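(* Let $n\geq 2$ and let $f$ belong to either $\mathcal{E}'(\mathbb{R}^n)$ or $C_\infty(\mathbb{R}^n)$. Let $d\in\mathbb{N}$ be odd such that $0<d<n$. If $N_d f|_V=0$ and $f|_V=0$ for some nonempty open set $V\subset\mathbb{R}^n$, then $f=0$.
   Context: $\mathcal{E}'(\mathbb{R}^n)$ is the space of compactly supported distributions. $C_\infty(\mathbb{R}^n)$ is the space of continuous functions $f$ on $\mathbb{R}^n$ such that $(1+|x|^2)^{N/2}f(x)$ is bounded for every $N\in\mathbb{N}$. Let $\mathbf{P}^d$ be the space of all $d$-dimensional affine planes in $\mathbb{R}^n$. The $d$-plane transform of a function $f$ is $R_df(A)=\int_{x\in A}f(x)\,dm(x)$, $A\in\mathbf{P}^d$, with $m$ the $d$-dimensional Hausdorff measure on $A$; its adjoint is $R_d^*g(x)=\int_{A\ni x}g(A)\,d\mu(A)$ for functions $g$ on $\mathbf{P}^d$, with $\mu$ the rotation invariant (normalized) measure on the $d$-planes through $x$. The normal operator is $N_d=R_d^*R_d$. For compactly supported distributions the operators are defined by duality: $\langle R_df,\psi\rangle=\langle f,R_d^*\psi\rangle$ for $\psi\in C^\infty(\mathbf{P}^d)$ and $\langle R_d^*g,\varphi\rangle=\langle g,R_d\varphi\rangle$ for $\varphi\in C_c^\infty(\mathbb{R}^n)$, so $N_d:\mathcal{E}'(\mathbb{R}^n)\to\mathcal{D}'(\mathbb{R}^n)$. In both cases $N_df=c_{n,d}\,(f*|\cdot|^{-(n-d)})$ with a positive constant $c_{n,d}$ depending only on $n$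 and $d$. *)

(* Defs.v *)
From HB Require Import structures.
From mathcomp Require Import all_boot all_order all_algebra.
From mathcomp Require Import all_classical all_reals all_analysis.
From mathcomp Require Import complex.

Set Implicit Arguments.
Unset Strict Implicit.
Unset Printing Implicit Defensive.

Import Order.TTheory GRing.Theory Num.Theory.
Import numFieldNormedType.Exports.

Local Open Scope classical_set_scope.
Local Open Scope complex_scope.
Local Open Scope ring_scope.

(* The norm that the library puts on 'rV[R]_n is the max norm. It induces the
   usual topology, but lengths and diameters below are Euclidean. *)
Definition euclidean_norm (R : realType) (n : nat) (x : 'rV[R]_n) : R :=
  Num.sqrt (\sum_(i < n) x 0 i ^+ 2).

(* Volume of the unit ball of R^k:
   omega_0 = 1, omega_1 = 2, omega_(k+2) = 2 pi / (k+2) * omega_k. *)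
Fixpoint unit_ball_volume (R : realType) (k : nat) : R :=
  match k with
  | 0 => 1
  | 1 => 2
  | (k'.+1 as k1).+1 => 2 * pi / k1.+1%:R * unit_ball_volume R k'
  end.

Section hausdorff.
Local Open Scope ereal_scope.
Variables (R : realType) (n : nat).
Implicit Types (A U : set 'rV[R]_n).

(* Meant for U nonempty: the supremum of the empty set is -oo. *)
Definition diameter U : \bar R :=
  ereal_sup [set (euclidean_norm (p.1 - p.2))%:E | p in U `*` U].

Definition hausdorff_gauge (d : nat) U : \bar R :=
  if U == set0 then 0
  else (unit_ball_volume R d / 2 ^+ d)%:E * diameter U ^+ d.

Definition hausdorff_cover (delta : R) A : set (nat -> set 'rV[R]_n) :=
  [set F | A `<=` \bigcup_k F k /\ forall k, diameter (F k) <= delta%:E].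

Definition hausdorff_content (d : nat) (delta : R) A : \bar R :=
  ereal_inf [set \sum_(k <oo) hausdorff_gauge d (F k)
            | F in hausdorff_cover delta A].

(* The factor omega_d / 2^d in the gauge makes this agree with Lebesgue measure
   on d-dimensional planes. *)
Definition hausdorff (d : nat) A : \bar R :=
  ereal_sup [set hausdorff_content d delta A | delta in [set r : R | (0 < r)%R]].

Lemma unit_ball_volume_ge0 k : (0 <= unit_ball_volume R k)%R.
Proof.
suff: (0 <= unit_ball_volume R k)%R /\ (0 <= unit_ball_volume R k.+1)%R by case.
elim: k => [|k [h0 h1]]; split=> //=.
by rewrite mulr_ge0// divr_ge0// mulr_ge0// pi_ge0.
Qed.

Lemma hausdorff_gauge0 d : hausdorff_gauge d set0 = 0.
Proof. by rewrite /hausdorff_gauge eqxx. Qed.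

Lemma diameter_ge0 U : U != set0 -> 0 <= diameter U.
Proof.
move=> /set0P[x Ux]; apply: ereal_sup_ubound; exists (x, x) => //=.
rewrite subrr /euclidean_norm big1 ?sqrtr0// => i _.
by rewrite mxE expr0n.
Qed.

Lemma hausdorff_gauge_ge0 d U : 0 <= hausdorff_gauge d U.
Proof.
rewrite /hausdorff_gauge; case: ifPn => // U0.
rewrite mule_ge0 ?expe_ge0 ?diameter_ge0// lee_fin.
by rewrite divr_ge0 ?exprn_ge0// unit_ball_volume_ge0.
Qed.

Lemma diameter_set0 (delta : R) : diameter set0 <= delta%:E.
Proof.
rewrite /diameter setX0 image_set0 ereal_sup0; exact: leNye.
Qed.

Lemma hausdorff_content_ge0 d delta A : 0 <= hausdorff_content d delta A.
Proof.
apply: le_ereal_inf_tmp => _ [F _ <-].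
by apply: nneseries_ge0 => *; exact: hausdorff_gauge_ge0.
Qed.

Lemma hausdorff_content0 d delta : hausdorff_content d delta set0 = 0.
Proof.
apply/eqP; rewrite eq_le hausdorff_content_ge0 andbT.
apply: ereal_inf_lbound; exists (fun=> set0).
  by split=> // k; exact: diameter_set0.
by rewrite eseries0// => *; exact: hausdorff_gauge0.
Qed.

Lemma le_hausdorff_content d delta :
  {homo hausdorff_content d delta : A B / A `<=` B >-> A <= B}.
Proof.
move=> A B AB; apply: ereal_inf_le_tmp => x /= [F [BF dF] xE].
by exists F => //; split=> //; exact: subset_trans BF.
Qed.

Lemma hausdorff_content_sigma_subadditive d delta :
  sigma_subadditive (hausdorff_content d delta).
Proof.
pose T := g_sigma_algebraType [set: set 'rV[R]_n].
pose g (U : set T) :=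
  if diameter U <= delta%:E then hausdorff_gauge d U else +oo.
have g0 : g set0 = 0 by rewrite /g diameter_set0 hausdorff_gauge0.
have g_ge0 U : 0 <= g U.
  by rewrite /g; case: ifP => // _; exact: hausdorff_gauge_ge0.
suff -> : hausdorff_content d delta = @mu_ext _ T R g.
  by have := @mu_ext_sigma_subadditive _ T R g g_ge0; apply.
apply/funext => A; apply/eqP; rewrite eq_le; apply/andP; split.
- apply: le_ereal_inf_tmp => _ [F [_ AF] <-].
  have [[k Fk]|allF] := pselect (exists k, ~~ (diameter (F k) <= delta%:E)).
    rewrite (@eseries_pinfty _ _ _ k) ?leey//.
      by move=> m _; rewrite -ltNye (lt_le_trans _ (g_ge0 _)).
    by rewrite /g (negbTE Fk).
  have dF k : diameter (F k) <= delta%:E.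
    by apply: contrapT => /negP Fk; apply: allF; exists k.
  apply: ereal_inf_lbound; exists F => //.
  by apply: eq_eseriesr => k _; rewrite /g dF.
- apply: le_ereal_inf_tmp => _ [F [AF dF] <-].
  apply: ereal_inf_lbound; exists F.
    by split=> // k; apply: sub_sigma_algebra.
  by apply: eq_eseriesr => k _; rewrite /g dF.
Qed.

Lemma hausdorff_outer0 d : hausdorff d set0 = 0.
Proof.
rewrite /hausdorff; apply/eqP; rewrite eq_le; apply/andP; split.
  by apply: ge_ereal_sup => _ [r _ <-]; rewrite hausdorff_content0.
by apply: ereal_sup_ubound; exists 1%R => //=; exact: hausdorff_content0.
Qed.

Lemma hausdorff_outer_ge0 d A : 0 <= hausdorff d A.
Proof.
apply: (le_trans (hausdorff_content_ge0 d 1 A)).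
by apply: ereal_sup_ubound; exists 1%R => /=.
Qed.

Lemma le_hausdorff d : {homo hausdorff d : A B / A `<=` B >-> A <= B}.
Proof.
move=> A B AB; apply: ge_ereal_sup => _ [r r0 <-].
apply: le_trans (le_hausdorff_content d r AB) _.
by apply: ereal_sup_ubound; exists r.
Qed.

Lemma hausdorff_sigma_subadditive d : sigma_subadditive (hausdorff d).
Proof.
move=> F; apply: ge_ereal_sup => _ [r r0 <-].
apply: le_trans (hausdorff_content_sigma_subadditive d r F) _.
apply: lee_nneseries => [k _ _|k _]; first exact: hausdorff_content_ge0.
by apply: ereal_sup_ubound; exists r.
Qed.

HB.instance Definition _ d := isOuterMeasure.Build R 'rV[R]_n (hausdorff d)
  (hausdorff_outer0 d) (hausdorff_outer_ge0 d) (@le_hausdorff d)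
  (@hausdorff_sigma_subadditive d).

(* Caratheodory's restriction of the outer measure. *)
Definition hausdorff_measure (d : nat) :
    {measure set (caratheodory_type (hausdorff d)) -> \bar R} :=
  [the measure _ _ of
    ((hausdorff d : {outer_measure set 'rV[R]_n -> \bar R}) :
       set (caratheodory_type (hausdorff d)) -> \bar R)].

End hausdorff.

Definition complex_integral d (T : measurableType d) (R : realType)
    (mu : {measure set T -> \bar R}) (D : set T) (f : T -> R[i]) : R[i] :=
  (\int[mu]_(x in D) complex.Re (f x)) +i* (\int[mu]_(x in D) complex.Im (f x)).

(* The Grassmannian of d-dimensional linear subspaces L of R^n; L is encoded by
   the matrix of the orthogonal projection onto it (acting on row vectors). *)
Definition grassmannian (R : realType) (n d : nat) : set 'M[R]_n :=
  [set P | [/\ P *m P = P, P^T = P & \rank P = d]].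

(* The plane x + L, L being the row space of P. *)
Definition affine_plane (R : realType) (n : nat) (x : 'rV[R]_n) (P : 'M[R]_n) :
    set 'rV[R]_n := [set x + v *m P | v in [set: 'rV[R]_n]].

Notation borel_matrix R n := (g_sigma_algebraType (@open 'M[R]_n)).

(* For U orthogonal, U^T P U is the projection onto the image of L under the
   isometry v |-> v U. *)
Definition rotation_invariant (R : realType) (n d : nat)
    (mu : probability (borel_matrix R n) R) : Prop :=
  mu (grassmannian d) = 1%E /\
  forall (U : 'M[R]_n) (B : set (borel_matrix R n)),
    U *m U^T = 1%:M -> measurable B ->
    mu [set P : 'M[R]_n | B (U^T *m P *m U)] = mu B.

(* Functions on P^d are represented by functions on all subsets of R^n, of which
   only the values on d-dimensional affine planes are used. *)
Definition plane_transform (R : realType) (n d : nat) (f : 'rV[R]_n -> R[i])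
    (A : set 'rV[R]_n) : R[i] :=
  complex_integral (hausdorff_measure R n d) A f.

Definition plane_adjoint (R : realType) (n d : nat)
    (mu : probability (borel_matrix R n) R) (g : set 'rV[R]_n -> R[i])
    (x : 'rV[R]_n) : R[i] :=
  complex_integral mu (grassmannian d) (fun P => g (affine_plane x P)).

Definition normal_operator (R : realType) (n d : nat)
    (mu : probability (borel_matrix R n) R) (f : 'rV[R]_n -> R[i]) :
    'rV[R]_n -> R[i] :=
  plane_adjoint d mu (plane_transform d f).

Definition partial (R : realType) (n : nat) (i : 'I_n) (f : 'rV[R]_n -> R) :
    'rV[R]_n -> R := fun x => 'D_(delta_mx 0 i) f x.

Definition partials (R : realType) (n : nat) (s : seq 'I_n)
    (f : 'rV[R]_n -> R) : 'rV[R]_n -> R := foldr (@partial R n) f s.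

Definition real_smooth (R : realType) (n : nat) (f : 'rV[R]_n -> R) : Prop :=
  forall s : seq 'I_n, continuous (partials s f) /\
    forall (i : 'I_n) (x : 'rV[R]_n),
      derivable (partials s f) x (delta_mx 0 i).

Definition smooth (R : realType) (n : nat) (f : 'rV[R]_n -> R[i]) : Prop :=
  real_smooth (fun x => complex.Re (f x)) /\
  real_smooth (fun x => complex.Im (f x)).

Definition complex_partials (R : realType) (n : nat) (s : seq 'I_n)
    (f : 'rV[R]_n -> R[i]) (x : 'rV[R]_n) : R[i] :=
  partials s (fun y => complex.Re (f y)) x +i*
  partials s (fun y => complex.Im (f y)) x.

Definition support (R : realType) (n : nat) (f : 'rV[R]_n -> R[i]) :
    set 'rV[R]_n := closure [set x | f x != 0].

Definition test_function (R : realType) (n : nat) (V : set 'rV[R]_n)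
    (phi : 'rV[R]_n -> R[i]) : Prop :=
  [/\ smooth phi, compact (support phi) & support phi `<=` V].

(* E'(R^n), the dual of C^oo(R^n) with its Frechet topology: linear functionals u
   with |u phi| <= C * max_(|alpha| <= m) sup_K |d^alpha phi| for some compact K.
   Only the values of u on smooth functions are relevant. *)
Definition compactly_supported_distribution (R : realType) (n : nat)
    (u : ('rV[R]_n -> R[i]) -> R[i]) : Prop :=
  (forall (a : R[i]) (phi psi : 'rV[R]_n -> R[i]), smooth phi -> smooth psi ->
     u (fun x => a * phi x + psi x) = a * u phi + u psi) /\
  exists (K : set 'rV[R]_n) (m : nat) (C : R), compact K /\
    forall (phi : 'rV[R]_n -> R[i]) (M : R), smooth phi -> 0 <= M ->
      (forall (s : seq 'I_n) (x : 'rV[R]_n), (size s <= m)%N -> K x ->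
         `|complex_partials s phi x| <= M%:C) ->
      `|u phi| <= (C * M)%:C.

(* <R_d f, psi> = <f, R_d^* psi> *)
Definition dist_plane_transform (R : realType) (n d : nat)
    (mu : probability (borel_matrix R n) R) (u : ('rV[R]_n -> R[i]) -> R[i]) :
    (set 'rV[R]_n -> R[i]) -> R[i] :=
  fun psi => u (plane_adjoint d mu psi).

(* <R_d^* g, phi> = <g, R_d phi> *)
Definition dist_plane_adjoint (R : realType) (n d : nat)
    (g : (set 'rV[R]_n -> R[i]) -> R[i]) : ('rV[R]_n -> R[i]) -> R[i] :=
  fun phi => g (plane_transform d phi).

Definition dist_normal_operator (R : realType) (n d : nat)
    (mu : probability (borel_matrix R n) R) (u : ('rV[R]_n -> R[i]) -> R[i]) :
    ('rV[R]_n -> R[i]) -> R[i] :=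
  dist_plane_adjoint d (dist_plane_transform d mu u).

Definition dist_vanishes_on (R : realType) (n : nat) (V : set 'rV[R]_n)
    (u : ('rV[R]_n -> R[i]) -> R[i]) : Prop :=
  forall phi : 'rV[R]_n -> R[i], test_function V phi -> u phi = 0.

Definition C_infty (R : realType) (n : nat) (f : 'rV[R]_n -> R[i]) : Prop :=
  [/\ continuous (fun x => complex.Re (f x)),
      continuous (fun x => complex.Im (f x)) &
      forall N : nat, exists M : R, forall x : 'rV[R]_n,
        `|((1 + euclidean_norm x ^+ 2) `^ (N%:R / 2))%:C * f x| <= M%:C].

(* Main.v *)
Require Import Defs.
From mathcomp Require Import all_boot all_order all_algebra.
From mathcomp Require Import all_classical all_reals all_analysis.
From mathcomp Require Import complex.
From mathcomp Require Import measurable_realfun ring lra zify.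
Import Order.TTheory GRing.Theory Num.Theory.
Import numFieldNormedType.Exports.
Local Open Scope classical_set_scope.
Local Open Scope ring_scope.

Set Implicit Arguments.
Unset Strict Implicit.
Unset Printing Implicit Defensive.

(** Write I f for the mean of the integrals of f over the d-planes through the
    origin, so that N_d f at x is I applied to f(x + .).

    For functions, both I and the integral over R^n are positive linear
    functionals invariant under rotations and homogeneous under dilations, of
    degrees d and n.  Positive functionals with such symmetries are determined
    up to a constant and a power of |y| ([compare_functionals]), which gives
    I f = c * int f(y) |y|^-(n-d) dy with c > 0 when f vanishes near 0
    ([planes_mean_riesz]).  Move a point of V to the origin.  Then f vanishes
    on a ball around 0 and, for every small x,
      int f(y) |y - x|^-(n-d) dy = 0.
    The inversion z = y / |y|^2 turns the kernel into a power of a polynomial: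
    |y - x|^2 = |y|^2 D(x,z) with D(x,z) = 1 - 2 x.z + |x|^2 |z|^2.  Hence the
    functional L h = int f(y) |y|^-(n-d) h(y / |y|^2) dy, which lives on a
    compact ball of z, kills D(x,.)^-a for a = (n-d)/2 and all small x.  The
    Laplacian in x of D^-b is 2b (2b + 2 - n) |z|^2 D^(-b-1), so that
    differentiation in x shows that L kills |z|^2k D^(-a-k) for every k,
    provided that 2(a+k) + 2 never equals n, that is, d never equals 2k + 2.
    This is where d is odd.  The first derivatives in x then give all
    monomials, and x = 0 shows that L kills every polynomial in z
    ([moments_vanish]).  As L is integration against a continuous density,
    powers of a quadratic polynomial concentrating at a point show that the
    density has no positive value, and by symmetry that it is zero
    ([moments_nonpos], [real_unique_continuation]).

    For distributions, take a smooth phi supported near 0.  The convolution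
    x |-> u(phi(x - .)) is continuous with compact support, vanishes near a
    point of V, and so does its normal operator, because u commutes with I.
    By the first part it is zero.  Any smooth psi is a limit of mollifications
    of psi, and these are limits of Riemann sums of translates of phi, all in
    the seminorm that controls u; hence u psi = 0.  Both commutations, of u
    with I and of u with the integral, are one statement
    ([functional_swap]): u applied to an average of translates of phi is the
    average of u applied to the translates.

    In the measure theory, three facts on the Hausdorff measure H^k carry
    everything: similarities of ratio l multiply it by l^k
    ([hausdorff_similar]), open sets are measurable for it
    ([hausdorff_open_cara]), and balls of R^k have positive finite H^k-measure
    ([hausdorff_cube_fin], [hausdorff_cube_gt0]).  Functions are integrated
    under the decay condition [tame], which makes all integrals over planes
    converge uniformly. *)

(** * Euclidean norm and topology of row vectors *)

Section Dot.
Variable R : realType.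
Implicit Types n m : nat.

Definition dot n (x y : 'rV[R]_n) : R := \sum_(i < n) x 0 i * y 0 i.
Local Notation enorm := (@euclidean_norm R _).

Lemma dotC n (x y : 'rV[R]_n) : dot x y = dot y x.
Proof. by apply: eq_bigr => i _; rewrite mulrC. Qed.

Lemma dotDl n (x y z : 'rV[R]_n) : dot (x + y) z = dot x z + dot y z.
Proof. by rewrite -big_split; apply: eq_bigr => i _; rewrite mxE mulrDl. Qed.

Lemma dotZl n a (x y : 'rV[R]_n) : dot (a *: x) y = a * dot x y.
Proof. by rewrite mulr_sumr; apply: eq_bigr => i _; rewrite mxE mulrA. Qed.

Lemma dotNl n (x y : 'rV[R]_n) : dot (- x) y = - dot x y.
Proof. by rewrite -scaleN1r dotZl mulN1r. Qed.

Lemma dotDr n (x y z : 'rV[R]_n) : dot z (x + y) = dot z x + dot z y.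
Proof. by rewrite !(dotC z) dotDl. Qed.

Lemma dotZr n a (x y : 'rV[R]_n) : dot y (a *: x) = a * dot y x.
Proof. by rewrite !(dotC y) dotZl. Qed.

Lemma dotNr n (x y : 'rV[R]_n) : dot y (- x) = - dot y x.
Proof. by rewrite !(dotC y) dotNl. Qed.

Lemma dot0l n (x : 'rV[R]_n) : dot 0 x = 0.
Proof. by rewrite -(scale0r x) dotZl mul0r. Qed.

Lemma dot_mx n (x y : 'rV[R]_n) : x *m y^T = (dot x y)%:M.
Proof.
apply/matrixP => i j; rewrite !ord1 !mxE eqxx mulr1n.
by apply: eq_bigr => k _; rewrite mxE.
Qed.

Lemma dot_mulmx n m (x : 'rV[R]_n) (y : 'rV[R]_m) (A : 'M[R]_(n, m)) :
  dot (x *m A) y = dot x (y *m A^T).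
Proof.
have : (dot (x *m A) y)%:M = (dot x (y *m A^T))%:M :> 'M[R]_1.
  by rewrite -!dot_mx trmx_mul trmxK mulmxA.
by move=> /matrixP/(_ 0 0); rewrite !mxE eqxx !mulr1n.
Qed.

Lemma dot_ge0 n (x : 'rV[R]_n) : 0 <= dot x x.
Proof. by apply: sumr_ge0 => i _; rewrite -expr2 sqr_ge0. Qed.

Lemma sqr_enorm n (x : 'rV[R]_n) : enorm x ^+ 2 = dot x x.
Proof.
rewrite sqr_sqrtr; first by apply: eq_bigr => i _; rewrite expr2.
by apply: sumr_ge0 => i _; exact: sqr_ge0.
Qed.

Lemma enormE n (x : 'rV[R]_n) : enorm x = Num.sqrt (dot x x).
Proof. by congr Num.sqrt; apply: eq_bigr => i _; rewrite expr2. Qed.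

Lemma enorm_ge0 n (x : 'rV[R]_n) : 0 <= enorm x.
Proof. exact: sqrtr_ge0. Qed.

Lemma enorm0 n : enorm (0 : 'rV[R]_n) = 0.
Proof. by rewrite enormE dot0l sqrtr0. Qed.

Lemma enorm_eq0 n (x : 'rV[R]_n) : (enorm x == 0) = (x == 0).
Proof.
apply/idP/idP => [|/eqP->]; last by rewrite enorm0.
rewrite -sqrf_eq0 sqr_enorm psumr_eq0 => [/allP x0|i _]; last first.
  by rewrite -expr2 sqr_ge0.
apply/eqP/rowP => i; rewrite mxE; apply/eqP.
by rewrite -sqrf_eq0 expr2; apply: x0; rewrite mem_index_enum.
Qed.

Lemma enorm_gt0 n (x : 'rV[R]_n) : (0 < enorm x) = (x != 0).
Proof. by rewrite lt_def enorm_ge0 andbT enorm_eq0. Qed.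

Lemma enormZ n a (x : 'rV[R]_n) : enorm (a *: x) = `|a| * enorm x.
Proof. by rewrite !enormE dotZl dotZr mulrA -expr2 sqrtrM ?sqr_ge0// sqrtr_sqr. Qed.

Lemma enormN n (x : 'rV[R]_n) : enorm (- x) = enorm x.
Proof. by rewrite -scaleN1r enormZ normrN1 mul1r. Qed.

Lemma enormB n (x y : 'rV[R]_n) : enorm (x - y) = enorm (y - x).
Proof. by rewrite -opprB enormN. Qed.

(** Cauchy-Schwarz, from 0 <= |(x.x) y - (x.y) x|^2. *)
Lemma dot_le n (x y : 'rV[R]_n) : dot x y <= enorm x * enorm y.
Proof.
have [->|x0] := eqVneq x 0; first by rewrite dot0l enorm0 mul0r.
have A0 : 0 < dot x x by rewrite -sqr_enorm exprn_gt0// enorm_gt0.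
have := dot_ge0 (dot x x *: y - dot x y *: x).
rewrite dotDl !dotDr !dotNl !dotNr !dotZl !dotZr (dotC y x) => h.
apply: le_trans (ler_norm _) _.
rewrite -ler_sqr ?nnegrE ?mulr_ge0 ?enorm_ge0// (real_normK (num_real _)) exprMn !sqr_enorm.
rewrite -subr_ge0 -(pmulr_rge0 _ A0).
by apply: le_trans h _; rewrite le_eqVlt; apply/orP; left; apply/eqP; ring.
Qed.

Lemma ler_enormD n (x y : 'rV[R]_n) : enorm (x + y) <= enorm x + enorm y.
Proof.
rewrite -ler_sqr ?nnegrE ?addr_ge0 ?enorm_ge0// sqr_enorm sqrrD !sqr_enorm.
rewrite dotDl !dotDr (dotC y x); have := dot_le x y; lra.
Qed.

Lemma ler_enormB n (x y : 'rV[R]_n) : enorm (x - y) <= enorm x + enorm y.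
Proof. by rewrite -(enormN y) ler_enormD. Qed.

Lemma ler_enorm_dist n (x y : 'rV[R]_n) : enorm x - enorm y <= enorm (x - y).
Proof. by rewrite lerBlDr -{1}(subrK y x) ler_enormD. Qed.

Lemma ler_dist_enorm n (x y : 'rV[R]_n) : `|enorm x - enorm y| <= enorm (x - y).
Proof.
by rewrite ler_norml lerNl opprB {1}enormB !ler_enorm_dist.
Qed.

Lemma coord_le_enorm n (x : 'rV[R]_n) i : `|x 0 i| <= enorm x.
Proof.
rewrite -ler_sqr ?nnegrE ?enorm_ge0// sqr_enorm (real_normK (num_real _)) /dot (bigD1 i)//=.
by rewrite expr2 lerDl sumr_ge0// => j _; rewrite -expr2 sqr_ge0.
Qed.

Lemma coord_le_norm n (x : 'rV[R]_n) i : `|x 0 i| <= `|x|.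
Proof.
rewrite [leRHS]/Num.norm /= mx_normrE; apply/bigmax_geP; right => /=.
by exists (0, i).
Qed.

Lemma norm_leP n (x : 'rV[R]_n) e : 0 <= e ->
  (forall i, `|x 0 i| <= e) -> `|x| <= e.
Proof.
move=> e0 h; rewrite [leLHS]/Num.norm /= mx_normrE; apply/bigmax_leP; split => //.
by move=> [i j] _ /=; rewrite ord1.
Qed.

Lemma norm_le_enorm n (x : 'rV[R]_n) : `|x| <= enorm x.
Proof. by apply: norm_leP (enorm_ge0 _) _ => i; exact: coord_le_enorm. Qed.

Lemma enorm_le_norm n (x : 'rV[R]_n) : enorm x <= n%:R * `|x|.
Proof.
rewrite -ler_sqr ?nnegrE ?enorm_ge0 ?mulr_ge0// sqr_enorm exprMn.
apply: (@le_trans _ _ (\sum_(i < n) `|x| ^+ 2)).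
  apply: ler_sum => i _; rewrite -expr2 -(real_normK (num_real _)) lerXn2r ?nnegrE//.
  exact: coord_le_norm.
rewrite sumr_const card_ord -[leLHS]mulr_natl ler_wpM2r ?sqr_ge0//.
case: n {x} => [|n]; first by rewrite expr0n.
by rewrite expr2 ler_peMr// ler1n.
Qed.

Lemma enorm_isometry n m (B : 'M[R]_(n, m)) (x : 'rV[R]_n) :
  B *m B^T = 1%:M -> enorm (x *m B) = enorm x.
Proof. by move=> BB; rewrite !enormE dot_mulmx -mulmxA BB mulmx1. Qed.

Lemma delta_enorm n i : enorm (delta_mx 0 i : 'rV[R]_n) = 1.
Proof.
rewrite enormE /dot (bigD1 i)//= big1 => [|j ji]; rewrite !mxE ?eqxx /=.
  by rewrite mulr1 addr0 sqrtr1.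
by rewrite (negbTE ji) mul0r.
Qed.

Lemma dot_delta n i (x : 'rV[R]_n) : dot x (delta_mx 0 i) = x 0 i.
Proof.
rewrite /dot (bigD1 i)//= big1 => [|j ji]; rewrite !mxE ?eqxx /=.
  by rewrite mulr1 addr0.
by rewrite (negbTE ji) mulr0.
Qed.

End Dot.

Notation enorm := (@euclidean_norm _ _).

Section Topo.
Variable R : realType.

Lemma nbhs_enormP n (x : 'rV[R]_n) (A : set 'rV[R]_n) :
  nbhs x A <-> exists2 e, 0 < e & forall y, enorm (x - y) < e -> A y.
Proof.
split=> [/nbhs_ballP[e /= e0 h]|[e e0 h]].
  exists e => // y xy; apply: h; rewrite -ball_normE /=.
  exact: le_lt_trans (norm_le_enorm _) xy.
apply/nbhs_ballP; exists (e / n.+1%:R) => /=; first by rewrite divr_gt0.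
move=> y; rewrite -ball_normE /= => xy; apply: h.
apply: le_lt_trans (enorm_le_norm _) _.
apply: (@le_lt_trans _ _ (n.+1%:R * `|x - y|)).
  by rewrite ler_wpM2r// ler_nat.
by rewrite mulrC -ltr_pdivlMr.
Qed.

Lemma continuous_enormP n (f : 'rV[R]_n -> R) (x : 'rV[R]_n) :
  {for x, continuous f} <->
  forall e, 0 < e -> exists2 d, 0 < d &
    forall y, enorm (x - y) < d -> `|f x - f y| < e.
Proof.
rewrite /prop_for /continuous_at.
have P := @cvgrPdist_lt R R _ (nbhs x) (nbhs_filter x) f (f x).
split=> [/P h e e0|h].
  by have /nbhs_enormP := h e e0.
apply/P => e e0; apply/nbhs_enormP; exact: h.
Qed.

Lemma enorm_lip_continuous n m (g : 'rV[R]_n -> 'rV[R]_m) (C : R) :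
  (forall x y, enorm (g x - g y) <= C * enorm (x - y)) -> continuous g.
Proof.
move=> h x A /nbhs_enormP[e e0 eA]; apply/nbhs_enormP.
exists (e / (`|C| + 1)) => [|y]; first by rewrite divr_gt0// ltr_wpDl.
rewrite ltr_pdivlMr ?ltr_wpDl// => xy; apply: eA.
apply: le_lt_trans (h _ _) _; apply: le_lt_trans xy.
rewrite mulrC ler_wpM2l ?enorm_ge0// (le_trans (ler_norm _))// lerDl//.
Qed.

Lemma enorm_continuous n : continuous (@euclidean_norm R n).
Proof.
move=> x; apply/continuous_enormP => e e0; exists e => // y xy.
exact: le_lt_trans (ler_dist_enorm _ _) xy.
Qed.

Lemma dot_continuous n (a : 'rV[R]_n) : continuous (fun x : 'rV[R]_n => dot a x).
Proof.
move=> x; apply/continuous_enormP => e e0.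
have C0 : 0 < enorm a + 1 by rewrite ltr_wpDl// enorm_ge0.
exists (e / (enorm a + 1)) => [|y]; first by rewrite divr_gt0.
rewrite ltr_pdivlMr// => xy.
rewrite -dotNr -dotDr; apply: le_lt_trans xy.
have h z : dot a z <= enorm z * (enorm a + 1).
  by apply: le_trans (dot_le _ _) _; rewrite mulrC ler_wpM2l ?enorm_ge0// lerDl.
by rewrite ler_norml lerNl h andbT -dotNr -enormN h.
Qed.

(** Heine-Cantor; only one of the two points has to lie in the compact set. *)
Lemma unif_cont n (f : 'rV[R]_n -> R) (K : set 'rV[R]_n) e :
  compact K -> (forall x, K x -> {for x, continuous f}) -> 0 < e ->
  exists2 d, 0 < d & forall x y, K x -> enorm (x - y) < d -> `|f x - f y| < e.
Proof.
move=> /compact_near_coveringP cK cf e0.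
have /nbhs_enormP[d d0 h] : nbhs (0 : 'rV[R]_n)
    [set v | K `<=` (fun x => `|f x - f (x + v)| < e)].
  apply: (cK _ (nbhs (0 : 'rV[R]_n)) (fun v x => `|f x - f (x + v)| < e)).
  move=> x Kx; have /continuous_enormP/(_ (e / 2)) := cf _ Kx.
  case=> [|d d0 fd]; first by rewrite divr_gt0.
  have dd : 0 < d / 2 by rewrite divr_gt0.
  exists ([set y | enorm (x - y) < d / 2], [set v | enorm (0 - v) < d / 2]).
    by split; apply/nbhs_enormP; exists (d / 2).
  move=> [y v] /= [xy]; rewrite sub0r enormN => vd.
  have h1 : `|f x - f y| < e / 2 by apply: fd; apply: lt_le_trans xy _; lra.
  have h2 : `|f x - f (y + v)| < e / 2.
    apply: fd; rewrite opprD addrA.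
    by apply: le_lt_trans (ler_enormB _ _) _; lra.
  rewrite -(subrK (f x) (f y)) -addrA (le_lt_trans (ler_normD _ _))//.
  by rewrite distrC; lra.
exists d => // x y Kx xy.
  have := h (y - x) _ x Kx; rewrite [x + _]addrC subrK; apply.
by rewrite sub0r opprB.
Qed.

Lemma closed_eball n (x : 'rV[R]_n) r : closed [set y | enorm (y - x) <= r].
Proof.
have -> : [set y | enorm (y - x) <= r] =
    (fun y : 'rV[R]_n => enorm (y - x)) @^-1` [set t | t <= r] by [].
apply: preimage_closed; last exact: closed_le.
move=> y _; apply/continuous_enormP => e e0; exists e => // z yz.
apply: le_lt_trans (ler_dist_enorm _ _) _.
by rewrite opprB addrA subrK.
Qed.

Lemma compact_eball n (x : 'rV[R]_n) r : compact [set y | enorm (y - x) <= r].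
Proof.
apply: bounded_closed_compact (@closed_eball _ _ _).
exists (enorm x + r); split; first exact: num_real.
move=> M hM y /= yr; apply: le_trans (norm_le_enorm _) _.
rewrite -(subrK x y); apply: le_trans (ler_enormD _ _) _.
by rewrite addrC (le_trans _ (ltW hM))// lerD2l.
Qed.

End Topo.

(** * Hausdorff measure: similarities and separated sets *)

Section HausdorffLip.
Local Open Scope ereal_scope.
Variable R : realType.

Lemma expe_le (x y : \bar R) k : 0 <= x -> x <= y -> x ^+ k <= y ^+ k.
Proof.
move=> x0 xy; elim: k => [|k IH]; first by rewrite !expe0.
by rewrite !expeS lee_pmul// expe_ge0.
Qed.

Lemma expeZ (l : R) (x : \bar R) k : (0 < l)%R ->
  (l%:E * x) ^+ k = (l ^+ k)%:E * x ^+ k.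
Proof.
move=> l0; elim: k => [|k IH]; first by rewrite !expe0 mule1.
by rewrite !expeS IH exprS EFinM muleACA.
Qed.

Lemma diameter_le n (U : set 'rV[R]_n) (r : \bar R) :
  (forall x y, U x -> U y -> (enorm (x - y))%:E <= r) -> diameter U <= r.
Proof. by move=> h; apply: ge_ereal_sup => _ [[x y] [Ux Uy] <-]; exact: h. Qed.

Lemma le_diameter n (U : set 'rV[R]_n) x y :
  U x -> U y -> (enorm (x - y))%:E <= diameter U.
Proof. by move=> Ux Uy; apply: ereal_sup_ubound; exists (x, y). Qed.

Section Lip.
Variables (m n d : nat) (g : 'rV[R]_m -> 'rV[R]_n) (l : R) (A : set 'rV[R]_m).
Hypothesis l0 : (0 < l)%R.
Hypothesis gl : forall x y, A x -> A y -> (enorm (g x - g y) <= l * enorm (x - y))%R.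

Lemma diameter_lip U : diameter (g @` (U `&` A)) <= l%:E * diameter U.
Proof.
apply: diameter_le => _ _ [x [Ux Ax] <-] [y [Uy Ay] <-].
apply: (@le_trans _ _ (l%:E * (enorm (x - y))%:E)).
  by rewrite -EFinM lee_fin gl.
by apply: lee_wpmul2l; [rewrite lee_fin ltW|exact: le_diameter].
Qed.

Lemma gauge_lip U :
  hausdorff_gauge d (g @` (U `&` A)) <= (l ^+ d)%:E * hausdorff_gauge d U.
Proof.
rewrite {1}/hausdorff_gauge; case: ifPn => [_|/[dup] /set0P[_ [x [Ux Ax] _]] h].
  by rewrite mule_ge0 ?hausdorff_gauge_ge0// lee_fin exprn_ge0// ltW.
rewrite /hausdorff_gauge ifF; last by apply/negbTE/set0P; exists x.
rewrite muleCA lee_wpmul2l//.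
  by rewrite lee_fin divr_ge0 ?exprn_ge0// unit_ball_volume_ge0.
by rewrite -expeZ// expe_le ?diameter_ge0 ?diameter_lip.
Qed.

(** A cover of A with mesh r / l is mapped to a cover of the image with mesh r,
    and each gauge grows by at most l^d. *)
Lemma hausdorff_lip : hausdorff d (g @` A) <= (l ^+ d)%:E * hausdorff d A.
Proof.
have ld : (0 < l ^+ d)%R by rewrite exprn_gt0.
apply: ge_ereal_sup => _ [r /= r0 <-].
apply: (@le_trans _ _ ((l ^+ d)%:E * hausdorff_content d (r / l) A)); last first.
  apply: lee_wpmul2l; first by rewrite lee_fin ltW.
  by apply: ereal_sup_ubound; exists (r / l)%R => //=; rewrite divr_gt0.
rewrite -lee_pdivrMl//; apply: le_ereal_inf_tmp => _ [F [AF dF] <-].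
rewrite lee_pdivrMl// -nneseriesZl; last by move=> *; exact: hausdorff_gauge_ge0.
apply: (@le_trans _ _ (\sum_(k <oo) hausdorff_gauge d (g @` (F k `&` A)))).
  apply: ereal_inf_lbound; exists (fun k => g @` (F k `&` A)) => //.
  split=> [_ [x Ax <-]|k]; first by have [k _ Fx] := AF x Ax; exists k => //; exists x.
  apply: le_trans (diameter_lip _) _; rewrite -lee_pdivlMl//.
  by apply: le_trans (dF k) _; rewrite -EFinM lee_fin mulrC.
by apply: lee_nneseries => [k _ _|k _]; [exact: hausdorff_gauge_ge0|exact: gauge_lip].
Qed.

End Lip.

(** Both the similarity and its inverse, defined on the image only, are
    Lipschitz. *)
Lemma hausdorff_similar m n d (j : 'rV[R]_m -> 'rV[R]_n) (l : R) A :
  (0 < l)%R -> (forall x y, enorm (j x - j y) = l * enorm (x - y))%R ->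
  hausdorff d (j @` A) = (l ^+ d)%:E * hausdorff d A.
Proof.
move=> l0 jl; apply/eqP; rewrite eq_le; apply/andP; split.
  by apply: hausdorff_lip => // x y _ _; rewrite jl.
have ji : injective j.
  move=> x y /eqP; rewrite -subr_eq0 -enorm_eq0 jl mulf_eq0 gt_eqF//= enorm_eq0.
  by rewrite subr_eq0 => /eqP.
pose g y := if pselect (exists x, j x = y) is left h then sval (cid h) else 0%R.
have gj x : g (j x) = x.
  rewrite /g; case: pselect => [h|[]]; last by exists x.
  by apply: ji; case: cid.
have := @hausdorff_lip n m d g l^-1 (j @` A).
rewrite invr_gt0 => /(_ l0).
rewrite image_comp (_ : g \o j = id); last by apply/funext => x; exact: gj.
rewrite image_id exprVn lee_pdivlMl ?exprn_gt0//; apply.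
move=> _ _ [x _ <-] [y _ <-]; rewrite !gj jl mulrA mulVf ?mul1r//.
by rewrite gt_eqF.
Qed.

Lemma content_antitone n d (A : set 'rV[R]_n) r s : (r <= s)%R ->
  hausdorff_content d s A <= hausdorff_content d r A.
Proof.
move=> rs; apply: ereal_inf_le_tmp => _ [F [AF dF] <-]; exists F => //.
by split=> // k; apply: le_trans (dF k) _; rewrite lee_fin.
Qed.

Lemma ereal_supD_le (S T : set (\bar R)) c :
  (forall x, S x -> 0 <= x) -> (forall x, T x -> 0 <= x) ->
  S !=set0 -> T !=set0 ->
  (forall x y, S x -> T y -> x + y <= c) -> ereal_sup S + ereal_sup T <= c.
Proof.
move=> S0 T0 [s Ss] [t Tt] h.
have [->|cf] := eqVneq c +oo; first by rewrite leey.
have cfin : c \is a fin_num.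
  rewrite ge0_fin_numE ?ltey//; apply: le_trans (h _ _ Ss Tt).
  by apply: adde_ge0; [exact: S0|exact: T0].
have fS x : S x -> x \is a fin_num.
  move=> Sx; rewrite ge0_fin_numE; last exact: S0.
  apply: le_lt_trans (_ : c < +oo).
    by apply: le_trans (h _ _ Sx Tt); apply: leeDl; exact: T0.
  by rewrite ltey.
have h1 x : S x -> ereal_sup T <= c - x.
  by move=> Sx; apply: ge_ereal_sup => y Ty; rewrite leeBrDl ?fS// h.
have fT : ereal_sup T \is a fin_num.
  rewrite ge0_fin_numE; last exact: le_trans (T0 _ Tt) (ereal_sup_ubound Tt).
  by apply: le_lt_trans (h1 _ Ss) _; rewrite ltey_eq fin_numB cfin fS.
rewrite -leeBrDr//; apply: ge_ereal_sup => x Sx.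
by rewrite leeBrDr// addeC -leeBrDr ?fS// h1.
Qed.

(** In a cover of mesh below the distance of A and B no set meets both, so the
    cover splits into a cover of A and a cover of B. *)
Lemma hausdorff_separated n d (A B : set 'rV[R]_n) (e : R) : (0 < e)%R ->
  (forall x y, A x -> B y -> (e <= enorm (x - y))%R) ->
  hausdorff d A + hausdorff d B <= hausdorff d (A `|` B).
Proof.
move=> e0 AB.
have cge0 C x : [set hausdorff_content d r C | r in [set r : R | (0 < r)%R]] x -> 0 <= x.
  by move=> [r _ <-]; exact: hausdorff_content_ge0.
apply: ereal_supD_le.
- exact: cge0.
- exact: cge0.
- by exists (hausdorff_content d 1 A), 1%R => //=.
- by exists (hausdorff_content d 1 B), 1%R => //=.
move=> _ _ [r1 /= r10 <-] [r2 /= r20 <-].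
pose r := (Num.min (Num.min r1 r2) (e / 2))%R.
have r0 : (0 < r)%R by rewrite !lt_min r10 r20 divr_gt0.
apply: (@le_trans _ _ (hausdorff_content d r A + hausdorff_content d r B)).
  by rewrite leeD// content_antitone// !ge_min lexx ?orbT.
apply: (@le_trans _ _ (hausdorff_content d r (A `|` B))); last first.
  by apply: ereal_sup_ubound; exists r.
apply: le_ereal_inf_tmp => _ [F [ABF dF] <-].
pose FA k := if pselect (F k `&` A !=set0) is left _ then F k else set0.
pose FB k := if pselect (F k `&` B !=set0) is left _ then F k else set0.
apply: (@le_trans _ _ (\sum_(k <oo) hausdorff_gauge d (FA k) +
                       \sum_(k <oo) hausdorff_gauge d (FB k))).
  apply: leeD; apply: ereal_inf_lbound.
  - exists FA => //; split=> [x Ax|k]; last first.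
      by rewrite /FA; case: pselect => // _; exact: diameter_set0.
    have [k _ Fx] := ABF x (or_introl Ax); exists k => //.
    by rewrite /FA; case: pselect => // -[]; exists x.
  - exists FB => //; split=> [x Ax|k]; last first.
      by rewrite /FB; case: pselect => // _; exact: diameter_set0.
    have [k _ Fx] := ABF x (or_intror Ax); exists k => //.
    by rewrite /FB; case: pselect => // -[]; exists x.
rewrite -nneseriesD; try by move=> *; exact: hausdorff_gauge_ge0.
apply: lee_nneseries => [k _ _|k _]; first by rewrite adde_ge0 ?hausdorff_gauge_ge0.
rewrite /FA /FB; case: pselect => [[x [Fx Ax]]|_]; case: pselect => [[y [Fy By]]|_];
  rewrite ?hausdorff_gauge0 ?adde0 ?add0e ?hausdorff_gauge_ge0//.
have := le_trans (le_diameter Fx Fy) (dF k).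
rewrite lee_fin => h; have := le_trans (AB _ _ Ax By) h.
by rewrite le_min => /andP[_ ?]; exfalso; lra.
Qed.

End HausdorffLip.

(** * Measurability of open sets for the Hausdorff measure *)

Section Cara.
Local Open Scope ereal_scope.
Variable R : realType.

Lemma nneseries_le_bound (u : nat -> \bar R) c : (forall i, 0 <= u i) ->
  (forall n, \sum_(0 <= i < n) u i <= c) -> \sum_(i <oo) u i <= c.
Proof.
move=> u0 h; apply: lime_le; first exact: is_cvg_nneseries.
by near=> n; exact: h.
Unshelve. all: by end_near. Qed.

(** Caratheodory's criterion for metric outer measures.  With A_j the points of
    X at distance at least 1/(j+1) from the complement of U, the shells
    A_(j+1) - A_j are separated when their indices differ by at least 2, so
    their measures are summable and the measure of A_j tends to that of the
    intersection of X and U. *)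
Lemma hausdorff_open_cara n d (U : set 'rV[R]_n) : open U ->
  (hausdorff d).-caratheodory U.
Proof.
move=> oU; apply: le_caratheodory_measurable => X.
have [Xoo|Xoo] := eqVneq (hausdorff d X) +oo.
  by rewrite [leRHS](_ : _ = +oo) ?leey.
change (hausdorff d (X `&` U) + hausdorff d (X `&` ~` U) <= hausdorff d X).
pose far j := [set x : 'rV[R]_n | forall c, ~ U c -> (j.+1%:R^-1 <= enorm (x - c))%R].
pose A j := X `&` far j.
pose D j := A j.+1 `\` A j.
have farS j : far j `<=` far j.+1.
  by move=> x xj c /xj; apply: le_trans; rewrite lef_pV2 ?posrE// ler_nat.
have AS j : A j `<=` A j.+1 by move=> x [Xx /farS].
have AX j : hausdorff d (A j) <= hausdorff d X by apply: le_hausdorff => x [].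
have sep j : hausdorff d (A j) + hausdorff d (D j.+1) <= hausdorff d (A j.+2).
  apply: (@le_trans _ _ (hausdorff d (A j `|` D j.+1))); last first.
    by apply: le_hausdorff => x [/AS/AS|[]].
  apply: (@hausdorff_separated _ _ _ _ _ (j.+1%:R^-1 - j.+2%:R^-1)).
    by rewrite subr_gt0 ltf_pV2 ?posrE// ltr_nat.
  move=> x y [_ xj] [[Xy _] yj].
  have [c [Uc /negP cj]] : exists c, ~ U c /\ ~ (j.+2%:R^-1 <= enorm (y - c))%R.
    apply: contrapT => h; apply: yj; split=> // c Uc; apply: contrapT => cj.
    by apply: h; exists c.
  have := xj c Uc; rewrite -ltNge in cj.
  have := ler_enormD (x - y) (y - c); rewrite addrA subrK => h1 h2.
  by rewrite lerBlDr (le_trans h2)// (le_trans h1)// lerD2l ltW.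
have bound k : \sum_(0 <= i < k.+1) hausdorff d (D i) <=
    hausdorff d (A k.+1) + hausdorff d (A k).
  elim: k => [|k IH].
    rewrite big_nat1 -[leLHS]adde0; apply: leeD; last exact: hausdorff_outer_ge0.
    by apply: le_hausdorff => x [].
  rewrite big_nat_recr//=; apply: le_trans (leeD IH (lexx _)) _.
  by rewrite -addeA addeC leeD2r.
have Dsum : \sum_(i <oo) hausdorff d (D i) < +oo.
  apply: (@le_lt_trans _ _ (hausdorff d X + hausdorff d X)).
    apply: nneseries_le_bound => [i|[|k]]; first exact: hausdorff_outer_ge0.
      by rewrite big_geq// adde_ge0// hausdorff_outer_ge0.
    by apply: le_trans (bound _) _; exact: leeD.
  by rewrite lte_add_pinfty// ltey.
have tail : \sum_(N <= i <oo) hausdorff d (D i) @[N --> \oo] --> 0.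
  by apply: nneseries_tail_cvg => // k _; exact: hausdorff_outer_ge0.
have key N : hausdorff d (X `&` U) + hausdorff d (X `&` ~` U) <=
   hausdorff d X + \sum_(N <= i <oo) hausdorff d (D i).
  have h1 : hausdorff d (X `&` U) <=
      hausdorff d (A N) + \sum_(N <= i <oo) hausdorff d (D i).
    apply: le_trans (leeD (lexx _)
      (outer_measure_sigma_subadditive_tail (hausdorff d) N D)).
    apply: le_trans (outer_measureU2 (hausdorff d) _ _); apply: le_hausdorff.
    move=> x [Xx Ux].
    have [m xm] : exists m, far m x.
      have /nbhs_enormP[e e0 he] := oU x Ux.
      exists (Num.truncn e^-1) => c Uc; rewrite leNgt; apply/negP => xc; apply: Uc.
      apply: he; apply: lt_trans xc _; rewrite invf_plt ?posrE//.
      exact: truncnS_gt.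
    have [xN|xN] := pselect (far N x); first by left.
    have : exists k, far (N + k.+1)%N x /\ ~ far (N + k)%N x.
      apply: contrapT => h; apply: xN.
      have xNm : far (N + m)%N x.
        by elim: N {h} => [|N IH]; rewrite ?addSn//; exact: farS.
      elim: m xNm {xm} => [|m IH]; first by rewrite addn0.
      by move=> xm; apply: IH; apply: contrapT => xm'; apply: h; exists m.
    move=> [k [xk xk']]; right; exists (N + k)%N => /=.
      by apply/negP; rewrite -leqNgt leq_addr.
    split=> //; last by case.
    by split=> //; rewrite -addnS.
  apply: le_trans (leeD h1 (lexx _)) _.
  rewrite addeAC leeD2r// addeC.
  apply: (@le_trans _ _ (hausdorff d ((X `&` ~` U) `|` A N))).
    apply: (@hausdorff_separated _ _ _ _ _ N.+1%:R^-1) => //.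
    by move=> x y [_ Ux] [_ yN]; rewrite enormB yN.
  by apply: le_hausdorff => x [[]|[]].
rewrite -[leRHS]adde0.
have tX : (hausdorff d X + \sum_(N <= i <oo) hausdorff d (D i)) @[N --> \oo]
    --> hausdorff d X + 0.
  apply: cvgeD; [|exact: cvg_cst|exact: tail].
  by rewrite fin_num_adde_defl.
rewrite -(cvg_lim _ tX)//; apply: lime_ge; first by apply/cvg_ex; exists (hausdorff d X + 0).
by near=> N; exact: key.
Unshelve. all: by end_near. Qed.

End Cara.

(** * Hausdorff measure of the unit cube *)

Section Cube.
Variable R : realType.

Definition unit_cube k := [set x : 'rV[R]_k | forall i, 0 <= x 0 i <= 1].

Lemma unit_ball_volume_gt0 k : 0 < unit_ball_volume R k.
Proof.
suff: 0 < unit_ball_volume R k /\ 0 < unit_ball_volume R k.+1 by case.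
elim: k => [|k [h0 h1]]; split=> //=.
by rewrite mulr_gt0// divr_gt0// mulr_gt0// pi_gt0.
Qed.

Lemma content_fin_cover n d (T : finType) (G : T -> set 'rV[R]_n) A (delta g : R) :
  0 <= g -> A `<=` \bigcup_t G t ->
  (forall t, (diameter (G t) <= delta%:E)%E) ->
  (forall t, (hausdorff_gauge d (G t) <= g%:E)%E) ->
  (hausdorff_content d delta A <= (#|T|%:R * g)%:E)%E.
Proof.
move=> g0 AG dG gG; pose s := [seq G t | t <- enum T].
have gs U : U \in s -> (hausdorff_gauge d U <= g%:E)%E.
  by move=> /mapP[t _ ->].
have ds U : U \in s -> (diameter U <= delta%:E)%E by move=> /mapP[t _ ->].
apply: (@le_trans _ _ (\sum_(k <oo) hausdorff_gauge d (nth set0 s k))%E).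
  apply: ereal_inf_lbound; exists (nth set0 s) => //; split=> [x Ax|k].
    have [t _ Gx] := AG x Ax; exists (index t (enum T)) => //.
    by rewrite (nth_map t) ?index_mem ?mem_enum// nth_index ?mem_enum.
  have [ks|ks] := ltnP k (size s); first by rewrite ds// mem_nth.
  by rewrite nth_default//; exact: diameter_set0.
rewrite cardE -(size_map G) -/s; move: s gs {ds} => s gs.
apply: nneseries_le_bound => [k|k]; first exact: hausdorff_gauge_ge0.
elim: s k gs => [|U s IH] k gs.
  rewrite mul0r big1// => i _.
  by rewrite nth_nil hausdorff_gauge0.
case: k => [|k]; first by rewrite big_geq// lee_fin mulr_ge0.
rewrite big_nat_recl//=.
have -> : (size s).+1%:R * g = g + (size s)%:R * g by rewrite -natr1; ring.
rewrite EFinD leeD//.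
  by rewrite gs// mem_head.
by apply: IH => V Vs; rewrite gs// in_cons Vs orbT.
Qed.

Lemma gauge_le n d (U : set 'rV[R]_n) (r : R) : 0 <= r -> 
  (diameter U <= r%:E)%E ->
  (hausdorff_gauge d U <= (unit_ball_volume R d / 2 ^+ d * r ^+ d)%:E)%E.
Proof.
move=> r0 Ur; have c0 : 0 <= unit_ball_volume R d / 2 ^+ d.
  by rewrite divr_ge0 ?exprn_ge0// ltW// unit_ball_volume_gt0.
rewrite /hausdorff_gauge; case: ifPn => [_|U0].
  by rewrite lee_fin mulr_ge0// exprn_ge0.
rewrite [leRHS]EFinM; apply: lee_wpmul2l; first by rewrite lee_fin.
by rewrite EFin_expe expe_le ?diameter_ge0.
Qed.

(** Cut the cube into N^k cubes of side 1/N: the sum of the gauges does not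
    depend on N. *)
Lemma hausdorff_cube_fin k : (hausdorff k (@unit_cube k) < +oo)%E.
Proof.
pose C := unit_ball_volume R k / 2 ^+ k * k%:R ^+ k.
apply: (@le_lt_trans _ _ C%:E); last by rewrite ltry.
apply: ge_ereal_sup => _ [delta /= d0 <-].
(* the subcubes have diameter at most k / (N+1) <= delta *)
pose N := Num.truncn (k%:R / delta).
have N0 : 0 < N.+1%:R :> R by [].
have Nd : k%:R / N.+1%:R <= delta.
  by rewrite ler_pdivrMr// mulrC -ler_pdivrMr// ltW// truncnS_gt.
pose G (f : {ffun 'I_k -> 'I_N.+1}) := [set x : 'rV[R]_k |
  forall i, (f i)%:R / N.+1%:R <= x 0 i <= (f i).+1%:R / N.+1%:R].
have dG f : (diameter (G f) <= (k%:R / N.+1%:R)%:E)%E.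
  apply: diameter_le => x y Gx Gy; rewrite lee_fin.
  apply: le_trans (enorm_le_norm _) _; rewrite ler_wpM2l//.
  apply: norm_leP => [|i]; first by rewrite invr_ge0.
  rewrite !mxE; move: (Gx i) (Gy i).
  rewrite -[(f i).+1%:R]natr1 mulrDl mul1r => h1 h2.
  have aux (a b u v : R) : a <= u <= a + b -> a <= v <= a + b -> `|u - v| <= b.
    by move=> /andP[? ?] /andP[? ?]; rewrite ler_norml; apply/andP; split; lra.
  exact: aux h1 h2.
have -> : C = #|{ffun 'I_k -> 'I_N.+1}|%:R *
    (unit_ball_volume R k / 2 ^+ k * (k%:R / N.+1%:R) ^+ k).
  rewrite card_ffun !card_ord natrX mulrCA /C; congr (_ * _).
  by rewrite -exprMn mulrCA divff ?mulr1// gt_eqF.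
apply: (@content_fin_cover _ _ _ G) => [|x xQ|f|f].
- rewrite mulr_ge0 ?exprn_ge0 ?divr_ge0// ?exprn_ge0//.
  exact/ltW/unit_ball_volume_gt0.
- exists [ffun i => inord (minn N (Num.truncn (x 0 i * N.+1%:R)))] => // i.
  rewrite ffunE inordK ?ltnS ?geq_minl//; have /andP[x0 x1] := xQ i.
  have y0 : 0 <= x 0 i * N.+1%:R by rewrite mulr_ge0.
  rewrite ler_pdivrMr// ler_pdivlMr//; apply/andP; split.
    by rewrite -truncn_ge_nat// geq_minr.
  have [h|h] := leqP N (Num.truncn (x 0 i * N.+1%:R)).
    by rewrite ler_piMl.
  by rewrite ltW// truncnS_gt.
- by apply: le_trans (dG f) _; rewrite lee_fin.
- by apply: gauge_le => //; rewrite divr_ge0.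
Qed.

(** The grid points in an interval of length 2r differ by at most 2rM steps, and
    there are at most 2rM + 1 of them; the factor 3 absorbs the 1. *)
Lemma count_interval (M : nat) (x r : R) : (0 < M)%N -> 1 <= r * M%:R ->
  #|[set j : 'I_M | `|x - j%:R / M%:R| < r]%SET|%:R <= 3 * (r * M%:R).
Proof.
move=> M0 rM; set S := [set j | _]%SET.
have M0' : 0 < M%:R :> R by rewrite ltr0n.
have [->|[j0 j0S]] := set_0Vmem S; first by rewrite cards0; lra.
have [j jS jmin] := @arg_minnP _ j0 (mem S) (fun j => val j) j0S.
pose L := Num.truncn (2 * (r * M%:R)).
pose h (i : 'I_M) : 'I_L.+1 := inord (i - j).
have hL i : i \in S -> (i - j < L.+1)%N.
  move=> iS; rewrite ltnS /L.
  have ji : (j <= i)%N := jmin i iS.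
  rewrite truncn_ge_nat; last by lra.
  rewrite natrB//; move: iS jS; rewrite !inE !ltr_norml => /andP[i1 i2] /andP[j1 j2].
  have : (i%:R / M%:R - j%:R / M%:R) * M%:R <= (2 * r) * M%:R.
    by rewrite ler_pM2r//; lra.
  by rewrite mulrBl !divfK ?gt_eqF// mulrA.
have hi : {in S &, injective h}.
  move=> a b aS bS /(congr1 val); rewrite /= !inordK ?hL// => /eqP.
  by rewrite eqn_sub2rE ?jmin// => /eqP /val_inj.
rewrite -(card_in_imset hi).
apply: (@le_trans _ _ L.+1%:R).
  by rewrite ler_nat -[X in (_ <= X)%N]card_ord max_card.
have h2 : L%:R <= 2 * (r * M%:R) by rewrite truncn_le; lra.
rewrite -natr1.
lra.
Qed.

Lemma count_ball k (M : nat) (x : 'rV[R]_k) (r : R) : (0 < M)%N -> 1 <= r * M%:R ->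
  #|[set f : {ffun 'I_k -> 'I_M} |
      [forall i, `|x 0 i - (f i)%:R / M%:R| < r]]%SET|%:R <= (3 * (r * M%:R)) ^+ k.
Proof.
move=> M0 rM.
pose S i := [set j : 'I_M | `|x 0 i - j%:R / M%:R| < r]%SET.
rewrite (_ : #|_| = \prod_(i < k) #|S i|)%N; last first.
  have := card_family (fun i => mem (S i)).
  rewrite foldrE big_map big_enum/= => <-.
  apply: eq_card => f; rewrite inE; apply/forallP/familyP => h i.
    by rewrite inE h.
  by have := h i; rewrite inE.
rewrite natr_prod.
apply: (@le_trans _ _ (\prod_(i < k) (3 * (r * M%:R)))).
  by apply: ler_prod => i _; rewrite ler0n count_interval.
by rewrite prodr_const card_ord.
Qed.

(** Replacing volume by counting the points of a fine grid: every grid point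
    lies in one of the boxes, and the box of radius r_j holds at most
    (3 r_j M)^k of the M^k points. *)
Lemma cube_cover_sum k (N0 : nat) (x : nat -> 'rV[R]_k) (r : nat -> R) :
  (forall j, 0 < r j) ->
  (forall y, @unit_cube k y -> exists2 j, (j < N0)%N & `|y - x j| < r j) ->
  1 <= \sum_(j < N0) (3 * r j) ^+ k.
Proof.
move=> r0 cov.
have [M [M0 rM]] : exists M, (0 < M)%N /\ forall j : 'I_N0, 1 <= r j * M%:R.
  exists (\sum_(j < N0) (Num.truncn (r j)^-1).+1).+1; split => // j.
  rewrite mulrC -ler_pdivrMr// div1r.
  apply: le_trans (ltW (truncnS_gt _)) _; rewrite ler_nat.
  by rewrite leqW// (bigD1 j)//= leq_addr.
have M0' : 0 < M%:R :> R by rewrite ltr0n.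
pose S (j : 'I_N0) := [set f : {ffun 'I_k -> 'I_M} |
      [forall i, `|x j 0 i - (f i)%:R / M%:R| < r j]]%SET.
have : (#|{ffun 'I_k -> 'I_M}| <= \sum_(j < N0) #|S j|)%N.
  rewrite -cardsT; apply: leq_trans (_ : #|(\bigcup_(j < N0) S j)%SET| <= _)%N.
    apply/subset_leq_card/fintype.subsetP => f _.
    have /cov[j jN yj] : @unit_cube k (\row_i ((f i)%:R / M%:R)).
      move=> i; rewrite mxE divr_ge0//= ler_pdivrMr// mul1r ler_nat.
      exact/ltnW.
    apply/bigcupP; exists (Ordinal jN) => //; rewrite inE; apply/forallP => i.
    apply: le_lt_trans yj; rewrite distrC.
    by have := coord_le_norm (\row_i ((f i)%:R / M%:R) - x j) i; rewrite !mxE.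
  elim/big_ind2: _ => [|A a B b hA hB|//]; first by rewrite cards0.
  by apply: leq_trans (leq_card_setU _ _) (leq_add hA hB).
rewrite -(@ler_nat R) card_ffun !card_ord natrX natr_sum => h.
have Mk : 0 < M%:R ^+ k :> R by rewrite exprn_gt0.
rewrite -(ler_pM2r Mk) mul1r; apply: le_trans h _.
rewrite mulr_suml; apply: ler_sum => j _.
by rewrite -exprMn -mulrA; exact: count_ball.
Qed.

(** Enlarge the sets of a cover to open boxes around chosen points, with radius
    diameter plus a summably small eps_j; by compactness finitely many boxes
    cover the cube, and [cube_cover_sum] bounds the sum of the gauges below. *)
Lemma hausdorff_cube_gt0 k : (0 < k)%N -> (0 < hausdorff k (@unit_cube k))%E.
Proof.
move=> k0; pose c := unit_ball_volume R k / 2 ^+ k.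
have c0 : 0 < c by rewrite divr_gt0 ?exprn_gt0// unit_ball_volume_gt0.
(* (3 r_j)^k <= 6^k (D_j^k + eps_j), so that 1 <= 6^k (sum of D_j^k + e) *)
pose e : R := (6 ^+ k)^-1 / 2.
have e0 : 0 < e by rewrite divr_gt0// invr_gt0 exprn_gt0.
apply: (@lt_le_trans _ _ (c * e)%:E); first by rewrite lte_fin mulr_gt0.
apply: (@le_trans _ _ (hausdorff_content k 1 (@unit_cube k))); last first.
  by apply: ereal_sup_ubound; exists 1 => /=.
apply: le_ereal_inf_tmp => _ [F [QF dF] <-].
(* a point of F j; the default is taken when F j is empty *)
pose x j := xget 0 (F j).
pose D j := if F j == set0 then 0 else fine (diameter (F j)).
have D0 j : 0 <= D j.
  by rewrite /D; case: ifPn => // h; rewrite fine_ge0// diameter_ge0.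
have dE j : F j != set0 -> diameter (F j) = (D j)%:E.
  move=> h; rewrite /D (negbTE h) fineK// ge0_fin_numE ?diameter_ge0//.
  by apply: le_lt_trans (dF j) _; rewrite ltry.
have gE j : hausdorff_gauge k (F j) = (c * D j ^+ k)%:E.
  rewrite /hausdorff_gauge; case: ifPn => [/eqP h|h].
    by rewrite /D h eqxx expr0n eqn0Ngt k0 mulr0.
  by rewrite dE// -EFin_expe -EFinM.
pose eps j : R := e / (2 ^ j.+1)%:R.
have eps0 j : 0 < eps j by rewrite divr_gt0// ltr0n expn_gt0.
have eps1 j : eps j <= 1.
  rewrite ler_pdivrMr ?mul1r ?ltr0n ?expn_gt0//; apply: (@le_trans _ _ 1).
    rewrite ler_pdivrMr// mul1r (@le_trans _ _ 1) ?ler1n//.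
    by rewrite invf_le1 ?exprn_gt0// exprn_ege1// ler1n.
  by rewrite ler1n expn_gt0.
pose r j := D j + eps j.
have r0 j : 0 < r j by rewrite ltr_wpDl.
have Fx j y : F j y -> `|y - x j| < r j.
  move=> Fy; have Fx : F j (x j) by rewrite /x; case: xgetP => // h; have := h y.
  have h : F j != set0 by apply/set0P; exists y.
  apply: le_lt_trans (norm_le_enorm _) _.
  have := le_diameter Fy Fx; rewrite dE// lee_fin => h1.
  by rewrite /r (le_lt_trans h1)// ltrDl.
have [N0 cov] : exists N0, forall y, @unit_cube k y ->
    exists2 j, (j < N0)%N & `|y - x j| < r j.
  have cQ : compact (@unit_cube k).
    have := @rV_compact R k (fun=> `[0, 1]%classic) (fun=> @segment_compact R 0 1).
    congr compact; apply/seteqP; split=> y /= h i; have := h i;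
    by rewrite in_itv/=.
  have /compact_near_coveringP/(_ nat \oo
    (fun N y => exists2 j, (j < N)%N & `|y - x j| < r j)) := cQ.
  case=> [y /QF[j _ Fy]|N0 _ h]; last first.
    by exists N0 => y Qy; apply: (h N0) => /=.
  exists ([set z | `|z - x j| < r j], [set N | (j < N)%N]).
    split; last by exists j.+1.
    apply/nbhs_ballP; have yj := Fx _ _ Fy.
    exists (r j - `|y - x j|) => /=; first by rewrite subr_gt0.
    move=> z; rewrite -ball_normE /= distrC => h.
    by rewrite -(subrK y z) -addrA (le_lt_trans (ler_normD _ _))// -ltrBrDr.
  by move=> [z N] /= [h1 h2]; exists j.
have h1 := cube_cover_sum r0 cov.
have h2 j : (3 * r j) ^+ k <= 6 ^+ k * (D j ^+ k + eps j).
  apply: (@le_trans _ _ ((6 * Num.max (D j) (eps j)) ^+ k)).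
    rewrite lerXn2r ?nnegrE ?mulr_ge0 ?le_max ?D0//; first exact: ltW.
    have : D j <= Num.max (D j) (eps j) by rewrite le_max lexx.
    have : eps j <= Num.max (D j) (eps j) by rewrite le_max lexx orbT.
    by rewrite /r; lra.
  rewrite exprMn ler_wpM2l ?exprn_ge0//.
  have ek : eps j ^+ k <= eps j.
    by rewrite -[leRHS]expr1 ler_wiXn2l// ltW.
  case: (leP (D j) (eps j)) => _.
    by rewrite (le_trans ek)// lerDr exprn_ge0.
  by rewrite lerDl ltW.
have h3 : \sum_(j < N0) eps j <= e.
  have h : \sum_(j < N0) eps j = e * (1 - (2 ^ N0)%:R^-1).
    elim: N0 {cov h1} => [|N IH]; first by rewrite big_ord0 expn0 invr1 subrr mulr0.
    rewrite big_ord_recr/= IH /eps expnS natrM invfM.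
    by field; rewrite pnatr_eq0 -lt0n expn_gt0.
  rewrite h; rewrite ler_piMr ?ltW// gerBl invr_ge0//.
apply: (@le_trans _ _ (\sum_(0 <= j < N0) hausdorff_gauge k (F j))%E); last first.
  by apply: nneseries_lim_ge => j _ _; exact: hausdorff_gauge_ge0.
rewrite big_mkord; under eq_bigr do rewrite gE.
rewrite sumEFin lee_fin -mulr_sumr ler_pM2l//.
have h4 : 1 <= 6 ^+ k * (\sum_(j < N0) D j ^+ k + e).
  apply: le_trans h1 _; apply: (@le_trans _ _ (\sum_(j < N0) 6 ^+ k * (D j ^+ k + eps j))).
    by apply: ler_sum => j _; exact: h2.
  rewrite -mulr_sumr big_split/= ler_wpM2l ?exprn_ge0// lerD2l//.
have k6 : 0 < 6 ^+ k :> R by rewrite exprn_gt0.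
rewrite -ler_pdivrMl// mulr1 -lerBlDr in h4.
apply: le_trans h4; rewrite /e; have : 0 < (6 ^+ k)^-1 :> R by rewrite invr_gt0.
move: ((6 ^+ k)^-1) => z z0; lra.
Qed.

End Cube.

(** * Change of variables between two measures *)

Notation borel_rV R n := (g_sigma_algebraType (@open 'rV[R]_n)).

Section Transfer.
Local Open Scope ereal_scope.
Variable R : realType.

Lemma open_borel n (U : set 'rV[R]_n) : open U -> measurable (U : set (borel_rV R n)).
Proof. by move=> oU; apply: sub_sigma_algebra. Qed.

Lemma closed_borel n (U : set 'rV[R]_n) : closed U -> measurable (U : set (borel_rV R n)).
Proof.
by move=> cU; rewrite -[U]setCK; apply: measurableC; apply: open_borel; exact: closed_openC.
Qed.

Lemma continuous_borel n (f : 'rV[R]_n -> R) : continuous f ->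
  measurable_fun setT (f : borel_rV R n -> R).
Proof.
move=> cf; apply: (measurability _ (RGenOpens.measurableE R)).
move=> _ [_ [a [b ->] <-]]; rewrite setTI; apply: open_borel.
by apply: open_comp => [x _|]; [exact: cf|exact: itv_open].
Qed.

Lemma cara_to_borel m n d (j : 'rV[R]_m -> 'rV[R]_n) : continuous j ->
  measurable_fun setT (j : caratheodory_type (@hausdorff R m d) -> borel_rV R n).
Proof.
move=> cj; apply: (measurability (@open 'rV[R]_n : set (set (borel_rV R n))) erefl).
move=> _ [U oU <-]; rewrite setTI; apply: hausdorff_open_cara.
by apply: open_comp => // x _; exact: cj.
Qed.

Section ge0.
Context d1 d2 (T1 : measurableType d1) (T2 : measurableType d2) (n : nat).
Variables (m1 : {measure set T1 -> \bar R}) (m2 : {measure set T2 -> \bar R}).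
Variables (j1 : T1 -> borel_rV R n) (j2 : T2 -> borel_rV R n) (c : {nonneg R}).
Variable E : set (borel_rV R n).
Hypotheses (mj1 : measurable_fun setT j1) (mj2 : measurable_fun setT j2).
Hypothesis mE : measurable E.
Hypothesis m12 : forall A : set (borel_rV R n), measurable A -> A `<=` E ->
  m1 (j1 @^-1` A) = c%:num%:E * m2 (j2 @^-1` A).

(** Both sides are integrals over E, against the image measures of j1 and j2. *)
Lemma ge0_transfer (f : 'rV[R]_n -> \bar R) :
  measurable_fun setT (f : borel_rV R n -> \bar R) -> (forall y, 0 <= f y) ->
  \int[m1]_(x in j1 @^-1` E) f (j1 x) = c%:num%:E * \int[m2]_(x in j2 @^-1` E) f (j2 x).
Proof.
move=> mf f0; have mfE : measurable_fun E f by exact: measurable_funTS.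
rewrite -(@ge0_integral_pushforward _ _ _ _ _ _ mj1 m1 E f)//.
rewrite -(@ge0_integral_pushforward _ _ _ _ _ _ mj2 m2 E f)//.
rewrite -ge0_integral_mscale//.
by apply: eq_measure_integral => A mA AE; exact: m12.
Qed.

Lemma transfer (f : 'rV[R]_n -> R) : continuous f ->
  m2.-integrable (j2 @^-1` E) (EFin \o (f \o j2)) ->
  (\int[m1]_(x in j1 @^-1` E) f (j1 x) = c%:num * \int[m2]_(x in j2 @^-1` E) f (j2 x))%R.
Proof.
move=> cf intf; have mf := continuous_borel cf.
have mf' : measurable_fun setT (EFin \o f : borel_rV R n -> \bar R).
  exact/measurable_EFinP.
rewrite /Rintegral.
have mE2 : measurable (j2 @^-1` E) by rewrite -[_ @^-1` _]setTI; exact: mj2.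
have := integrable_fin_num mE2 intf => fin2.
rewrite integralE.
have pE (T : Type) (j : T -> 'rV[R]_n) :
    (fun x => (f (j x))%:E)^\+ = (EFin \o f)^\+ \o j by rewrite -funepos_comp.
have nE (T : Type) (j : T -> 'rV[R]_n) :
    (fun x => (f (j x))%:E)^\- = (EFin \o f)^\- \o j by rewrite -funeneg_comp.
have hp := ge0_transfer (measurable_funepos mf') (funepos_ge0 _).
have hn := ge0_transfer (measurable_funeneg mf') (funeneg_ge0 _).
have -> : \int[m1]_(x in j1 @^-1` E) (fun x => (f (j1 x))%:E)^\+ x =
   c%:num%:E * \int[m2]_(x in j2 @^-1` E) (fun x => (f (j2 x))%:E)^\+ x.
  by rewrite (pE _ j1) (pE _ j2).
have -> : \int[m1]_(x in j1 @^-1` E) (fun x => (f (j1 x))%:E)^\- x =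
   c%:num%:E * \int[m2]_(x in j2 @^-1` E) (fun x => (f (j2 x))%:E)^\- x.
  by rewrite (nE _ j1) (nE _ j2).
rewrite -muleBr//; last first.
  by rewrite fin_num_adde_defl// fin_numN; exact: (integrable_neg_fin_num mE2 intf).
by rewrite -integralE fineM.
Qed.
End ge0.
End Transfer.

(** * A weight of finite integral *)

Section Lam.
Variable R : realType.

(** The exponent makes the weight integrable over R^n, and restricted to a
    d-plane with d <= n it is at most the weight of R^d. *)
Definition weight n (x : 'rV[R]_n) : R := ((1 + enorm x ^+ 2)^-1) ^+ n.+1.

(** The class on which all functionals below are defined: it is stable under
    translations, dilations, isometries and restriction to subspaces. *)
Definition tame n (f : 'rV[R]_n -> R) :=
  continuous f /\ exists C, forall x, `|f x| <= C * weight x.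

Definition space_int k (f : 'rV[R]_k -> R) : R :=
  \int[hausdorff_measure R k k]_(x in setT) f x.

Lemma add1sqr_gt0 (t : R) : 0 < 1 + t ^+ 2.
Proof. by rewrite ltr_pwDl// sqr_ge0. Qed.

Lemma weight_gt0 n (x : 'rV[R]_n) : 0 < weight x.
Proof. by rewrite exprn_gt0// invr_gt0 add1sqr_gt0. Qed.

Lemma weight_ge0 n (x : 'rV[R]_n) : 0 <= weight x.
Proof. exact/ltW/weight_gt0. Qed.

Lemma weight_le1 n (x : 'rV[R]_n) : weight x <= 1.
Proof.
rewrite /weight exprn_ile1 ?invr_ge0 ?(ltW (add1sqr_gt0 _))//.
by rewrite invf_le1 ?add1sqr_gt0// lerDl sqr_ge0.
Qed.

Lemma cont_comp_R n (f : 'rV[R]_n -> R) (g : R -> R) (x : 'rV[R]_n) :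
  {for x, continuous f} -> {for f x, continuous g} -> {for x, continuous (g \o f)}.
Proof. by move=> cf cg; apply: continuous_comp. Qed.

Lemma weight_continuous n : continuous (@weight n).
Proof.
move=> x; apply: (@cont_comp_R _ (fun x => (1 + enorm x ^+ 2)^-1) (fun t => t ^+ n.+1)).
  apply: (@cont_comp_R _ _ (fun t => (1 + t ^+ 2)^-1)); first exact: enorm_continuous.
  apply: cvgV; first by rewrite gt_eqF// add1sqr_gt0.
  by apply: cvgD; [exact: cvg_cst|exact: exprn_continuous].
exact: exprn_continuous.
Qed.

Lemma weight_tame n : tame (@weight n).
Proof.
split; first exact: weight_continuous.
by exists 1 => x; rewrite mul1r ger0_norm// weight_ge0.
Qed.

Definition eball n (x : 'rV[R]_n) r := [set y : 'rV[R]_n | enorm (y - x) <= r].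

Lemma hausdorff_unit_ball_fin k : (hausdorff k (eball (0 : 'rV[R]_k) 1%R) < +oo)%E.
Proof.
pose j (x : 'rV[R]_k) : 'rV[R]_k := 2 *: x - const_mx 1.
have jl (x y : 'rV[R]_k) : enorm (j x - j y) = 2 * enorm (x - y).
  by rewrite /j opprB addrA subrK -scalerBr enormZ ger0_norm.
have h := @hausdorff_similar R k k k j 2 (@unit_cube R k) (ltr0n _ 2) jl.
apply: (@le_lt_trans _ _ (hausdorff k (j @` @unit_cube R k))).
  apply: le_hausdorff => x; rewrite /eball /= subr0 => x1.
  exists (2^-1 *: (x + const_mx 1)) => [i|]; last first.
    by rewrite /j scalerA divff// scale1r addrK.
  rewrite !mxE; have := le_trans (coord_le_enorm x i) x1.
  by rewrite ler_norml => /andP[? ?]; apply/andP; split; lra.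
rewrite h; have := hausdorff_cube_fin R k.
have := hausdorff_outer_ge0 k (@unit_cube R k).
by case: (hausdorff k _) => //= r _ _; rewrite -EFinM ltry.
Qed.

Lemma hausdorff_ball k r : 0 < r ->
  hausdorff k (eball (0 : 'rV[R]_k) r) =
  ((r ^+ k)%:E * hausdorff k (eball (0 : 'rV[R]_k) 1%R))%E.
Proof.
move=> r0; rewrite -(@hausdorff_similar R k k k (fun x => r *: x) r)//; last first.
  by move=> x y; rewrite -scalerBr enormZ ger0_norm ?ltW.
congr hausdorff; apply/seteqP; split=> [x|_ [x x1 <-]]; rewrite /eball /= subr0.
  move=> xr; exists (r^-1 *: x); last by rewrite scalerA divff ?scale1r// gt_eqF.
  by rewrite /= subr0 enormZ ger0_norm ?invr_ge0 ?(ltW r0)// ler_pdivrMl// mulr1.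
rewrite /eball /= subr0 in x1; rewrite enormZ ger0_norm ?(ltW r0)//.
by rewrite ler_piMr// ltW.
Qed.

Lemma hausdorff_ball_gt0 k (x : 'rV[R]_k) r : (0 < k)%N -> 0 < r ->
  (0 < hausdorff k (eball x r))%E.
Proof.
move=> k0 r0; pose s := r / k%:R.
have k0' : 0 < k%:R :> R by rewrite ltr0n.
have s0 : 0 < s by rewrite divr_gt0.
pose j (y : 'rV[R]_k) : 'rV[R]_k := x + s *: y.
have h := @hausdorff_similar R k k k j s (@unit_cube R k) s0.
apply: (@lt_le_trans _ _ (hausdorff k (j @` @unit_cube R k))).
  rewrite h => [|y z]; last first.
    by rewrite /j opprD addrACA subrr add0r -scalerBr enormZ ger0_norm// ltW.
  by rewrite mule_gt0 ?lte_fin ?exprn_gt0//; exact: hausdorff_cube_gt0.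
apply: le_hausdorff => _ [y yQ <-]; rewrite /eball /j /= addrAC subrr add0r.
rewrite enormZ ger0_norm ?(ltW s0)// /s mulrAC ler_pdivrMr// ler_pM2l//.
apply: le_trans (enorm_le_norm _) _; rewrite ler_piMr ?ler0n//.
apply: norm_leP => // i; have /andP[? ?] := yQ i.
by rewrite ger0_norm.
Qed.

Lemma cara_continuous k d (f : 'rV[R]_k -> R) : continuous f ->
  measurable_fun setT (f : caratheodory_type (@hausdorff R k d) -> R).
Proof.
move=> cf; have h := continuous_borel cf.
have h2 := @cara_to_borel R k k d id (fun x => cvg_id).
exact: (measurableT_comp h h2).
Qed.

Lemma closed_cara k d (A : set 'rV[R]_k) : closed A ->
  measurable (A : set (caratheodory_type (@hausdorff R k d))).
Proof.
move=> cA; rewrite -[A]setCK; apply: measurableC.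
by apply: hausdorff_open_cara; exact: closed_openC.
Qed.

Local Open Scope ereal_scope.

(** On the dyadic shell 2^(j-1) < |x| <= 2^j the weight is at most
    4^(k+1) / 4^((k+1)j), while the ball of radius 2^j has measure of order
    2^(jk). *)
Lemma weight_integral_fin k :
  \int[hausdorff_measure R k k]_(x in setT) (weight x)%:E < +oo.
Proof.
pose B (j : nat) : set (caratheodory_type (@hausdorff R k k)) :=
  eball (0 : 'rV[R]_k) (2 ^+ j)%R.
have mB j : measurable (B j) by apply: closed_cara; exact: closed_eball.
pose a (j : nat) : R := (4 ^+ k.+1 / (4 ^+ k.+1) ^+ j)%R.
have a0 j : (0 <= a j)%R by rewrite divr_ge0 ?exprn_ge0.
have wa (x : 'rV[R]_k) : (weight x)%:E <= \sum_(j <oo) (a j * \1_(B j) x)%:E.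
  have [j0 xj0] : exists j, B j x.
    exists (Num.truncn (enorm x)).+1; rewrite /B /eball /= subr0.
    apply: le_trans (ltW (truncnS_gt _)) _.
    by rewrite -natrX ler_nat ltnW// ltn_expl.
  have [j [xj jmin]] : exists j, B j x /\ forall i, (i < j)%N -> ~ B i x.
    have ex : exists j, `[< B j x >] by exists j0; apply/asboolP.
    exists (ex_minn ex); case: ex_minnP => m /asboolP Bm mmin; split=> // i im /asboolP.
    by move/mmin; rewrite leqNgt im.
  apply: (@le_trans _ _ (a j * \1_(B j) x)%:E).
    rewrite lee_fin indicE mem_set// mulr1 /a.
    case: j xj jmin => [_ _|j xj jmin].
      by rewrite expr0 divr1 (le_trans (weight_le1 _))// exprn_ege1// ler1n.
    have /negP := jmin j (ltnSn _); rewrite /B /eball /= subr0 -ltNge => xj2.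
    rewrite [((_ ^+ _) ^+ j.+1)%R]exprS invfM mulrA divff ?gt_eqF ?exprn_gt0// mul1r exprAC -exprVn.
    rewrite lerXn2r ?nnegrE ?invr_ge0 ?(ltW (add1sqr_gt0 _)) ?exprn_ge0//.
    rewrite lef_pV2 ?posrE ?add1sqr_gt0 ?exprn_gt0//.
    rewrite (_ : 4 = 2 ^+ 2)%R; last by rewrite -natrX.
    rewrite exprAC (@le_trans _ _ (enorm x ^+ 2)%R)//; last by rewrite lerDr.
    by rewrite lerXn2r ?nnegrE ?exprn_ge0 ?enorm_ge0// ltW.
  rewrite (nneseries_split _ j.+1); last first.
    by move=> i _; rewrite lee_fin mulr_ge0// indicE.
  rewrite add0n big_nat_recr//= -addeA addeCA leeDl// adde_ge0//.
    by apply: sume_ge0 => i _; rewrite lee_fin mulr_ge0// indicE.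
  by apply: nneseries_ge0 => i _ _; rewrite lee_fin mulr_ge0// indicE.
apply: (@le_lt_trans _ _ (\int[hausdorff_measure R k k]_(x in setT)
    \sum_(j <oo) (a j * \1_(B j) x)%:E)).
  apply: ge0_le_integral.
  - exact: measurableT.
  - by move=> x _; rewrite lee_fin weight_ge0.
  - by apply/measurable_EFinP; apply: cara_continuous; exact: weight_continuous.
  - have := @ge0_emeasurable_sum _ _ R setT (fun j x => (a j * \1_(B j) x)%:E) xpredT.
    apply=> [j x _ _|j _]; first by rewrite lee_fin mulr_ge0// indicE.
    by apply/measurable_EFinP; apply: measurable_funM; [exact: measurable_cst|exact: measurable_indic].
  - by move=> x _; exact: wa.
rewrite integral_nneseries; last 3 first.
- exact: measurableT.
- by move=> j; apply/measurable_EFinP; apply: measurable_funM; [exact: measurable_cst|exact: measurable_indic].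
- by move=> j x _; rewrite lee_fin mulr_ge0// indicE.
have C0 := hausdorff_outer_ge0 k (eball (0 : 'rV[R]_k) 1%R).
have := hausdorff_unit_ball_fin k.
move CE : (hausdorff k (eball (0 : 'rV[R]_k) 1%R)) => C; rewrite CE in C0.
case: C C0 CE => // C C0 CE _; rewrite lee_fin in C0.
apply: (@le_lt_trans _ _ (4 ^+ k.+1 * C * 2)%R%:E); last by rewrite ltry.
have intE j : \int[hausdorff_measure R k k]_(x in setT) (a j * \1_(B j) x)%:E =
    (a j * (2 ^+ j) ^+ k * C)%:E.
  under eq_integral do rewrite EFinM.
  rewrite ge0_integralZl_EFin; last 4 first.
  - exact: measurableT.
  - by move=> x _; rewrite lee_fin indicE.
  - by apply/measurable_EFinP; exact: measurable_indic.
  - exact: a0.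
  rewrite integral_indic; [|exact: measurableT|exact: mB]; rewrite setIT.
  have := @hausdorff_ball k (2 ^+ j)%R; rewrite exprn_gt0// => /(_ isT).
  by rewrite CE => h; rewrite -[LHS]/(_ * hausdorff k (B j)) h -!EFinM mulrA.
apply: nneseries_le_bound => [j|m].
  by rewrite intE lee_fin !mulr_ge0// !exprn_ge0.
under eq_bigr do rewrite intE.
rewrite sumEFin lee_fin.
apply: (@le_trans _ _ (\sum_(0 <= j < m) 4 ^+ k.+1 * C * (2 ^- j))%R).
  apply: ler_sum => j _; rewrite /a.
  have h : (((4 ^+ k.+1) ^+ j)^-1 * (2 ^+ j) ^+ k <= 2 ^- j :> R)%R.
    rewrite ler_pdivrMl ?exprn_gt0 ?exprn_gt0// ler_pdivlMr ?exprn_gt0//.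
    rewrite -!exprM -exprD (_ : (j * k + j)%N = (k.+1 * j)%N); last first.
      by rewrite mulSn mulnC addnC.
    by rewrite lerXn2r ?nnegrE// ler_nat.
  rewrite -!mulrA; apply: ler_wpM2l; first by rewrite exprn_ge0.
  rewrite mulrA mulrC; apply: ler_wpM2l => //.
rewrite -mulr_sumr ler_wpM2l ?mulr_ge0 ?exprn_ge0//.
have -> : (\sum_(0 <= j < m) 2 ^- j = 2 - 2 ^- m * 2 :> R)%R.
  elim: m => [|m IH]; first by rewrite big_geq// expr0 invr1 mul1r subrr.
  rewrite big_nat_recr//= IH exprS; field.
  by rewrite gt_eqF// exprn_gt0.
by rewrite gerBl mulr_ge0// invr_ge0 exprn_ge0.
Qed.

End Lam.

(** * Integrals of decaying functions over affine subspaces *)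

Section Tame.
Variable R : realType.

Lemma contC (T : topologicalType) (a : R) : continuous (fun _ : T => a).
Proof. exact: cst_continuous. Qed.

Lemma contD (T : topologicalType) (f g : T -> R) :
  continuous f -> continuous g -> continuous (fun x => f x + g x).
Proof. by move=> cf cg x; exact: (cvgD (cf x) (cg x)). Qed.

Lemma contM (T : topologicalType) (f g : T -> R) :
  continuous f -> continuous g -> continuous (fun x => f x * g x).
Proof. by move=> cf cg x; exact: (cvgM (cf x) (cg x)). Qed.

Lemma contZ (T : topologicalType) a (f : T -> R) :
  continuous f -> continuous (fun x => a * f x).
Proof. by move=> cf x; exact: (cvgM (cvg_cst a) (cf x)). Qed.

Lemma tame_lin n a (f g : 'rV[R]_n -> R) : tame f -> tame g ->
  tame (fun x => a * f x + g x).
Proof.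
move=> [cf [C fC]] [cg [D gD]]; split.
  exact: (contD (contZ cf) cg).
exists (`|a| * C + D) => x; apply: le_trans (ler_normD _ _) _.
by rewrite normrM mulrDl -mulrA lerD// ler_wpM2l.
Qed.

Lemma tame0 n : tame (fun _ : 'rV[R]_n => 0 : R).
Proof.
split; first exact: contC.
by exists 0 => x; rewrite normr0 mul0r.
Qed.

Lemma tameZ n a (f : 'rV[R]_n -> R) : tame f -> tame (fun x => a * f x).
Proof.
move=> tf; have := tame_lin a tf (@tame0 n).
by rewrite (_ : (fun x => a * f x + 0) = (fun x => a * f x))//; apply/funext => x; rewrite addr0.
Qed.

Lemma tameD n (f g : 'rV[R]_n -> R) : tame f -> tame g -> tame (fun x => f x + g x).
Proof.
move=> tf tg; have := tame_lin 1 tf tg.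
by under eq_fun do rewrite mul1r.
Qed.

Lemma tameN n (f : 'rV[R]_n -> R) : tame f -> tame (fun x => - f x).
Proof. by move=> tf; have := tameZ (-1) tf; under eq_fun do rewrite mulN1r. Qed.

Lemma tameB n (f g : 'rV[R]_n -> R) : tame f -> tame g -> tame (fun x => f x - g x).
Proof. by move=> tf tg; apply: tameD => //; exact: tameN. Qed.

Lemma tame_bound n (f : 'rV[R]_n -> R) C : continuous f ->
  (forall x, `|f x| <= C * weight x) -> tame f.
Proof. by move=> cf fC; split=> //; exists C. Qed.

(** Peetre's inequality: 1 + |y|^2 <= 2 (1 + |x|^2) (1 + |x+y|^2). *)
Lemma weightS n (x y : 'rV[R]_n) :
  weight (x + y) <= (2 * (1 + enorm x ^+ 2)) ^+ n.+1 * weight y.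
Proof.
rewrite /weight -exprMn lerXn2r ?nnegrE ?mulr_ge0 ?invr_ge0 ?(ltW (add1sqr_gt0 _))//.
rewrite ler_pdivlMr ?add1sqr_gt0// ler_pdivrMl ?add1sqr_gt0//.
have h : enorm y <= enorm (x + y) + enorm x.
  by rewrite -{1}(addKr x y) addrC; exact: ler_enormB.
have h2 : enorm y ^+ 2 <= (enorm (x + y) + enorm x) ^+ 2.
  by rewrite lerXn2r ?nnegrE ?addr_ge0 ?enorm_ge0.
have : 0 <= (enorm (x + y) - enorm x) ^+ 2 by exact: sqr_ge0.
have : 0 <= enorm (x + y) ^+ 2 * enorm x ^+ 2 by rewrite mulr_ge0// sqr_ge0.
move: h2; rewrite sqrrD sqrrB.
move: (enorm (x + y) * enorm x) (enorm (x + y) ^+ 2) (enorm x ^+ 2) => a b c.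
nra.
Qed.

Lemma cont_shift n (f : 'rV[R]_n -> R) (x : 'rV[R]_n) : continuous f ->
  continuous (fun y => f (x + y)).
Proof.
move=> cf y; apply: (@continuous_comp _ _ _ (fun y => x + y) f); last exact: cf.
apply: (@enorm_lip_continuous _ _ _ _ 1) => a b.
by rewrite opprD addrACA subrr add0r mul1r.
Qed.

Lemma tame_shift n (f : 'rV[R]_n -> R) (x : 'rV[R]_n) : tame f ->
  tame (fun y => f (x + y)).
Proof.
move=> [cf [C fC]]; split; first exact: cont_shift.
exists (`|C| * (2 * (1 + enorm x ^+ 2)) ^+ n.+1) => y.
apply: le_trans (fC _) _; rewrite -mulrA.
apply: (@le_trans _ _ (`|C| * weight (x + y))).
  by rewrite ler_wpM2r ?weight_ge0// ler_norm.
by rewrite ler_wpM2l// weightS.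
Qed.

Lemma isometry_continuous n d (B : 'M[R]_(d, n)) : B *m B^T = 1%:M ->
  continuous (fun w : 'rV[R]_d => w *m B).
Proof.
move=> BB; apply: (@enorm_lip_continuous _ _ _ _ 1) => x y.
by rewrite mul1r -mulmxBl enorm_isometry.
Qed.

Lemma tame_isometry n d (B : 'M[R]_(d, n)) (f : 'rV[R]_n -> R) :
  B *m B^T = 1%:M -> (d <= n)%N -> tame f -> tame (fun w : 'rV[R]_d => f (w *m B)).
Proof.
move=> BB dn [cf [C fC]]; split.
  by move=> w; apply: continuous_comp; [exact: isometry_continuous|exact: cf].
exists `|C| => w; apply: le_trans (fC _) _.
apply: (@le_trans _ _ (`|C| * weight (w *m B))).
  by rewrite ler_wpM2r ?weight_ge0// ler_norm.
rewrite ler_wpM2l// /weight enorm_isometry// ler_wiXn2l//.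
- by rewrite invr_ge0 (ltW (add1sqr_gt0 _)).
- by rewrite invf_le1 ?add1sqr_gt0// lerDl sqr_ge0.
Qed.

Lemma tame_scale n (f : 'rV[R]_n -> R) (t : R) : t != 0 -> tame f ->
  tame (fun y => f (t *: y)).
Proof.
move=> t0 [cf [C fC]]; split.
  move=> y; apply: (@continuous_comp _ _ _ (fun y : 'rV[R]_n => t *: y : 'rV[R]_n) f); last exact: cf.
  by apply: (@enorm_lip_continuous _ _ _ _ `|t|) => a b; rewrite -scalerBr enormZ.
exists (`|C| * (1 + t ^- 2) ^+ n.+1) => y; apply: le_trans (fC _) _.
apply: (@le_trans _ _ (`|C| * weight (t *: y))).
  by rewrite ler_wpM2r ?weight_ge0// ler_norm.
rewrite -mulrA ler_wpM2l// /weight -exprMn.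
have t2 : 0 < t ^+ 2 by rewrite exprn_even_gt0.
have t2' : 0 < t ^- 2 by rewrite invr_gt0.
rewrite lerXn2r ?nnegrE ?mulr_ge0 ?invr_ge0 ?(ltW (add1sqr_gt0 _)) ?addr_ge0 ?(ltW t2')//.
rewrite ler_pdivlMr ?add1sqr_gt0// ler_pdivrMl ?add1sqr_gt0// enormZ exprMn real_normK ?num_real//.
have y2 : 0 <= enorm y ^+ 2 := sqr_ge0 _.
have : t ^+ 2 * t ^- 2 = 1 by rewrite divff// gt_eqF.
move: y2 t2 t2'; move: (t ^+ 2) (t ^- 2) (enorm y ^+ 2) => a b c c0 a0 b0 ab.
have -> : (1 + a * c) * (1 + b) = 1 + b + a * c + (a * b) * c by ring.
rewrite ab mul1r.
have : 0 <= a * c by apply: mulr_ge0 => //; exact: ltW.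
lra.
Qed.

Lemma tame_mulr n (f g : 'rV[R]_n -> R) C : tame f -> continuous g ->
  (forall x, `|g x| <= C) -> tame (fun x => f x * g x).
Proof.
move=> [cf [D fD]] cg gC; split; first exact: contM.
exists (D * C) => x; rewrite normrM mulrAC ler_pM//.
Qed.

Lemma tame_compact n (f : 'rV[R]_n -> R) M : continuous f ->
  (forall x, M < enorm x -> f x = 0) -> tame f.
Proof.
move=> cf f0.
have cK : compact (@eball R n 0 M) by exact: compact_eball.
have cfn : {within @eball R n 0 M, continuous f} by exact: continuous_subspaceT.
have /compact_bounded[D [_ hD]] := continuous_compact cfn cK.
pose E := `|D| + 1.
have fE x : `|f x| <= E.
  have [xM|xM] := leP (enorm x) M; last by rewrite f0// normr0 addr_ge0.
  apply: (hD E); first by rewrite /E (le_lt_trans (ler_norm _))// ltrDl.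
  by exists x => //; rewrite /eball /= subr0.
have E0 : 0 <= E by rewrite addr_ge0.
apply: (@tame_bound _ _ (E * (1 + M ^+ 2) ^+ n.+1)) => // x.
have [xM|xM] := leP (enorm x) M; last first.
  by rewrite f0// normr0 !mulr_ge0 ?weight_ge0// exprn_ge0// (ltW (add1sqr_gt0 _)).
rewrite -mulrA -[leLHS]mulr1 ler_pM// /weight -exprMn exprn_ege1//.
rewrite ler_pdivlMr ?add1sqr_gt0// mul1r lerD2l lerXn2r ?nnegrE ?enorm_ge0//.
exact: le_trans (enorm_ge0 _) xM.
Qed.

End Tame.

Section LamTheory.
Variable R : realType.
Local Notation H k := (hausdorff_measure R k k).

Lemma tame_integrable k (f : 'rV[R]_k -> R) : tame f ->
  (H k).-integrable setT (EFin \o f).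
Proof.
move=> [cf [C fC]].
have iw : (H k).-integrable setT (EFin \o @weight R k).
  apply/integrableP; split.
    by apply/measurable_EFinP; apply: cara_continuous; exact: weight_continuous.
  under eq_integral => x _ do rewrite /= ger0_norm ?weight_ge0//.
  exact: weight_integral_fin.
have iCw : (H k).-integrable setT (fun x => C%:E * (EFin \o @weight R k) x)%E.
  exact: integrableZl.
apply: (le_integrable measurableT _ _ iCw).
  by apply/measurable_EFinP; exact: cara_continuous.
move=> x _ /=; rewrite lee_fin; apply: le_trans (fC x) _.
by rewrite ler_norm.
Qed.

Lemma space_int_lin k a (f g : 'rV[R]_k -> R) : tame f -> tame g ->
  space_int (fun x => a * f x + g x) = a * space_int f + space_int g.
Proof.
move=> tf tg; rewrite /space_int.
have mT := @measurableT _ (caratheodory_type (@hausdorff R k k)).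
have i1 := tame_integrable tf.
have i2 := tame_integrable tg.
have i3 := tame_integrable (tameZ a tf).
by rewrite (RintegralD mT i3 i2) (RintegralZl _ mT i1).
Qed.

Lemma space_int_ge0 k (f : 'rV[R]_k -> R) : (forall x, 0 <= f x) -> 0 <= space_int f.
Proof. by move=> f0; apply: Rintegral_ge0. Qed.

Lemma space_int_gt0 k (f : 'rV[R]_k -> R) x : (0 < k)%N -> tame f ->
  (forall y, 0 <= f y) -> 0 < f x -> 0 < space_int f.
Proof.
move=> k0 tf f0 fx.
have mT := @measurableT _ (caratheodory_type (@hausdorff R k k)).
have /continuous_enormP/(_ (f x / 2)) := tf.1 x.
case; first by rewrite divr_gt0.
move=> d d0 fd.
have dd0 : 0 < d / 2 by rewrite divr_gt0.
have hf y : eball x (d / 2) y -> f x / 2 <= f y.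
  rewrite /eball /= => xy.
  have : `|f x - f y| < f x / 2 by apply: fd; rewrite enormB; lra.
  by rewrite ltr_norml => /andP[? ?]; lra.
have h1 : ((f x / 2)%:E * hausdorff k (eball x (d / 2)%R) <=
    \int[H k]_(y in setT) (f y)%:E)%E.
  pose B : set (caratheodory_type (@hausdorff R k k)) := eball x (d / 2).
  have mB : measurable B by apply: closed_cara; exact: closed_eball.
  have -> : ((f x / 2)%:E * hausdorff k (eball x (d / 2)%R) =
    \int[H k]_(y in setT) ((f x / 2)%:E * (\1_B y)%:E))%E.
    rewrite ge0_integralZl_EFin; last 4 first.
    - exact: mT.
    - by move=> y _; rewrite lee_fin indicE.
    - by apply/measurable_EFinP; exact: measurable_indic.
    - by rewrite divr_ge0// ltW.
    by rewrite integral_indic; [rewrite setIT|exact: mT|exact: mB].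
  apply: ge0_le_integral.
  - exact: mT.
  - by move=> y _; rewrite mule_ge0// ?lee_fin ?divr_ge0 ?(ltW fx) ?indicE.
  - apply/measurable_EFinP; apply: measurable_funM; first exact: measurable_cst.
    exact: measurable_indic.
  - by apply/measurable_EFinP; apply: cara_continuous; exact: tf.1.
  move=> y _; rewrite -EFinM lee_fin indicE.
  have [yB|yB] := boolP (y \in B); last by rewrite mulr0.
  by rewrite mulr1; apply: hf; rewrite inE in yB.
have h2 : (0 < \int[H k]_(y in setT) (f y)%:E)%E.
  apply: lt_le_trans h1; rewrite mule_gt0 ?lte_fin ?divr_gt0//.
  exact: hausdorff_ball_gt0.
have h3 := integrable_fin_num mT (tame_integrable tf).
by rewrite -lte_fin /space_int /Rintegral fineK.
Qed.

(** The preimage of A under a similarity of ratio l has measure l^-k times that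
    of A. *)
Lemma space_int_similar k (j : 'rV[R]_k -> 'rV[R]_k) l (f : 'rV[R]_k -> R) :
  0 < l -> (forall x y, enorm (j x - j y) = l * enorm (x - y)) ->
  (forall y, exists x, j x = y) -> tame f ->
  space_int (fun x => f (j x)) = l ^- k * space_int f.
Proof.
move=> l0 jl js tf.
have cj : continuous j.
  by apply: (@enorm_lip_continuous _ _ _ _ l) => x y; rewrite jl.
have lk : 0 <= l ^- k by rewrite invr_ge0 exprn_ge0// ltW.
have := @transfer R _ _ _ _ k (H k) (H k) j id (NngNum lk) setT
  (cara_to_borel cj) (cara_to_borel (fun x => cvg_id)) measurableT.
apply; last 2 first.
- exact: tf.1.
- exact: tame_integrable.
move=> A _ _; rewrite -[RHS]/((l ^- k)%:E * hausdorff k A)%E.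
rewrite -[LHS]/(hausdorff k (j @^-1` A)).
have AE : A = j @` (j @^-1` A).
  apply/seteqP; split=> [y Ay|_ [x Ax <-]//].
  by have [x jx] := js y; exists x => //=; rewrite jx.
rewrite [in RHS]AE (@hausdorff_similar _ _ _ _ j l)// muleA -EFinM mulVf ?mul1e//.
by rewrite gt_eqF// exprn_gt0.
Qed.

Lemma space_int_shift k (f : 'rV[R]_k -> R) (x : 'rV[R]_k) : tame f ->
  space_int (fun y => f (x + y)) = space_int f.
Proof.
move=> tf; rewrite (@space_int_similar k (fun y => x + y) 1)//.
- by rewrite expr1n invr1 mul1r.
- by move=> a b; rewrite opprD addrACA subrr add0r mul1r.
- by move=> y; exists (y - x); rewrite addrC subrK.
Qed.

Lemma space_int_orth k (f : 'rV[R]_k -> R) (U : 'M[R]_k) : tame f -> U *m U^T = 1%:M ->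
  space_int (fun y => f (y *m U)) = space_int f.
Proof.
move=> tf UU; rewrite (@space_int_similar k (fun y => y *m U) 1)//.
- by rewrite expr1n invr1 mul1r.
- by move=> a b; rewrite -mulmxBl enorm_isometry// mul1r.
- by move=> y; exists (y *m U^T); rewrite -mulmxA (mulmx1C UU) mulmx1.
Qed.

Lemma space_int_scale k (f : 'rV[R]_k -> R) t : tame f -> 0 < t ->
  space_int (fun y => f (t *: y)) = t ^- k * space_int f.
Proof.
move=> tf t0; rewrite (@space_int_similar k (fun y => t *: y) t)//.
- by move=> a b; rewrite -scalerBr enormZ gtr0_norm.
- by move=> y; exists (t^-1 *: y); rewrite scalerA divff ?scale1r// gt_eqF.
Qed.

Lemma affine_planeE n d (x : 'rV[R]_n) (B : 'M[R]_(d, n)) : B *m B^T = 1%:M ->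
  affine_plane x (B^T *m B) = [set x + w *m B | w in [set: 'rV[R]_d]].
Proof.
move=> BB; apply/seteqP; split=> [_ [v _ <-]|_ [w _ <-]].
  by exists (v *m B^T) => //; rewrite mulmxA.
by exists (w *m B) => //; rewrite mulmxA -(mulmxA w) BB mulmx1.
Qed.

Lemma closed_affine_plane n d (x : 'rV[R]_n) (B : 'M[R]_(d, n)) : B *m B^T = 1%:M ->
  closed (affine_plane x (B^T *m B)).
Proof.
move=> BB.
have -> : affine_plane x (B^T *m B) =
  (fun y : 'rV[R]_n => enorm ((y - x) - (y - x) *m (B^T *m B))) @^-1` [set t | t <= 0].
  apply/seteqP; split=> [_ [v _ <-]|y] /=.
    rewrite (addrAC x) subrr add0r -(mulmxA v) (mulmxA (B^T *m B)) -(mulmxA B^T) BB mulmx1.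
    by rewrite subrr enorm0.
  rewrite le_eqVlt ltNge enorm_ge0 orbF enorm_eq0 subr_eq0 => /eqP yE.
  by exists (y - x) => //; rewrite -yE addrC subrK.
apply: preimage_closed; last exact: closed_le.
move=> y _.
pose g (y : 'rV[R]_n) := (y - x) - (y - x) *m (B^T *m B).
apply: (@continuous_comp _ _ _ g); last exact: enorm_continuous.
apply: (@enorm_lip_continuous _ _ _ _ 2) => a b.
have -> : g a - g b = (a - b) - (a - b) *m B^T *m B.
  rewrite -mulmxA /g; have -> : a - b = (a - x) - (b - x) by rewrite opprB addrA subrK.
  rewrite [in RHS]mulmxBl; move: (_ *m _) => p; move: (_ *m _) => q.
  by apply/matrixP => i k; rewrite !mxE; ring.
apply: le_trans (ler_enormB _ _) _; rewrite enorm_isometry//.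
have : enorm ((a - b) *m B^T) <= enorm (a - b).
  rewrite -ler_sqr ?nnegrE ?enorm_ge0// !sqr_enorm dot_mulmx trmxK.
  move: (a - b) => c.
  have := dot_ge0 (c - c *m B^T *m B).
  rewrite dotDl !dotDr !dotNl !dotNr.
  have -> : dot (c *m B^T *m B) (c *m B^T *m B) = dot c (c *m B^T *m B).
    by rewrite dot_mulmx -(mulmxA _ B) BB mulmx1 dot_mulmx trmxK.
  rewrite (dotC (c *m B^T *m B) c); lra.
lra.
Qed.

(** An orthonormal basis B parametrizes the plane isometrically. *)
Lemma plane_integral n d (x : 'rV[R]_n) (B : 'M[R]_(d, n)) (f : 'rV[R]_n -> R) :
  B *m B^T = 1%:M -> (d <= n)%N -> tame f ->
  \int[hausdorff_measure R n d]_(y in affine_plane x (B^T *m B)) f y =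
  space_int (fun w : 'rV[R]_d => f (x + w *m B)).
Proof.
move=> BB dn tf.
pose j (w : 'rV[R]_d) := x + w *m B.
have jl a b : enorm (j a - j b) = 1 * enorm (a - b).
  by rewrite /j opprD addrACA subrr add0r -mulmxBl enorm_isometry// mul1r.
have cj : continuous j.
  by apply: (@enorm_lip_continuous _ _ _ _ 1) => a b; rewrite jl.
set E := affine_plane _ _.
have mE : measurable (E : set (borel_rV R n)).
  by apply: closed_borel; exact: closed_affine_plane.
have jE : j @^-1` E = setT.
  by apply/seteqP; split=> // w _; rewrite /E affine_planeE//; exists w.
have := @transfer R _ _ _ _ n (hausdorff_measure R n d) (H d) id j (NngNum ler01) E
  (cara_to_borel (fun x => cvg_id)) (cara_to_borel cj) mE.
rewrite jE => h.
have := h _ f tf.1 (tame_integrable _).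
rewrite mul1r; apply.
- move=> A _ AE; rewrite mul1e -[LHS]/(hausdorff d A) -[RHS]/(hausdorff d (j @^-1` A)).
  have AjE : A = j @` (j @^-1` A).
    apply/seteqP; split=> [y Ay|_ [w Aw <-]//].
    have := AE y Ay; rewrite /E affine_planeE// => -[w _ jw].
    by exists w => //=; rewrite /j jw.
  by rewrite [in LHS]AjE (@hausdorff_similar _ _ _ _ j 1)// expr1n mul1e.
- exact: (tame_isometry BB dn (tame_shift x tf)).
Qed.

End LamTheory.

(** * Positive functionals, and the Grassmannian as a quotient of the Stiefel manifold *)

Section PosFun.
Variables (R : realType) (n : nat).
Implicit Types (L : ('rV[R]_n -> R) -> R) (f g : 'rV[R]_n -> R).

Definition posfun L :=
  (forall a f g, tame f -> tame g -> L (fun x => a * f x + g x) = a * L f + L g) /\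
  (forall f, tame f -> (forall x, 0 <= f x) -> 0 <= L f).

Variable L : ('rV[R]_n -> R) -> R.
Hypothesis pL : posfun L.

Lemma posfun0 : L (fun=> 0) = 0.
Proof.
have := pL.1 (-1) _ _ (@tame0 R n) (@tame0 R n).
rewrite (_ : (fun x => -1 * 0 + 0) = (fun=> 0)); last first.
  by apply/funext => x; rewrite mulr0 addr0.
by move=> h; lra.
Qed.

Lemma posfunZ a f : tame f -> L (fun x => a * f x) = a * L f.
Proof.
move=> tf; have := pL.1 a _ _ tf (@tame0 R n).
rewrite posfun0 addr0 => <-; congr L; apply/funext => x; by rewrite addr0.
Qed.

Lemma posfunD f g : tame f -> tame g -> L (fun x => f x + g x) = L f + L g.
Proof.
move=> tf tg; have := pL.1 1 _ _ tf tg.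
rewrite mul1r => <-; congr L; apply/funext => x; by rewrite mul1r.
Qed.

Lemma posfunN f : tame f -> L (fun x => - f x) = - L f.
Proof.
move=> tf; rewrite -mulN1r -posfunZ//; congr L; apply/funext => x.
by rewrite mulN1r.
Qed.

Lemma posfunB f g : tame f -> tame g -> L (fun x => f x - g x) = L f - L g.
Proof. by move=> tf tg; rewrite posfunD ?posfunN//; exact: tameN. Qed.

Lemma posfun_sum (T : Type) (s : seq T) (F : T -> 'rV[R]_n -> R) :
  (forall t, tame (F t)) ->
  tame (fun x => \sum_(t <- s) F t x) /\
  L (fun x => \sum_(t <- s) F t x) = \sum_(t <- s) L (F t).
Proof.
move=> tF; elim: s => [|t s [tS IH]].
  have -> : (fun x : 'rV[R]_n => \sum_(t <- [::]) F t x) = (fun=> 0).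
    by apply/funext => x; rewrite big_nil.
  by rewrite big_nil posfun0; split=> //; exact: tame0.
have -> : (fun x => \sum_(j <- t :: s) F j x) = (fun x => F t x + \sum_(j <- s) F j x).
  by apply/funext => x; rewrite big_cons.
by rewrite big_cons posfunD// IH; split=> //; exact: tameD.
Qed.

Lemma posfun_le f g : tame f -> tame g -> (forall x, f x <= g x) -> L f <= L g.
Proof.
move=> tf tg fg; rewrite -subr_ge0 -posfunB//.
by apply: pL.2 => [|x]; [exact: tameB|rewrite subr_ge0].
Qed.

Lemma posfun_norm f g : tame f -> tame g -> (forall x, `|f x| <= g x) -> `|L f| <= L g.
Proof.
move=> tf tg fg; rewrite ler_norml -posfunN//.
apply/andP; split; apply: posfun_le => //; try exact: tameN.
  by move=> x; have := fg x; rewrite ler_norml => /andP[].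
by move=> x; exact: le_trans (ler_norm _) (fg x).
Qed.

Lemma posfun_weight f c : tame f -> (forall x, `|f x| <= c * weight x) ->
  `|L f| <= c * L (@weight R n).
Proof.
move=> tf h; rewrite -posfunZ; last exact: weight_tame.
by apply: posfun_norm => //; apply: tameZ; exact: weight_tame.
Qed.

Lemma posfun_weight_ge0 : 0 <= L (@weight R n).
Proof. by apply: pL.2; [exact: weight_tame|exact: weight_ge0]. Qed.

End PosFun.

Section Grass.
Variable R : realType.

Lemma space_int_posfun k : posfun (@space_int R k).
Proof. by split; [exact: space_int_lin|move=> f _; exact: space_int_ge0]. Qed.

(** Split off a normalized nonzero row e of P: the matrix P - e^T e is again an
    orthogonal projection, of rank one less. *)
Lemma orthonormal_factor n d (P : 'M[R]_n) : grassmannian d P ->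
  exists B : 'M[R]_(d, n), B *m B^T = 1%:M /\ P = B^T *m B.
Proof.
elim: d P => [|d IH] P [PP PT rP].
  exists 0; split; first by apply/matrixP => -[].
  by rewrite mulmx0; apply/eqP; rewrite -mxrank_eq0 rP.
have [i ri] : exists i, row i P != 0.
  apply: contrapT => h; have P0 : P = 0.
    apply/row_matrixP => i; rewrite row0; apply: contrapT => /eqP ri.
    by apply: h; exists i.
  by move: rP; rewrite P0 mxrank0.
pose v := row i P; have v0 : 0 < enorm v by rewrite enorm_gt0.
pose e := (enorm v)^-1 *: v.
have eP : e *m P = e by rewrite -scalemxAl /v -row_mul PP.
have PeT : P *m e^T = e^T by rewrite -{1}PT -trmx_mul eP.
have ee : e *m e^T = 1%:M.
  rewrite dot_mx -sqr_enorm enormZ ger0_norm ?invr_ge0 ?enorm_ge0//.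
  by rewrite mulVf ?expr1n// gt_eqF.
pose P' := P - e^T *m e.
have eP' : e *m P' = 0 by rewrite mulmxBr eP mulmxA ee mul1mx subrr.
have P'e : P' *m e^T = 0 by rewrite mulmxBl PeT -mulmxA ee mulmx1 subrr.
have PP' : P' *m P = P' by rewrite mulmxBl PP -mulmxA eP.
have P'P' : P' *m P' = P'.
  by rewrite {2}/P' mulmxBr PP' mulmxA P'e mul0mx subr0.
have P'T : P'^T = P' by rewrite /P' linearB /= trmx_mul trmxK PT.
have rP' : \rank P' = d.
  apply/eqP; rewrite eqn_leq; apply/andP; split; last first.
    have := mxrank_add P' (e^T *m e); rewrite subrK rP => h.
    have h2 : (\rank (e^T *m e) <= 1)%N.
      by apply: leq_trans (mxrankM_maxl _ _) _; exact: rank_leq_col.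
    by have := leq_trans h (leq_add (leqnn _) h2); rewrite addn1.
  rewrite -ltnS -rP.
  suff : (P' < P)%MS by rewrite ltmxErank => /andP[].
  rewrite /ltmx; apply/andP; split; first by apply/submxP; exists P'; rewrite PP'.
  apply/negP => PsP'.
  have /submxP[u eu] : (e <= P')%MS.
    apply: submx_trans PsP'; rewrite -eP; exact: submxMl.
  have e0 : e = 0 by rewrite eu -P'P' mulmxA -eu eP'.
  by have := ee; rewrite e0 mul0mx => /matrixP/(_ 0 0)/eqP; rewrite !mxE eqxx eq_sym oner_eq0.
have [B [BB P'E]] := IH P' (And3 P'P' P'T rP').
exists (col_mx e B : 'M[R]_(1 + d, n)).
have BP' : B *m P' = B by rewrite P'E mulmxA BB mul1mx.
have eB : e *m B^T = 0.
  by rewrite -BP' trmx_mul P'T mulmxA eP' mul0mx.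
have Be : B *m e^T = 0 by rewrite -[B]trmxK -trmx_mul eB trmx0.
have h1 : col_mx e B *m (col_mx e B)^T = 1%:M.
  by rewrite tr_col_mx mul_col_row ee eB Be BB -scalar_mx_block.
have h2 : P = (col_mx e B)^T *m col_mx e B.
  by rewrite tr_col_mx mul_row_col -P'E addrC subrK.
by split.
Qed.

Lemma grassmannian_factor n d (B : 'M[R]_(d, n)) : B *m B^T = 1%:M ->
  grassmannian d (B^T *m B).
Proof.
move=> BB; split.
- by rewrite mulmxA -(mulmxA B^T) BB mulmx1.
- by rewrite trmx_mul trmxK.
apply/eqP; rewrite eqn_leq; apply/andP; split.
  by apply: leq_trans (mxrankM_maxl _ _) _; exact: rank_leq_col.
have {1}-> : d = \rank (1%:M : 'M[R]_d) by rewrite mxrank1.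
rewrite -BB; apply: leq_trans (mxrankM_maxl _ _) _.
by rewrite -{1}[B]mul1mx -BB -mulmxA; exact: mxrankM_maxr.
Qed.

Lemma mx_continuous (T : topologicalType) p q (g : T -> 'M[R]_(p, q)) :
  (forall i j, continuous (fun x => g x i j)) -> continuous g.
Proof.
move=> h x A [P HP PA].
have : \forall y \near x, forall i j, P i j (g y i j).
  apply: filter_forall => i; apply: filter_forall => j.
  exact: (h i j x _ (HP i j)).
by apply: filterS => y hy; exact: PA.
Qed.

Lemma cont_sum (T : topologicalType) (I : Type) (s : seq I) (F : I -> T -> R) :
  (forall i, continuous (F i)) -> continuous (fun x => \sum_(i <- s) F i x).
Proof.
move=> cF; elim: s => [|i s IH].
  by rewrite (_ : (fun _ => _) = (fun=> 0)); [exact: contC|apply/funext => x; rewrite big_nil].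
rewrite (_ : (fun _ => _) = (fun x => F i x + \sum_(j <- s) F j x)).
  exact: contD.
by apply/funext => x; rewrite big_cons.
Qed.

Lemma cont_coord n (i : 'I_n) : continuous (fun x : 'rV[R]_n => x 0 i).
Proof.
move=> x; apply/continuous_enormP => e e0; exists e => // y xy.
by apply: le_lt_trans xy; have := coord_le_enorm (x - y) i; rewrite !mxE.
Qed.

Section Stiefel.
Variables (n d : nat).
(** Orthonormal d-frames, flattened to vectors so that the topology of row
    vectors applies. *)
Definition stiefel := [set v : 'rV[R]_(d * n) | vec_mx v *m (vec_mx v)^T = 1%:M].

Lemma vec_mx_cont i j : continuous (fun v : 'rV[R]_(d * n) => vec_mx v i j).
Proof.
by under eq_fun do rewrite mxE; exact: cont_coord.
Qed.

Lemma stiefel_compact : compact stiefel.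
Proof.
apply: bounded_closed_compact.
  exists 1; split; first exact: num_real.
  move=> M M1 v /= vS; apply: norm_leP => [|k]; first by rewrite ltW// (lt_trans _ M1).
  apply: le_trans (ltW M1).
  suff h (B : 'M[R]_(d, n)) : B *m B^T = 1%:M -> `|mxvec B 0 k| <= 1.
    by have := h _ vS; rewrite vec_mxK.
  move=> BB; case/mxvec_indexP: k => i j; rewrite mxvecE.
  have -> : B i j = ((delta_mx 0 i : 'rV[R]_d) *m B) 0 j by rewrite -rowE mxE.
  apply: le_trans (coord_le_enorm _ _) _.
  by rewrite (enorm_isometry _ BB) delta_enorm.
have -> : stiefel = (fun v => vec_mx v *m (vec_mx v)^T) @^-1` [set 1%:M] by [].
apply: preimage_closed.
  move=> v _; apply: mx_continuous => i j.
  under eq_fun do rewrite mxE.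
  apply: cont_sum => k; apply: contM; first exact: vec_mx_cont.
  by under eq_fun do rewrite mxE; exact: vec_mx_cont.
by apply: compact_closed; [exact: norm_hausdorff|exact: compact_set1].
Qed.

Lemma gram_continuous :
  continuous (fun v : 'rV[R]_(d * n) => (vec_mx v)^T *m vec_mx v : 'M[R]_n).
Proof.
apply: mx_continuous => i j; under eq_fun do rewrite mxE.
apply: cont_sum => k; apply: contM; last exact: vec_mx_cont.
by under eq_fun do rewrite mxE; exact: vec_mx_cont.
Qed.

Lemma grassmannianE :
  grassmannian d = [set (vec_mx v)^T *m vec_mx v | v in stiefel] :> set 'M[R]_n.
Proof.
apply/seteqP; split=> [P /orthonormal_factor[B [BB ->]]|_ [v vS <-]].
  by exists (mxvec B); rewrite /stiefel /= mxvecK.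
exact: grassmannian_factor.
Qed.

(** The image of a compact set of frames is compact, hence Borel; this replaces
    a measurable choice of a frame for each plane. *)
Lemma stiefel_image_measurable (A : set 'rV[R]_(d * n)) : closed A -> A `<=` stiefel ->
  measurable ([set (vec_mx v)^T *m vec_mx v | v in A] : set (borel_matrix R n)).
Proof.
move=> cA AS; have kA : compact A := subclosed_compact cA stiefel_compact AS.
rewrite -[X in measurable X]setCK; apply: measurableC.
apply: sub_sigma_algebra; apply: closed_openC.
apply: compact_closed; first exact: norm_hausdorff.
apply: continuous_compact => //; apply: continuous_subspaceT.
exact: gram_continuous.
Qed.

Lemma grassmannian_measurable : measurable (grassmannian d : set (borel_matrix R n)).
Proof.
rewrite grassmannianE; apply: stiefel_image_measurable => //.
by apply: compact_closed; [exact: norm_hausdorff|exact: stiefel_compact].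
Qed.

End Stiefel.
End Grass.

(** * Mean of the plane integrals through the origin *)

Section PlaneOp.
Variables (R : realType) (n d : nat).
Hypotheses (d0 : (0 < d)%N) (dn : (d < n)%N).
Let dn' : (d <= n)%N := ltnW dn.

Definition plane_int (f : 'rV[R]_n -> R) (P : 'M[R]_n) : R :=
  \int[hausdorff_measure R n d]_(y in affine_plane 0 P) f y.

Lemma plane_intE (f : 'rV[R]_n -> R) (B : 'M[R]_(d, n)) : tame f -> B *m B^T = 1%:M ->
  plane_int f (B^T *m B) = space_int (fun w : 'rV[R]_d => f (w *m B)).
Proof.
move=> tf BB; rewrite /plane_int plane_integral//.
by congr space_int; apply/funext => w; rewrite add0r.
Qed.

Lemma enorm_mul_vec (w : 'rV[R]_d) (u : 'rV[R]_(d * n)) :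
  enorm (w *m vec_mx u) <= n%:R * (d%:R * (enorm w * enorm u)).
Proof.
apply: le_trans (enorm_le_norm _) _; rewrite ler_wpM2l//.
apply: norm_leP => [|i]; first by rewrite !mulr_ge0 ?enorm_ge0.
rewrite mxE; apply: le_trans (ler_norm_sum _ _ _) _.
have -> : d%:R * (enorm w * enorm u) = \sum_(k < d) enorm w * enorm u.
  by rewrite sumr_const card_ord mulr_natl.
apply: ler_sum => k _; rewrite normrM mxE ler_pM//; exact: coord_le_enorm.
Qed.

(** The spare power of 1 + |w|^2, available because d < n, gives smallness far
    away. *)
Lemma weight_gain (w : 'rV[R]_d) M : 0 <= M -> M <= enorm w ->
  ((1 + enorm w ^+ 2)^-1) ^+ n.+1 <= (1 + M ^+ 2)^-1 * weight w.
Proof.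
move=> M0 Mw.
have a1 : (1 + enorm w ^+ 2)^-1 <= 1 by rewrite invf_le1 ?add1sqr_gt0// lerDl sqr_ge0.
have a0 : 0 <= (1 + enorm w ^+ 2)^-1 by rewrite invr_ge0 ltW// add1sqr_gt0.
apply: (@le_trans _ _ (((1 + enorm w ^+ 2)^-1) ^+ d.+2)).
  by rewrite ler_wiXn2l.
rewrite exprS ler_wpM2r ?weight_ge0//.
by rewrite lef_pV2 ?posrE ?add1sqr_gt0// lerD2l lerXn2r ?nnegrE ?enorm_ge0.
Qed.

(** Inside a large ball f is uniformly continuous; outside, the decay of f along
    every plane is uniform. *)
Lemma stiefel_cont (f : 'rV[R]_n -> R) v0 e : tame f -> stiefel v0 -> 0 < e ->
  exists2 del, 0 < del & forall v : 'rV[R]_(d * n), stiefel v -> enorm (v0 - v) < del ->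
    `|space_int (fun w : 'rV[R]_d => f (w *m vec_mx v0)) -
      space_int (fun w : 'rV[R]_d => f (w *m vec_mx v))| < e.
Proof.
move=> tf S0 e0; have [cf [C fC]] := tf.
have W0 := posfun_weight_ge0 (@space_int_posfun R d).
set W := space_int (@weight R d) in W0 *.
pose eta := e / (W + 1).
have eta0 : 0 < eta by rewrite divr_gt0// ltr_wpDl.
(* the decay of f gains the factor (1 + M^2)^-1 <= 1 / M outside the ball of radius M *)
pose M := 2 * `|C| / eta + 1.
have M1 : 1 <= M.
  by rewrite /M lerDr; apply: divr_ge0; [exact: mulr_ge0|exact: ltW].
have M0 : 0 <= M := le_trans ler01 M1.
have CM : 2 * `|C| * (1 + M ^+ 2)^-1 <= eta.
  rewrite ler_pdivrMr ?add1sqr_gt0// [eta * _]mulrC -ler_pdivrMr//.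
  apply: (@le_trans _ _ M); first by rewrite /M lerDl.
  by rewrite (@le_trans _ _ (M ^+ 2))// ?lerDr// expr2 ler_peMr.
(* the oscillation allowed inside the ball, at most eta times the weight there *)
have e1 : 0 < eta * ((1 + M ^+ 2)^-1) ^+ d.+1.
  by rewrite mulr_gt0// exprn_gt0// invr_gt0 add1sqr_gt0.
have [d1 d10 fd] := unif_cont (@compact_eball R n 0 M) (fun x _ => cf x) e1.
pose K := n%:R * (d%:R * M) + 1 : R.
have K0 : 0 < K by rewrite ltr_wpDl// !mulr_ge0.
exists (d1 / K) => [|v Sv vv0]; first by rewrite divr_gt0.
have t0 := tame_isometry S0 dn' tf; have tv := tame_isometry Sv dn' tf.
rewrite -(posfunB (@space_int_posfun R d) t0 tv).
apply: (@le_lt_trans _ _ (eta * W)); last first.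
  by rewrite /eta mulrAC ltr_pdivrMr ?ltr_wpDl// ltr_pM2l// ltrDl.
apply: (posfun_weight (@space_int_posfun R d)); first exact: tameB.
move=> w; have [wM|wM] := leP (enorm w) M.
  apply: (@le_trans _ _ (eta * ((1 + M ^+ 2)^-1) ^+ d.+1)).
    apply/ltW/fd; first by rewrite /= subr0 (enorm_isometry _ S0).
    rewrite -mulmxBr -linearB; apply: le_lt_trans (enorm_mul_vec _ _) _.
    apply: (@le_lt_trans _ _ (K * enorm (v0 - v))); last by rewrite mulrC -ltr_pdivlMr.
    rewrite !mulrA ler_wpM2r ?enorm_ge0// /K mulrA.
    by rewrite (@le_trans _ _ (n%:R * d%:R * M)) ?lerDl// ler_wpM2l// mulr_ge0.
  rewrite ler_wpM2l ?(ltW eta0)// /weight.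
  rewrite lerXn2r ?nnegrE ?invr_ge0 ?(ltW (add1sqr_gt0 _))//.
  by rewrite lef_pV2 ?posrE ?add1sqr_gt0// lerD2l lerXn2r ?nnegrE ?enorm_ge0.
have h v' : stiefel v' -> `|f (w *m vec_mx v')| <= `|C| * ((1 + M ^+ 2)^-1 * weight w).
  move=> Sv'; apply: le_trans (fC _) _.
  apply: (@le_trans _ _ (`|C| * weight (w *m vec_mx v'))).
    by rewrite ler_wpM2r ?weight_ge0// ler_norm.
  rewrite ler_wpM2l// /weight (enorm_isometry _ Sv'); apply: weight_gain => //.
  exact: ltW.
apply: le_trans (ler_normB _ _) _.
apply: le_trans (lerD (h _ S0) (h _ Sv)) _.
rewrite -mulr2n -mulr_natl !mulrA; apply: ler_wpM2r; [exact: weight_ge0|exact: CM].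
Qed.

(** The superlevel sets are images of closed sets of frames, by continuity of
    the plane integral in the frame. *)
Lemma plane_int_measurable (f : 'rV[R]_n -> R) : tame f ->
  measurable_fun (grassmannian d : set (borel_matrix R n)) (plane_int f).
Proof.
move=> tf; apply: (measurability _ (RGenCInfty.measurableE R)).
move=> _ [_ [r ->] <-].
pose F (v : 'rV[R]_(d * n)) := space_int (fun w : 'rV[R]_d => f (w *m vec_mx v)).
have -> : (grassmannian d `&` plane_int f @^-1` `[r, +oo[) =
    [set (vec_mx v)^T *m vec_mx v | v in [set v : 'rV[R]_(d * n) | stiefel v /\ r <= F v]].
  rewrite grassmannianE; apply/seteqP; split=> [_ [[v Sv <-]]|_ [v [Sv rv] <-]].
    by rewrite /= in_itv/= andbT plane_intE// => rF; exists v.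
  by split; [exists v|rewrite /= in_itv/= andbT plane_intE].
apply: stiefel_image_measurable => [v0 cv0|v []//].
have S0 : stiefel v0.
  have cS : closed (@stiefel R n d).
    by apply: compact_closed; [exact: norm_hausdorff|exact: stiefel_compact].
  apply: cS => A /cv0 [v [[Sv _] Av]]; by exists v.
split=> //; rewrite leNgt; apply/negP => h.
have e0 : 0 < r - F v0 by rewrite subr_gt0.
have [del del0 hd] := stiefel_cont tf S0 e0.
have /cv0[v [[Sv rv] /= vv]] : nbhs v0 [set v | enorm (v0 - v) < del].
  by apply/nbhs_enormP; exists del.
have := hd v Sv vv; rewrite -/(F v0) -/(F v) distrC ltr_norml => /andP[_ h2].
by move: rv h2; lra.
Qed.

Lemma plane_int_bound (f : 'rV[R]_n -> R) : tame f ->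
  exists C, forall P, grassmannian d P -> `|plane_int f P| <= C.
Proof.
move=> tf; have [cf [C fC]] := tf.
exists (`|C| * space_int (@weight R d)) => P /orthonormal_factor[B [BB ->]].
rewrite plane_intE//; apply: (posfun_weight (@space_int_posfun R d)).
  exact: tame_isometry.
move=> w; apply: le_trans (fC _) _.
apply: (@le_trans _ _ (`|C| * weight (w *m B))).
  by rewrite ler_wpM2r ?weight_ge0// ler_norm.
rewrite ler_wpM2l// /weight enorm_isometry// ler_wiXn2l//.
- by rewrite invr_ge0 (ltW (add1sqr_gt0 _)).
- by rewrite invf_le1 ?add1sqr_gt0// lerDl sqr_ge0.
Qed.

Variable mu : probability (borel_matrix R n) R.
Hypothesis rmu : rotation_invariant d mu.
Local Notation Gr := (grassmannian d : set (borel_matrix R n)).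

(** The value at the origin of the normal operator. *)
Definition planes_mean (f : 'rV[R]_n -> R) : R := \int[mu]_(P in Gr) plane_int f P.

Let mGr : measurable Gr := @grassmannian_measurable R n d.

Lemma plane_int_integrable (f : 'rV[R]_n -> R) : tame f ->
  mu.-integrable Gr (EFin \o plane_int f).
Proof.
move=> tf; have [C hC] := plane_int_bound tf.
apply: measurable_bounded_integrable => //.
- by rewrite [X in (X < _)%E](_ : _ = 1%E) ?ltry//; exact: rmu.1.
- exact: plane_int_measurable.
exists C; split; first exact: num_real.
by move=> M CM P GP; apply: le_trans (hC P GP) (ltW CM).
Qed.

Lemma plane_int_lin a (f g : 'rV[R]_n -> R) P : tame f -> tame g -> grassmannian d P ->
  plane_int (fun x => a * f x + g x) P = a * plane_int f P + plane_int g P.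
Proof.
move=> tf tg /orthonormal_factor[B [BB ->]].
rewrite !plane_intE//; last exact: tame_lin.
by apply: space_int_lin; exact: tame_isometry.
Qed.

Lemma planes_mean_posfun : posfun planes_mean.
Proof.
split=> [a f g tf tg|f tf f0].
  rewrite /planes_mean.
  have -> : \int[mu]_(P in Gr) plane_int (fun x => a * f x + g x) P =
     \int[mu]_(P in Gr) (a * plane_int f P + plane_int g P).
    by apply: eq_Rintegral => P /set_mem GP; exact: plane_int_lin.
  have i1 := plane_int_integrable tf; have i2 := plane_int_integrable tg.
  have i3 : mu.-integrable Gr (EFin \o (fun P => a * plane_int f P)).
    by have h := integrableZl mGr a i1; apply: eq_integrable h.
  rewrite RintegralD//.
  by rewrite RintegralZl.
apply: Rintegral_ge0 => P /orthonormal_factor[B [BB ->]].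
by rewrite plane_intE//; apply: space_int_ge0.
Qed.

Lemma planes_mean_scale (f : 'rV[R]_n -> R) t : tame f -> 0 < t ->
  planes_mean (fun y => f (t *: y)) = t ^- d * planes_mean f.
Proof.
move=> tf t0; rewrite /planes_mean -RintegralZl//; last exact: plane_int_integrable.
apply: eq_Rintegral => P /set_mem /orthonormal_factor[B [BB ->]].
rewrite !plane_intE//; last by apply: tame_scale => //; rewrite gt_eqF.
rewrite -space_int_scale//; last exact: tame_isometry.
by congr space_int; apply/funext => w; rewrite scalemxAl.
Qed.

(** The isometry U maps the plane of P to the plane of U^T P U, and mu is
    invariant under this action. *)
Lemma planes_mean_orth (f : 'rV[R]_n -> R) (U : 'M[R]_n) : tame f -> U *m U^T = 1%:M ->
  planes_mean (fun y => f (y *m U)) = planes_mean f.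
Proof.
move=> tf UU.
pose phi (P : 'M[R]_n) := U^T *m P *m U.
have mphi : measurable_fun setT (phi : borel_matrix R n -> borel_matrix R n).
  apply: (measurability (@open 'M[R]_n : set (set (borel_matrix R n))) erefl).
  move=> _ [A oA <-]; rewrite setTI; apply: sub_sigma_algebra.
  apply: open_comp => // P _; apply: mx_continuous => i j.
  under eq_fun do rewrite mxE.
  apply: cont_sum => k; under eq_fun do rewrite mulrC; apply: contZ.
  under eq_fun do rewrite mxE.
  by apply: cont_sum => l; apply: contZ; exact: coord_continuous.
have phiB (B : 'M[R]_(d, n)) : phi (B^T *m B) = (B *m U)^T *m (B *m U).
  by rewrite /phi trmx_mul !mulmxA.
have BU (B : 'M[R]_(d, n)) : B *m B^T = 1%:M -> (B *m U) *m (B *m U)^T = 1%:M.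
  by move=> BB; rewrite trmx_mul mulmxA -(mulmxA B) UU mulmx1.
have phiG P : grassmannian d P -> grassmannian d (phi P).
  move=> /orthonormal_factor[B [BB ->]]; rewrite phiB.
  by apply: grassmannian_factor; exact: BU.
have phiGE : phi @^-1` Gr = Gr.
  apply/seteqP; split=> P; last exact: phiG.
  have UU' := mulmx1C UU.
  move=> /orthonormal_factor[B [BB PB]].
  have -> : P = (B *m U^T)^T *m (B *m U^T).
    rewrite trmx_mul trmxK !mulmxA -(mulmxA U) -PB /phi !mulmxA UU mul1mx.
    by rewrite -mulmxA UU mulmx1.
  by apply: grassmannian_factor; rewrite trmx_mul trmxK mulmxA -(mulmxA B) UU' mulmx1.
(* change of variables needs a function measurable on all matrices *)
pose g := (EFin \o plane_int f) \_ Gr.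
have mg : measurable_fun setT (g : borel_matrix R n -> \bar R).
  apply/(measurable_restrictT _ _).1 => //.
  by apply/measurable_EFinP; exact: plane_int_measurable.
have ig : mu.-integrable (phi @^-1` Gr) (g \o phi).
  rewrite phiGE; have := plane_int_integrable (tame_isometry UU (leqnn n) tf).
  apply: eq_integrable => // P /set_mem GP /=.
  rewrite /g patchE mem_set; last exact: phiG.
  move: GP => /orthonormal_factor[B [BB ->]] /=; congr EFin.
  rewrite phiB !plane_intE//; [|exact: BU|exact: tame_isometry].
  by congr space_int; apply/funext => w; rewrite mulmxA.
have h := integral_pushforward mphi mg ig mGr.
rewrite /planes_mean /Rintegral; congr fine.
transitivity (\int[mu]_(P in Gr) (g P))%E; last first.
  by apply: eq_integral => P GP; rewrite /g patchE GP.
transitivity (\int[pushforward mu (phi : borel_matrix R n -> borel_matrix R n)]_(P in Gr) (g P))%E; last first.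
  apply: eq_measure_integral => A mA _.
  by rewrite -[RHS](rmu.2 U)//.
rewrite h phiGE; apply: eq_integral => P /set_mem GP /=.
rewrite /g patchE mem_set; last exact: phiG.
move: GP => /orthonormal_factor[B [BB ->]] /=; congr EFin.
rewrite phiB !plane_intE//; [|exact: BU|exact: tame_isometry].
by congr space_int; apply/funext => w; rewrite mulmxA.
Qed.

(** Every plane contributes the same positive amount. *)
Lemma planes_mean_radial_gt0 (f : 'rV[R]_n -> R) (phi : R -> R) r :
  tame f -> (forall x, f x = phi (enorm x)) -> (forall x, 0 <= f x) ->
  0 <= r -> 0 < phi r -> 0 < planes_mean f.
Proof.
move=> tf fphi f0 r0 phir.
have [P0 /orthonormal_factor[B0 [BB0 _]]] : Gr !=set0.
  apply/set0P/eqP => G0; have := rmu.1; rewrite G0 measure0 => /eqP.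
  by rewrite eqe eq_sym oner_eq0.
pose g (w : 'rV[R]_d) := f (w *m B0).
have gE (B : 'M[R]_(d, n)) (w : 'rV[R]_d) : B *m B^T = 1%:M -> f (w *m B) = g w.
  by move=> BB; rewrite /g !fphi !enorm_isometry.
have g0 : 0 < space_int g.
  pose w : 'rV[R]_d := r *: delta_mx 0 (Ordinal d0).
  apply: (@space_int_gt0 _ _ _ w d0); first exact: tame_isometry.
    by move=> y; exact: f0.
  by rewrite /g fphi enorm_isometry// enormZ delta_enorm mulr1 ger0_norm.
have -> : planes_mean f = space_int g; last by [].
rewrite /planes_mean.
have -> : \int[mu]_(P in Gr) plane_int f P = \int[mu]_(P in Gr) (space_int g).
  apply: eq_Rintegral => P /set_mem /orthonormal_factor[B [BB ->]].
  by rewrite plane_intE//; congr space_int; apply/funext => w; exact: gE.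
rewrite Rintegral_cst// [X in fine X](_ : _ = 1%E) ?mulr1//; exact: rmu.1.
Qed.

End PlaneOp.

(** * Riemann sums for positive functionals *)

Section Cutoff.
Variables (R : realType) (n : nat).
Implicit Types (x y : 'rV[R]_n) (f : 'rV[R]_n -> R).

Lemma cont_max (T : topologicalType) (f g : T -> R) :
  continuous f -> continuous g -> continuous (fun t => Num.max (f t) (g t)).
Proof. by move=> cf cg t; apply: continuous_max; [exact: cf|exact: cg]. Qed.

Lemma cont_min (T : topologicalType) (f g : T -> R) :
  continuous f -> continuous g -> continuous (fun t => Num.min (f t) (g t)).
Proof. by move=> cf cg t; apply: continuous_min; [exact: cf|exact: cg]. Qed.

Lemma contN (T : topologicalType) (f : T -> R) :
  continuous f -> continuous (fun t => - f t).
Proof. by move=> cf t; exact: (cvgN (cf t)). Qed.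

Lemma contX (T : topologicalType) (f : T -> R) k :
  continuous f -> continuous (fun t => f t ^+ k).
Proof.
move=> cf; elim: k => [|k IH].
  by under eq_fun do rewrite expr0; exact: contC.
by under eq_fun do rewrite exprS; exact: contM.
Qed.

Definition cutoff M x : R := Num.max 0 (Num.min 1 (M + 1 - enorm x)).

Lemma cutoff_cont M : continuous (cutoff M).
Proof.
apply: cont_max; first exact: contC.
apply: cont_min; first exact: contC.
by apply: contD; [exact: contC|apply: contN; exact: enorm_continuous].
Qed.

Lemma cutoff_ge0 M x : 0 <= cutoff M x.
Proof. by rewrite le_max lexx. Qed.

Lemma cutoff_le1 M x : cutoff M x <= 1.
Proof. by rewrite ge_max ler01 ge_min lexx. Qed.

Lemma cutoff1 M x : enorm x <= M -> cutoff M x = 1.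
Proof.
move=> h; rewrite /cutoff min_l ?max_r//.
by rewrite lerBrDr addrC lerD2r.
Qed.

Lemma cutoff_out M x : M + 1 < enorm x -> cutoff M x = 0.
Proof.
move=> h; apply/eqP; rewrite eq_le cutoff_ge0 andbT ge_max lexx/= ge_min.
by apply/orP; right; rewrite subr_le0 ltW.
Qed.

Lemma cutoff_tame M : tame (cutoff M).
Proof. by apply: (tame_compact (M := M + 1)); [exact: cutoff_cont|exact: cutoff_out]. Qed.

Lemma unif_cont_compact f M e : continuous f -> (forall x, M < enorm x -> f x = 0) ->
  0 < e -> exists2 del, 0 < del & forall x y, enorm (x - y) < del -> `|f x - f y| <= e.
Proof.
move=> cf f0 e0.
have [d1 d10 hd] := unif_cont (@compact_eball R n 0 (M + 1)) (fun x _ => cf x) e0.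
exists (Num.min d1 1); first by rewrite lt_min d10 ltr01.
move=> x y; rewrite lt_min => /andP[xy1 xy2].
have [xM|xM] := leP (enorm x) (M + 1).
  by apply/ltW/hd => //=; rewrite subr0.
have h := ler_enorm_dist x y.
by rewrite !f0 ?subrr ?normr0; [exact: ltW|lra|lra].
Qed.

End Cutoff.

Section RiemannSum.
Variables (R : realType) (n : nat).

Definition hat (t : R) : R := Num.max 0 (1 - `|t|).

Lemma hat_ge0 t : 0 <= hat t.
Proof. by rewrite le_max lexx. Qed.

Lemma hat_out t : 1 <= `|t| -> hat t = 0.
Proof. by move=> h; rewrite /hat max_l// subr_le0. Qed.

(** The translates of the hat function by integers form a partition of unity
    away from the ends of the range. *)
Lemma hat_sum m (s : R) : 0 <= s ->
  \sum_(k < m.+1) hat (s - k%:R) = Num.min 1 (Num.max 0 (m.+1%:R - s)).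
Proof.
move=> s0; elim: m => [|m IH].
  rewrite big_ord_recr big_ord0 /= add0r subr0 /hat ger0_norm//.
  by rewrite min_r// ge_max ler01/=; lra.
rewrite big_ord_recr/= IH /hat -[m.+2%:R]natr1.
move: (m.+1%:R) => a; rewrite /Num.min /Num.max.
by case: (ger0P (s - a)) => h; do ? case: ifPn; rewrite -?leNgt; move=> *; lra.
Qed.

Lemma hat_cont : continuous hat.
Proof.
apply: cont_max; first exact: contC.
by apply: contD; [exact: contC|apply: contN; exact: norm_continuous].
Qed.

Variables (h : R) (N : nat).
Local Notation idx := {ffun 'I_n -> 'I_(2 * N).+1}.

Definition node (k : idx) : 'rV[R]_n := \row_i (h * ((k i)%:R - N%:R)).
(** A tensor product of hats around [node k]: a partition of unity subordinate
    to a grid of step h. *)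
Definition theta (k : idx) (x : 'rV[R]_n) : R :=
  \prod_(i < n) hat (x 0 i / h - ((k i)%:R - N%:R)).

Lemma theta_ge0 k (x : 'rV[R]_n) : 0 <= theta k x.
Proof. by apply: prodr_ge0 => i _; exact: hat_ge0. Qed.

Lemma theta_cont k : continuous (theta k).
Proof.
rewrite /theta; elim: (index_enum _) => [|i s IH].
  by under eq_fun do rewrite big_nil; exact: contC.
under eq_fun do rewrite big_cons; apply: contM => //.
have c1 : continuous (fun x : 'rV[R]_n => x 0 i / h - ((k i)%:R - N%:R)).
  apply: contD; last exact: contC.
  by under eq_fun do rewrite mulrC; apply: contZ; exact: cont_coord.
move=> x.
have h2 := @cont_comp_R _ _ (fun x => x 0 i / h - ((k i)%:R - N%:R)) hat x (c1 x) (@hat_cont _).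
exact: h2.
Qed.

Lemma theta_sum (x : 'rV[R]_n) : 0 < h -> (forall i, `|x 0 i| <= h * N%:R) ->
  \sum_k theta k x = 1.
Proof.
move=> h0 xN; rewrite /theta.
rewrite -(bigA_distr_bigA (fun i (j : 'I_(2 * N).+1) => hat (x 0 i / h - (j%:R - N%:R)))).
rewrite big1// => i _.
have : - N%:R <= x 0 i / h <= N%:R.
  by have := xN i; rewrite ler_norml ler_pdivlMr// ler_pdivrMr// mulNr mulrC.
move=> /andP[h1 h2].
under eq_bigr do rewrite opprB addrA.
rewrite hat_sum; last by lra.
rewrite -natr1 natrM min_l//; rewrite le_max; apply/orP; right; lra.
Qed.

Lemma theta_near k (x : 'rV[R]_n) : 0 < h -> theta k x != 0 -> enorm (x - node k) <= n%:R * h.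
Proof.
move=> h0 /prodf_neq0 hk; apply: le_trans (enorm_le_norm _) _.
rewrite ler_wpM2l//; apply: norm_leP => [|i]; first exact: ltW.
rewrite !mxE leNgt; apply/negP => hi; have := hk i isT; apply/negP; rewrite negbK.
apply/eqP/hat_out.
have -> : x 0 i / h - ((k i)%:R - N%:R) = (x 0 i - h * ((k i)%:R - N%:R)) / h.
  by rewrite mulrBl mulrAC divff ?mul1r// gt_eqF.
by rewrite normrM normfV (gtr0_norm h0) ler_pdivlMr// mul1r ltW.
Qed.

End RiemannSum.

Section RS.
Variables (R : realType) (n : nat).
Variable L : ('rV[R]_n -> R) -> R.
Hypothesis pL : posfun L.

(** One finite sum serves all g with a given modulus of continuity: the points
    and coefficients come from a partition of unity of mesh e and do not depend
    on g.  This uniformity is what allows functionals to be interchanged. *)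
Lemma riemann_sum (phi : 'rV[R]_n -> R) M e : continuous phi -> (forall x, 0 <= phi x) ->
  (forall x, M < enorm x -> phi x = 0) -> 0 < e ->
  exists s : seq ('rV[R]_n * R), forall (g : 'rV[R]_n -> R) w,
    tame (fun x => g x * phi x) ->
    (forall x y, phi x != 0 -> enorm (x - y) <= e -> `|g x - g y| <= w) ->
    `|L (fun x => g x * phi x) - \sum_(p <- s) p.2 * g p.1| <= w * L phi.
Proof.
move=> cphi phi0 phiM e0.
pose h := e / n.+1%:R; have h0 : 0 < h by rewrite divr_gt0.
have nh : n%:R * h <= e.
  by rewrite /h mulrCA ler_piMr ?(ltW e0)// ler_pdivrMr// mul1r ler_nat.
(* the grid of step h and N points in each direction covers the support of phi *)
pose N := (Num.truncn (`|M| / h)).+1.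
have hN : `|M| <= h * N%:R.
  by rewrite mulrC -ler_pdivrMr// ltW// truncnS_gt.
have tphi : tame phi by exact: tame_compact phiM.
have ttheta k : tame (fun x => phi x * theta h (N := N) k x).
  apply: (tame_compact (M := M)); first by apply: contM => //; exact: theta_cont.
  by move=> x /phiM ->; rewrite mul0r.
pose s := [seq (node h k, L (fun x => phi x * theta h (N := N) k x)) |
  k <- enum {ffun 'I_n -> 'I_(2 * N).+1}].
exists s => g w tg gw.
have -> : \sum_(p <- s) p.2 * g p.1 =
  L (fun x => \sum_(k <- enum {ffun 'I_n -> 'I_(2 * N).+1})
      g (node h k) * (phi x * theta h k x)).
  rewrite big_map; have [_ ->] := posfun_sum pL (enum {ffun 'I_n -> 'I_(2 * N).+1})
     (fun k => tameZ (g (node h k)) (ttheta k)).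
  by apply: eq_bigr => k _; rewrite posfunZ//= mulrC.
have [tS _] := posfun_sum pL (enum {ffun 'I_n -> 'I_(2 * N).+1})
     (fun k => tameZ (g (node h k)) (ttheta k)).
rewrite -posfunB// -posfunZ//; apply: posfun_norm => //; [exact: tameB|exact: tameZ|].
move=> x; have [->|phix] := eqVneq (phi x) 0.
  rewrite !mulr0 big1 ?subrr ?normr0// => k _.
  by rewrite mul0r mulr0.
have xM : enorm x <= `|M|.
  rewrite (le_trans _ (ler_norm _))// leNgt; apply/negP => /phiM phix0.
  by move: phix; rewrite phix0 eqxx.
have S1 : \sum_(k : {ffun 'I_n -> 'I_(2 * N).+1}) theta h k x = 1.
  by apply: theta_sum => // i; apply: le_trans (coord_le_enorm _ _) (le_trans xM hN).
rewrite big_enum /=.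
have -> : g x * phi x = \sum_(k : {ffun 'I_n -> 'I_(2 * N).+1}) g x * phi x * theta h k x.
  by rewrite -mulr_sumr S1 mulr1.
rewrite -sumrB; apply: le_trans (ler_norm_sum _ _ _) _.
have -> : w * phi x = \sum_(k : {ffun 'I_n -> 'I_(2 * N).+1}) w * (phi x * theta h k x).
  by rewrite -mulr_sumr -mulr_sumr S1 mulr1.
apply: ler_sum => k _; rewrite -mulrA -mulrBl normrM.
have p0 : 0 <= phi x * theta h k x by rewrite mulr_ge0// theta_ge0.
rewrite (ger0_norm p0).
have [->|tk] := eqVneq (theta h k x) 0; first by rewrite !mulr0.
rewrite ler_wpM2r//; apply: gw => //.
exact: le_trans (theta_near h0 tk) nh.
Qed.

End RS.

(** * Interchange of two functionals, and a similarity invariant kernel *)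

Section Swap.
Variables (R : realType) (n : nat).
Implicit Types (x y : 'rV[R]_n).

Lemma small_eq (a b K : R) : (forall e, 0 < e -> `|a - b| <= e * K) -> a = b.
Proof.
move=> h; apply/eqP; rewrite -subr_eq0 -normr_le0; apply/ler_addgt0Pr => e e0.
rewrite add0r; have K0 : 0 < `|K| + 1 by rewrite ltr_wpDl.
apply: le_trans (h (e / (`|K| + 1)) _) _; first by rewrite divr_gt0.
rewrite mulrAC ler_pdivrMr// ler_wpM2l ?(ltW e0)//.
by rewrite (le_trans (ler_norm _))// lerDl.
Qed.

Variables (L1 L2 : ('rV[R]_n -> R) -> R) (k : 'rV[R]_n -> 'rV[R]_n -> R) (M : R).
Hypotheses (pL1 : posfun L1) (pL2 : posfun L2).
Hypothesis kx : forall e, 0 < e -> exists2 del, 0 < del &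
  forall x x' y, enorm (x - x') < del -> `|k x y - k x' y| <= e.
Hypothesis ky : forall e, 0 < e -> exists2 del, 0 < del &
  forall x y y', enorm (y - y') < del -> `|k x y - k x y'| <= e.
Hypothesis kMx : forall x y, M < enorm x -> k x y = 0.
Hypothesis kMy : forall x y, M < enorm y -> k x y = 0.

Lemma kernel_tame x : tame (k x).
Proof.
apply: (tame_compact (M := M)); last by move=> y; exact: kMy.
move=> y; apply/continuous_enormP => e e0.
have e2 : 0 < e / 2 by rewrite divr_gt0.
have [del del0 h] := ky e2; exists del => // y' yy'.
by apply: le_lt_trans (h x y y' yy') _; lra.
Qed.

Lemma kernel_mean_tame : tame (fun x => L2 (k x)).
Proof.
have B0 := pL2.2 _ (cutoff_tame n M) (cutoff_ge0 M).
apply: (tame_compact (M := M)); last first.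
  move=> x xM; rewrite (_ : k x = fun=> 0) ?posfun0//.
  by apply/funext => y; exact: kMx.
move=> x; apply/continuous_enormP => e e0.
have e2 : 0 < e / (L2 (@cutoff R n M) + 1) by rewrite divr_gt0// ltr_wpDl.
have [del del0 h] := kx e2; exists del => // x' xx'.
rewrite -posfunB//; try exact: kernel_tame.
apply: (@le_lt_trans _ _ (e / (L2 (@cutoff R n M) + 1) * L2 (@cutoff R n M))).
  rewrite -posfunZ//; last exact: cutoff_tame.
  apply: posfun_norm => //.
  - by apply: tameB; exact: kernel_tame.
  - by apply: tameZ; exact: cutoff_tame.
  move=> y; have [yM|yM] := leP (enorm y) M.
    by rewrite cutoff1// mulr1; exact: h.
  by rewrite !kMy// subrr normr0 mulr_ge0 ?cutoff_ge0// ltW.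
by rewrite mulrAC ltr_pdivrMr ?ltr_wpDl// ltr_pM2l// ltrDl.
Qed.

End Swap.

(** Fubini for functionals without a product measure: replace L2 by the same
    Riemann sum for all x. *)
Lemma posfun_swap (R : realType) n (L1 L2 : ('rV[R]_n -> R) -> R) k M :
  posfun L1 -> posfun L2 ->
  (forall e, 0 < e -> exists2 del, 0 < del &
    forall x x' y, enorm (x - x') < del -> `|k x y - k x' y| <= e) ->
  (forall e, 0 < e -> exists2 del, 0 < del &
    forall x y y', enorm (y - y') < del -> `|k x y - k x y'| <= e) ->
  (forall x y, M < enorm x -> k x y = 0) ->
  (forall x y, M < enorm y -> k x y = 0) ->
  L1 (fun x => L2 (k x)) = L2 (fun y => L1 (fun x => k x y)).
Proof.
move=> pL1 pL2 kx ky kMx kMy.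
have tA1 := kernel_mean_tame pL2 kx ky kMx kMy.
have kx' : forall e, 0 < e -> exists2 del, 0 < del &
    forall y x x' , enorm (x - x') < del -> `|k x y - k x' y| <= e.
  by move=> e /kx[del d0 h]; exists del => // *; exact: h.
have ky' : forall e, 0 < e -> exists2 del, 0 < del &
    forall y y' x, enorm (y - y') < del -> `|k x y - k x y'| <= e.
  by move=> e /ky[del d0 h]; exists del => // *; exact: h.
have tA2 := kernel_mean_tame (k := fun y x => k x y) pL1 ky' kx'
  (fun y x => kMy x y) (fun y x => kMx x y).
have tk1 := kernel_tame ky kMy.
have tk2 y : tame (fun x => k x y).
  exact: (kernel_tame (k := fun y x => k x y) kx' (fun y x => kMx x y)).
set B := @cutoff R n M.
have tB : tame B := cutoff_tame n M.
have B1 : 0 <= L1 B := pL1.2 _ tB (cutoff_ge0 M).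
have B2 : 0 <= L2 B := pL2.2 _ tB (cutoff_ge0 M).
apply: (@small_eq _ _ _ (2 * (L1 B * L2 B))) => e e0.
have [del del0 hdel] := ky' _ e0.
have del2 : 0 < del / 2 by rewrite divr_gt0.
have [s hs] := riemann_sum pL2 (@cutoff_cont R n M) (cutoff_ge0 M) (@cutoff_out R n M) del2.
have cut (g : 'rV[R]_n -> R) : (forall y, M < enorm y -> g y = 0) -> (fun y => g y * B y) = g.
  move=> g0; apply/funext => y; have [yM|yM] := leP (enorm y) M.
    by rewrite /B cutoff1// mulr1.
  by rewrite g0// mul0r.
have near x y : enorm (x - y) <= del / 2 -> enorm (x - y) < del by lra.
have h1 x : `|L2 (k x) - \sum_(p <- s) p.2 * k x p.1| <= e * L2 B.
  have := hs (k x) e; rewrite cut; last by move=> y; exact: kMy.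
  apply=> // y y' _ /near; exact: hdel.
have A2e y y' : enorm (y - y') < del ->
    `|L1 (fun x => k x y) - L1 (fun x => k x y')| <= e * L1 B.
  move=> yy'; rewrite -posfunB// -posfunZ//; apply: posfun_norm => //.
  - exact: tameB.
  - exact: tameZ.
  move=> x; have [xM|xM] := leP (enorm x) M.
    by rewrite /B cutoff1// mulr1; exact: hdel.
  by rewrite !kMx// subrr normr0 mulr_ge0 ?cutoff_ge0// ltW.
have h2 : `|L2 (fun y => L1 (fun x => k x y)) -
    \sum_(p <- s) p.2 * L1 (fun x => k x p.1)| <= e * L1 B * L2 B.
  have := hs (fun y => L1 (fun x => k x y)) (e * L1 B); rewrite cut; last first.
    move=> y yM; rewrite (_ : (fun x => k x y) = fun=> 0) ?posfun0//.
    by apply/funext => x; exact: kMy.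
  by apply=> // y y' _ /near; exact: A2e.
have [tS LS] := posfun_sum pL1 s (fun p => tameZ p.2 (tk2 p.1)).
have h3 : `|L1 (fun x => L2 (k x)) - \sum_(p <- s) p.2 * L1 (fun x => k x p.1)|
    <= e * L2 B * L1 B.
  have <- : L1 (fun x => \sum_(p <- s) p.2 * k x p.1) =
      \sum_(p <- s) p.2 * L1 (fun x => k x p.1).
    by rewrite LS; apply: eq_bigr => p _; rewrite posfunZ.
  rewrite -posfunB// -posfunZ//; apply: posfun_norm => //.
  - exact: tameB.
  - exact: tameZ.
  move=> x; have [xM|xM] := leP (enorm x) M.
    by rewrite /B cutoff1// mulr1.
  rewrite (_ : k x = fun=> 0) ?posfun0//; last by apply/funext => y; exact: kMx.
  rewrite big1 ?subrr ?normr0 => [|p _]; last by rewrite mulr0.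
  by rewrite !mulr_ge0 ?cutoff_ge0// ltW.
rewrite distrC in h2.
set a := \sum_(p <- s) _ in h2 h3.
rewrite -(subrK a (L1 _)) -addrA; apply: le_trans (ler_normD _ _) _.
by apply: le_trans (lerD h3 h2) _; lra.
Qed.

Section Kernel.
Variables (R : realType) (n : nat).
Implicit Types (x y : 'rV[R]_n).

(** The reflection in the hyperplane orthogonal to x - x'. *)
Lemma householder x x' : enorm x = enorm x' ->
  exists U : 'M[R]_n, U *m U^T = 1%:M /\ x *m U = x'.
Proof.
move=> xx'; pose v := x - x'.
have [v0|v0] := eqVneq v 0.
  exists 1%:M; rewrite trmx1 mulmx1; split=> //; rewrite mulmx1.
  by apply/eqP; rewrite -subr_eq0 -/v v0.
pose q := dot v v; have q0 : q != 0 by rewrite /q -sqr_enorm sqrf_eq0 enorm_eq0.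
have vv : v *m v^T = q%:M by rewrite dot_mx.
have xx : dot x x = dot x' x' by rewrite -!sqr_enorm xx'.
have qE : q = 2 * dot x v.
  rewrite /q /v dotDl !dotDr !dotNl !dotNr (dotC x' x) -xx; ring.
have xv : x - v = x' by rewrite opprB addrC subrK.
clearbody q v.
exists (1%:M - (2 / q) *: (v^T *m v)); split.
  have -> : (1%:M - (2 / q) *: (v^T *m v))^T = 1%:M - (2 / q) *: (v^T *m v).
    by rewrite linearB linearZ /= trmx1 trmx_mul trmxK.
  rewrite mulmxBl mul1mx mulmxBr mulmx1 -scalemxAl -scalemxAr.
  rewrite mulmxA -(mulmxA v^T) vv mul_mx_scalar -scalemxAl !scalerA.
  have -> : 2 / q * (2 / q * q) = 2 / q + 2 / q by field.
  by rewrite scalerDl opprB; move: (_ *: _) => w; rewrite addrK subrK.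
rewrite mulmxBr mulmx1 -scalemxAr mulmxA dot_mx mul_scalar_mx scalerA.
have -> : 2 / q * dot x v = 1 by rewrite mulrAC -qE divff.
by rewrite scale1r.
Qed.

(** A kernel concentrated near the diagonal, relative to the size of x and y,
    invariant under rotations and homogeneous of degree 2 under dilations. *)
Definition simker (del : R) x y : R :=
  Num.max 0 (del * (enorm x * enorm y) - enorm (x - y) ^+ 2).

Lemma simker_ge0 del x y : 0 <= simker del x y.
Proof. by rewrite le_max lexx. Qed.

Lemma simkerC del x y : simker del x y = simker del y x.
Proof. by rewrite /simker enormB [enorm x * _]mulrC. Qed.

Lemma simker_orth del x y (U : 'M[R]_n) : U *m U^T = 1%:M ->
  simker del (x *m U) (y *m U) = simker del x y.
Proof. by move=> UU; rewrite /simker -mulmxBl !enorm_isometry. Qed.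

Lemma simkerZ del t x y : 0 < t -> simker del (t *: x) (t *: y) = t ^+ 2 * simker del x y.
Proof.
move=> t0; rewrite /simker -scalerBr !enormZ (gtr0_norm t0) maxr_pMr ?mulr0 ?sqr_ge0//.
by congr Num.max; ring.
Qed.

Lemma simker_neq0 del x y : simker del x y != 0 ->
  enorm (x - y) ^+ 2 < del * (enorm x * enorm y).
Proof.
apply: contraNT; rewrite -leNgt => h.
by rewrite /simker max_l// subr_le0.
Qed.

Lemma simker_supp del x y : del <= 2^-1 -> simker del x y != 0 -> enorm y <= 2 * enorm x.
Proof.
move=> d2 /simker_neq0 h; rewrite leNgt; apply/negP => xy.
have hx := enorm_ge0 x.
have h1 : enorm (x - y) ^+ 2 >= (enorm y - enorm x) ^+ 2.
  rewrite lerXn2r ?nnegrE ?enorm_ge0//; first lra.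
  by rewrite enormB; exact: ler_enorm_dist.
have : 0 <= enorm x * enorm y by rewrite mulr_ge0// enorm_ge0.
move: h h1 xy hx; move: (enorm (x - y) ^+ 2) (enorm x) (enorm y) => a b c.
move=> h h1 xy hx bc.
have h3 : del * (b * c) <= 2^-1 * (b * c) by rewrite ler_wpM2r.
have h4 : 0 < c by lra.
have h5 : (2 * b) * (c - 2 * b) >= 0 by rewrite mulr_ge0//; lra.
have h6 : 0 < c * (c - 2 * b) by rewrite mulr_gt0//; lra.
move: h1; rewrite sqrrB; nra.
Qed.

Lemma max0_lip (a b : R) : `|Num.max 0 a - Num.max 0 b| <= `|a - b|.
Proof.
case: (leP 0 a) => ha; case: (leP 0 b) => hb; rewrite ?subrr ?subr0 ?sub0r ?normr0//.
- by rewrite ger0_norm// ger0_norm; lra.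
- by rewrite normrN ger0_norm// ler0_norm; lra.
Qed.

(** Lipschitz in x locally uniformly in y; the constants are crude. *)
Lemma simker_lip del x x' y : 0 <= del <= 1 ->
  `|simker del x y - simker del x' y| <=
  enorm (x - x') * (enorm x + enorm x' + 3 * enorm y).
Proof.
move=> /andP[d0 d1]; apply: le_trans (max0_lip _ _) _.
have -> : del * (enorm x * enorm y) - enorm (x - y) ^+ 2 -
   (del * (enorm x' * enorm y) - enorm (x' - y) ^+ 2) =
   del * enorm y * (enorm x - enorm x') +
   (enorm (x' - y) - enorm (x - y)) * (enorm (x' - y) + enorm (x - y)) by ring.
apply: le_trans (ler_normD _ _) _; rewrite !normrM.
have h1 : `|enorm x - enorm x'| <= enorm (x - x') := ler_dist_enorm x x'.
have h2 : `|enorm (x' - y) - enorm (x - y)| <= enorm (x - x').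
  apply: le_trans (ler_dist_enorm _ _) _.
  by rewrite opprB addrA subrK enormB.
have h3 : `|enorm (x' - y) + enorm (x - y)| <= enorm x + enorm x' + 2 * enorm y.
  rewrite ger0_norm ?addr_ge0 ?enorm_ge0//.
  have := ler_enormB x y; have := ler_enormB x' y; lra.
have h4 : `|del| * `|enorm y| <= enorm y.
  by rewrite !ger0_norm ?enorm_ge0// ler_piMl ?enorm_ge0.
apply: (@le_trans _ _ (enorm y * enorm (x - x') +
   enorm (x - x') * (enorm x + enorm x' + 2 * enorm y))).
  apply: lerD; apply: ler_pM => //; rewrite ?mulr_ge0//.
by rewrite le_eqVlt; apply/orP; left; apply/eqP; ring.
Qed.

Lemma simker_tame del x : 0 <= del <= 2^-1 -> tame (simker del x).
Proof.
move=> /andP[d0 d2]; apply: (tame_compact (M := 2 * enorm x)); last first.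
  move=> y xy; apply/eqP; apply: contraLR xy => /(simker_supp d2).
  by rewrite -leNgt.
apply: cont_max; first exact: contC.
apply: contD; first by apply: contZ; apply: contZ; exact: enorm_continuous.
apply: contN; apply: contX => y.
apply/continuous_enormP => e e0; exists e => // z yz.
apply: le_lt_trans (ler_dist_enorm _ _) _.
by rewrite opprB addrC addrA subrK enormB.
Qed.

Variables (L : ('rV[R]_n -> R) -> R) (p : nat) (e0 : 'rV[R]_n).
Hypotheses (pL : posfun L) (e01 : enorm e0 = 1).
Hypothesis L_orth : forall f (U : 'M[R]_n), tame f -> U *m U^T = 1%:M ->
  L (fun y => f (y *m U)) = L f.
Hypothesis L_scale : forall f t, tame f -> 0 < t -> L (fun y => f (t *: y)) = t ^- p * L f.

(** All x are similar to e0, so L applied to the kernel at x is a power of |x|. *)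
Lemma simker_mean del x : 0 <= del <= 2^-1 ->
  L (simker del x) = L (simker del e0) * enorm x ^+ p.+2.
Proof.
move=> d2; have tk := simker_tame _ d2.
have [->|x0] := eqVneq x 0.
  rewrite enorm0 expr0n mulr0 (_ : simker del 0 = fun=> 0) ?posfun0//.
  apply/funext => y; rewrite /simker enorm0 mul0r mulr0 sub0r max_l//.
  by rewrite oppr_le0 sqr_ge0.
have x0' : 0 < enorm x by rewrite enorm_gt0.
have [U [UU e0U]] : exists U : 'M[R]_n, U *m U^T = 1%:M /\ (enorm x *: e0) *m U = x.
  by apply: householder; rewrite enormZ e01 mulr1 ger0_norm ?enorm_ge0.
rewrite -(L_orth (tk x) UU) -{1}e0U.
have -> : (fun y => simker del (enorm x *: e0 *m U) (y *m U)) =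
    simker del (enorm x *: e0).
  by apply/funext => y; rewrite simker_orth.
have -> : L (simker del (enorm x *: e0)) =
    enorm x ^+ p * L (fun y => simker del (enorm x *: e0) (enorm x *: y)).
  by rewrite L_scale// mulrA divff ?mul1r// gt_eqF// exprn_gt0.
have -> : (fun y => simker del (enorm x *: e0) (enorm x *: y)) =
   (fun y => enorm x ^+ 2 * simker del e0 y).
  by apply/funext => y; rewrite simkerZ.
by rewrite posfunZ// mulrA -exprD addn2 mulrC.
Qed.

End Kernel.

(** * Uniqueness of positive functionals with given symmetries *)

Section Uniqueness.
Variables (R : realType) (n : nat).
Variables (L1 L2 : ('rV[R]_n -> R) -> R) (p1 p2 : nat) (e0 : 'rV[R]_n).
Hypotheses (pL1 : posfun L1) (pL2 : posfun L2) (e01 : enorm e0 = 1).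
Hypothesis L1_orth : forall f (U : 'M[R]_n), tame f -> U *m U^T = 1%:M ->
  L1 (fun y => f (y *m U)) = L1 f.
Hypothesis L1_scale : forall f t, tame f -> 0 < t -> L1 (fun y => f (t *: y)) = t ^- p1 * L1 f.
Hypothesis L2_orth : forall f (U : 'M[R]_n), tame f -> U *m U^T = 1%:M ->
  L2 (fun y => f (y *m U)) = L2 f.
Hypothesis L2_scale : forall f t, tame f -> 0 < t -> L2 (fun y => f (t *: y)) = t ^- p2 * L2 f.

Section Fix_f.
Variables (f : 'rV[R]_n -> R) (M : R).
Hypotheses (cf : continuous f) (fM : forall x, M < enorm x -> f x = 0) (M1 : 1 <= M).

Let F := `|xget 0 [set C | forall x, `|f x| <= C]|.

Let fF x : `|f x| <= F.
Proof.
have [_ [C fC]] := tame_compact cf fM.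
have hC : forall x, `|f x| <= `|C|.
  move=> y; apply: le_trans (fC y) _; apply: le_trans (ler_norm _) _.
  by rewrite normrM ler_piMr// ger0_norm ?weight_ge0// weight_le1.
rewrite /F; case: xgetP => [D _ hD|h]; last by case: (h `|C|).
exact: le_trans (hD x) (ler_norm _).
Qed.

Let F0 : 0 <= F. Proof. exact: normr_ge0. Qed.

Lemma fker_x del e : 0 <= del <= 2^-1 -> 0 < e -> exists2 r, 0 < r &
  forall x x' y, enorm (x - x') < r -> `|f x * simker del x y - f x' * simker del x' y| <= e.
Proof.
move=> /[dup] dd /andP[d0 d2] e00.
pose a := 2 * (M + 1).
have a0 : 0 < a by rewrite /a; have := M1; lra.
have e1 : 0 < e / 2 / a ^+ 2 by rewrite !divr_gt0// exprn_gt0.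
have [r1 r10 hr1] := unif_cont_compact cf fM e1.
have q0 : 0 < 8 * a * F + 1.
  by rewrite ltr_wpDl//; apply: mulr_ge0 => //; apply: mulr_ge0 => //; exact: ltW.
exists (Num.min 1 (Num.min r1 (e / 2 / (8 * a * F + 1)))).
  by rewrite !lt_min r10 ltr01/= !divr_gt0.
move=> x x' y; rewrite !lt_min => /and3P[xx1 xx2 xx3].
have n1 := ler_enorm_dist x x'.
have n2 : enorm x' - enorm x <= enorm (x - x').
  by rewrite enormB; exact: ler_enorm_dist.
have [hM|hM] := boolP ((enorm x <= M + 1) && (enorm x' <= M + 1)); last first.
  have [h1 h2] : M < enorm x /\ M < enorm x'.
    by move: hM; rewrite negb_and -!ltNge => /orP[]; lra.
  by rewrite !fM// !mul0r subrr normr0 ltW.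
move: hM => /andP[h1 h2].
have [ya|ya] := leP (enorm y) a; last first.
  have k0 z : enorm z <= M + 1 -> simker del z y = 0.
    move=> h; apply/eqP; apply: contraLR ya => /(simker_supp d2) h3.
    by rewrite -leNgt (le_trans h3)// ler_wpM2l.
  by rewrite !k0// !mulr0 subrr normr0 ltW.
have -> : f x * simker del x y - f x' * simker del x' y =
  (f x - f x') * simker del x y + f x' * (simker del x y - simker del x' y) by ring.
apply: le_trans (ler_normD _ _) _; rewrite !normrM.
have b1 : `|simker del x y| <= a ^+ 2.
  rewrite ger0_norm ?simker_ge0// ge_max sqr_ge0/= lerBlDr.
  apply: (@le_trans _ _ (enorm x * enorm y)).
    by rewrite ler_piMl ?mulr_ge0 ?enorm_ge0//; lra.
  apply: (@le_trans _ _ (a ^+ 2)); last by rewrite lerDl sqr_ge0.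
  rewrite expr2 ler_pM ?enorm_ge0//; rewrite /a; have := M1; lra.
have b2 : `|simker del x y - simker del x' y| <= enorm (x - x') * (8 * a).
  apply: le_trans (simker_lip _ _ _ _) _; first by apply/andP; split; lra.
  rewrite ler_wpM2l ?enorm_ge0//; have := M1; rewrite /a in ya a0 *; lra.
have -> : e = e / 2 / a ^+ 2 * a ^+ 2 + e / 2.
  by rewrite divfK ?gt_eqF ?exprn_gt0//; field.
apply: lerD; first by apply: ler_pM => //; exact: hr1.
apply: (@le_trans _ _ (F * (e / 2 / (8 * a * F + 1) * (8 * a)))).
  apply: ler_pM => //; apply: le_trans b2 _; rewrite ler_wpM2r ?(ltW xx3)//.
  by apply: mulr_ge0 => //; exact: ltW.
have -> : F * (e / 2 / (8 * a * F + 1) * (8 * a)) = e / 2 * (8 * a * F) / (8 * a * F + 1).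
  by rewrite mulrCA [F * _]mulrC mulrAC.
by rewrite ler_pdivrMr// ler_wpM2l ?divr_ge0 ?(ltW e00)// lerDl.
Qed.

Lemma fker_y del e : 0 <= del <= 2^-1 -> 0 < e -> exists2 r, 0 < r &
  forall x y y', enorm (y - y') < r -> `|f x * simker del x y - f x * simker del x y'| <= e.
Proof.
move=> /[dup] dd /andP[d0 d2] e00.
pose a := 2 * (M + 1).
have a0 : 0 < a by rewrite /a; have := M1; lra.
have q0 : 0 < 8 * a * F + 1.
  by rewrite ltr_wpDl//; apply: mulr_ge0 => //; apply: mulr_ge0 => //; exact: ltW.
exists (Num.min 1 (e / (8 * a * F + 1))).
  by rewrite !lt_min ltr01/= !divr_gt0.
move=> x y y'; rewrite !lt_min => /andP[xx1 xx3].
have n1 := ler_enorm_dist y y'.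
have n2 : enorm y' - enorm y <= enorm (y - y').
  by rewrite enormB; exact: ler_enorm_dist.
have [hM|hM] := leP (enorm x) M; last first.
  by rewrite !fM// !mul0r subrr normr0 ltW.
have [hy|hy] := boolP ((enorm y <= a) && (enorm y' <= a)); last first.
  have [h1 h2] : 2 * M < enorm y /\ 2 * M < enorm y'.
    by move: hy; rewrite /a negb_and -!ltNge => /orP[]; lra.
  have k0 z : 2 * M < enorm z -> simker del x z = 0.
    move=> h; apply/eqP; apply: contraLR h => /(simker_supp d2) h3.
    by rewrite -leNgt (le_trans h3)// ler_wpM2l.
  by rewrite !k0// !mulr0 subrr normr0 ltW.
move: hy => /andP[h1 h2].
rewrite -mulrBr normrM.
have b2 : `|simker del x y - simker del x y'| <= enorm (y - y') * (8 * a).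
  rewrite !(simkerC _ x); apply: le_trans (simker_lip _ _ _ _) _.
    by apply/andP; split; lra.
  rewrite ler_wpM2l ?enorm_ge0//; have := M1; rewrite /a in h1 h2 a0 *; lra.
apply: (@le_trans _ _ (F * (e / (8 * a * F + 1) * (8 * a)))).
  apply: ler_pM => //; apply: le_trans b2 _; rewrite ler_wpM2r ?(ltW xx3)//.
  by apply: mulr_ge0 => //; exact: ltW.
have -> : F * (e / (8 * a * F + 1) * (8 * a)) = e * (8 * a * F) / (8 * a * F + 1).
  by rewrite mulrCA [F * _]mulrC mulrAC.
by rewrite ler_pdivrMr// ler_wpM2l ?(ltW e00)// lerDl.
Qed.

Let fX_tame k : tame (fun x => f x * enorm x ^+ k).
Proof.
apply: (tame_compact (M := M)) => [|x xM]; last by rewrite fM// mul0r.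
by apply: contM => //; apply: contX; exact: enorm_continuous.
Qed.

(** Apply L1 in x and L2 in y to f(x) k(x,y).  Integrating first over y gives
    the first term, by [simker_mean].  Integrating first over x nearly gives the
    second one, because f(x) is close to f(y) on the support of k. *)
Lemma compare_estimate eta : 0 < eta -> exists2 del0, 0 < del0 &
  forall del, 0 < del <= 2^-1 -> del <= del0 ->
  `|L2 (simker del e0) * L1 (fun x => f x * enorm x ^+ p2.+2) -
    L1 (simker del e0) * L2 (fun y => f y * enorm y ^+ p1.+2)| <=
  eta * L1 (simker del e0) * L2 (fun y => enorm y ^+ p1.+2 * cutoff (2 * M) y).
Proof.
move=> eta0; have M0 : 0 < M by have := M1; lra.
have [r r0 hr] := unif_cont_compact cf fM eta0.
(* on the support of the kernel |x - y|^2 < del |x| |y| <= del (2M)^2 <= r^2 *)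
exists (r ^+ 2 / (4 * M ^+ 2)); first by rewrite divr_gt0 ?mulr_gt0 ?exprn_gt0.
move=> del /andP[d0 d2] dr.
have dd : 0 <= del <= 2^-1 by rewrite ltW.
pose k x y := f x * simker del x y.
have kMx x y : 2 * M < enorm x -> k x y = 0.
  by move=> h; rewrite /k fM ?mul0r//; lra.
have kMy x y : 2 * M < enorm y -> k x y = 0.
  move=> h; rewrite /k; have [xM|xM] := leP (enorm x) M; last by rewrite fM ?mul0r.
  have -> : simker del x y = 0; last by rewrite mulr0.
  apply/eqP; apply: contraLR h => /(simker_supp d2) h3.
  by rewrite -leNgt (le_trans h3)// ler_wpM2l.
have kx := fker_x dd; have ky := fker_y dd.
have swap := posfun_swap pL1 pL2 kx ky kMx kMy.
set c1 := L1 (simker del e0); set c2 := L2 (simker del e0).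
have c10 : 0 <= c1 by apply: pL1.2; [exact: simker_tame|exact: simker_ge0].
have -> : c2 * L1 (fun x => f x * enorm x ^+ p2.+2) = L1 (fun x => L2 (k x)).
  rewrite -posfunZ//; congr L1; apply/funext => x.
  rewrite /k posfunZ//; last exact: simker_tame.
  by rewrite (simker_mean pL2 e01 L2_orth L2_scale x dd) mulrCA.
rewrite swap -posfunZ//.
have kx' : forall e, 0 < e -> exists2 del, 0 < del &
    forall y x x' , enorm (x - x') < del -> `|k x y - k x' y| <= e.
  by move=> e /kx[s s0 h]; exists s => // *; exact: h.
have ky' : forall e, 0 < e -> exists2 del, 0 < del &
    forall y y' x, enorm (y - y') < del -> `|k x y - k x y'| <= e.
  by move=> e /ky[s s0 h]; exists s => // *; exact: h.
have tA2 := kernel_mean_tame (k := fun y x => k x y) pL1 ky' kx'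
  (fun y x => kMy x y) (fun y x => kMx x y).
have tk2 y : tame (fun x => k x y).
  exact: (kernel_tame (k := fun y x => k x y) kx' (fun y x => kMx x y)).
have tX : tame (fun y : 'rV[R]_n => enorm y ^+ p1.+2 * cutoff (2 * M) y).
  apply: (tame_compact (M := 2 * M + 1)) => [|y yM]; last by rewrite cutoff_out// mulr0.
  by apply: contM; [apply: contX; exact: enorm_continuous|exact: cutoff_cont].
rewrite -posfunB//; last exact: tameZ.
rewrite -posfunZ//; apply: posfun_norm => //.
- by apply: tameB => //; exact: tameZ.
- exact: tameZ.
move=> y; have [yM|yM] := leP (enorm y) (2 * M); last first.
  rewrite (_ : (fun x => k x y) = fun=> 0); last by apply/funext => x; exact: kMy.
  rewrite posfun0// fM; last by lra.
  rewrite mul0r mulr0 subrr normr0; apply: mulr_ge0.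
    by apply: mulr_ge0 => //; exact: ltW.
  by apply: mulr_ge0; [rewrite exprn_ge0 ?enorm_ge0|exact: cutoff_ge0].
rewrite cutoff1// mulr1.
have c1y : c1 * enorm y ^+ p1.+2 = L1 (simker del y).
  by rewrite (simker_mean pL1 e01 L1_orth L1_scale y dd).
have ty := simker_tame y dd.
have -> : c1 * (f y * enorm y ^+ p1.+2) = L1 (fun x => f y * simker del y x).
  by rewrite posfunZ// -c1y mulrCA.
rewrite -posfunB//; [|exact: tk2|exact: (tameZ _ ty)].
rewrite -mulrA c1y -posfunZ//; apply: (posfun_norm pL1).
- by apply: tameB; [exact: tk2|exact: (tameZ _ ty)].
- exact: (tameZ _ ty).
move=> x; rewrite /k (simkerC del x) -mulrBl normrM [`|simker _ _ _|]ger0_norm ?simker_ge0//.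
have [->|kxy] := eqVneq (simker del y x) 0; first by rewrite !mulr0.
have [xM|xM] := leP (enorm x) (2 * M); last first.
  have h := simker_supp d2 kxy.
  by rewrite !fM ?subrr ?normr0 ?mul0r ?mulr_ge0 ?simker_ge0//; [exact: ltW|lra|lra].
rewrite ler_wpM2r ?simker_ge0//; apply: hr.
have := simker_neq0 kxy; rewrite enormB => h.
rewrite -(@ltr_pXn2r _ 2) ?nnegrE ?enorm_ge0 ?(ltW r0)//.
apply: lt_le_trans h _; rewrite ler_pdivlMr ?mulr_gt0 ?exprn_gt0// in dr.
apply: le_trans dr; rewrite ler_wpM2l ?(ltW d0)//.
have -> : 4 * M ^+ 2 = (2 * M) * (2 * M) by ring.
by rewrite ler_pM ?enorm_ge0.
Qed.

End Fix_f.

(** Let the width of the kernel tend to 0 in [compare_estimate] for f and for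
    g, and eliminate the unknown ratio L2(k)/L1(k) between the two. *)
Lemma compare_functionals (f g : 'rV[R]_n -> R) M :
  continuous f -> (forall x, M < enorm x -> f x = 0) ->
  continuous g -> (forall x, M < enorm x -> g x = 0) ->
  0 < L1 (fun x => g x * enorm x ^+ p2.+2) ->
  (forall del, 0 < del <= 2^-1 -> 0 < L2 (simker del e0)) ->
  L2 (fun y => f y * enorm y ^+ p1.+2) * L1 (fun x => g x * enorm x ^+ p2.+2) =
  L2 (fun y => g y * enorm y ^+ p1.+2) * L1 (fun x => f x * enorm x ^+ p2.+2).
Proof.
move=> cf fM cg gM Ig0 L2k0; pose N := Num.max M 1.
have N1 : 1 <= N by rewrite le_max lexx orbT.
have MN : M <= N by rewrite le_max lexx.
have fN x : N < enorm x -> f x = 0 by move=> h; apply: fM; exact: le_lt_trans h.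
have gN x : N < enorm x -> g x = 0 by move=> h; apply: gM; exact: le_lt_trans h.
set A := L2 (fun y => enorm y ^+ p1.+2 * cutoff (2 * N) y).
set a := L2 (fun y => f y * _); set a' := L2 (fun y => g y * _).
set b := L1 (fun x => f x * _); set b' := L1 (fun x => g x * _) in Ig0 *.
apply: (@small_eq _ _ _ (`|A| * (`|b| + b'))) => eta eta0.
have [d1 d10 h1] := compare_estimate cf fN N1 eta0.
have [d2 d20 h2] := compare_estimate cg gN N1 eta0.
pose del := Num.min 2^-1 (Num.min d1 d2).
have d0 : 0 < del <= 2^-1.
  by rewrite ge_min lexx andbT !lt_min d10 d20 invr_gt0 ltr0n.
have e1 : del <= d1 by rewrite !ge_min lexx /= orbT.
have e2 : del <= d2 by rewrite !ge_min lexx !orbT.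
have {h1} := h1 del d0 e1; have {h2} := h2 del d0 e2.
have := L2k0 _ d0; rewrite -/A -/a -/a' -/b -/b'.
have d0' : 0 <= del <= 2^-1 by move: d0 => /andP[/ltW -> ->].
have : 0 <= L1 (simker del e0).
  by apply: pL1.2; [exact: simker_tame|exact: simker_ge0].
move: (L1 _) (L2 _) => c1 c2 c10 c20 h2 h1.
have c1p : 0 < c1.
  rewrite lt_def c10 andbT; apply/eqP => c1E.
  by move: h2; rewrite c1E !mul0r mulr0 mul0r subr0 normr_le0 mulf_eq0 !gt_eqF.
have -> : a * b' - a' * b = (c1 * a * b' - c1 * a' * b) / c1.
  by field; rewrite gt_eqF.
rewrite normrM normfV (gtr0_norm c1p) ler_pdivrMr//.
have -> : c1 * a * b' - c1 * a' * b = (c2 * b' - c1 * a') * b - (c2 * b - c1 * a) * b' by ring.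
apply: le_trans (ler_normB _ _) _; rewrite !normrM (gtr0_norm Ig0).
have hA : eta * c1 * A <= eta * c1 * `|A|.
  by rewrite ler_wpM2l ?ler_norm// mulr_ge0// ltW.
have := lerD (ler_pM (normr_ge0 _) (normr_ge0 b) (le_trans h2 hA) (lexx `|b|))
             (ler_pM (normr_ge0 _) (ltW Ig0) (le_trans h1 hA) (lexx b')).
move=> h; apply: le_trans h _.
by rewrite le_eqVlt; apply/orP; left; apply/eqP; ring.
Qed.

End Uniqueness.

(** * The normal operator as a Riesz potential *)

Lemma contV (R : realType) (T : topologicalType) (f : T -> R) :
  continuous f -> (forall t, f t != 0) -> continuous (fun t => (f t)^-1).
Proof. by move=> cf f0 t; exact: (cvgV (f0 t) (cf t)). Qed.

Section Riesz.
Variables (R : realType) (n d : nat).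
Hypotheses (d0 : (0 < d)%N) (dn : (d < n)%N).
Implicit Types (x y : 'rV[R]_n) (f : 'rV[R]_n -> R).

(** One power of 1 + |x|^2 better than [tame], so that cutting off at a large
    radius is a small perturbation in the tame sense. *)
Definition fast f := continuous f /\
  exists C, forall x, `|f x| <= C * ((1 + enorm x ^+ 2)^-1 * weight x).

Definition vanish_ball r f := forall x, enorm x < r -> f x = 0.

Lemma fast_tame f : fast f -> tame f.
Proof.
move=> [cf [C fC]]; apply: (@tame_bound _ _ _ `|C|) => // x.
apply: le_trans (fC x) _.
have h : 0 <= (1 + enorm x ^+ 2)^-1 * weight x.
  by rewrite mulr_ge0 ?weight_ge0// invr_ge0 ltW// add1sqr_gt0.
apply: (@le_trans _ _ (`|C| * ((1 + enorm x ^+ 2)^-1 * weight x))).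
  by rewrite ler_wpM2r// ler_norm.
rewrite ler_wpM2l// ler_piMl ?weight_ge0// invf_le1 ?add1sqr_gt0//.
by rewrite lerDl sqr_ge0.
Qed.

(** The power |x|^-k, truncated near the origin to be continuous and bounded. *)
Definition invpow r k x : R := ((Num.max r (enorm x))^-1) ^+ k.

Lemma invpow_cont r k : 0 < r -> continuous (invpow r k).
Proof.
move=> r0; apply: contX; apply: contV; last first.
  by move=> x; rewrite gt_eqF// lt_max r0.
by apply: cont_max; [exact: contC|exact: enorm_continuous].
Qed.

Lemma invpow_bound r k x : 0 < r -> `|invpow r k x| <= r^-1 ^+ k.
Proof.
move=> r0; have m0 : 0 < Num.max r (enorm x) by rewrite lt_max r0.
rewrite ger0_norm ?exprn_ge0 ?invr_ge0 ?(ltW m0)//.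
rewrite lerXn2r ?nnegrE ?invr_ge0 ?(ltW m0) ?(ltW r0)//.
by rewrite lef_pV2 ?posrE// le_max lexx.
Qed.

Lemma invpowE r k f x : vanish_ball r f ->
  f x * invpow r k x = f x * (enorm x)^-1 ^+ k.
Proof.
move=> fr; have [xr|xr] := ltP (enorm x) r; first by rewrite fr// !mul0r.
by rewrite /invpow max_r.
Qed.

Lemma tame_riesz r k f : 0 < r -> tame f -> vanish_ball r f ->
  tame (fun x => f x * (enorm x)^-1 ^+ k).
Proof.
move=> r0 tf fr; have := tame_mulr tf (@invpow_cont _ k r0) (fun x => invpow_bound k x r0).
by congr tame; apply/funext => x; rewrite invpowE.
Qed.

Variable mu : probability (borel_matrix R n) R.
Hypothesis rmu : rotation_invariant d mu.
Local Notation I := (planes_mean d mu).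

(** Compare I and the integral on functions supported in a ball, after
    multiplication by a power of |x| that exists because f vanishes near 0; then
    let the radius of the ball grow. *)
Lemma planes_mean_riesz : exists2 c, 0 < c & forall f r, 0 < r -> fast f ->
  vanish_ball r f -> I f = c * space_int (fun y => f y * (enorm y)^-1 ^+ (n - d)).
Proof.
have n0 : (0 < n)%N := leq_ltn_trans (leq0n d) dn.
pose e0 : 'rV[R]_n := delta_mx 0 (Ordinal n0).
have e01 : enorm e0 = 1 := delta_enorm _ _.
have pI := planes_mean_posfun dn rmu.
have pL := @space_int_posfun R n.
have kernel_pos del : 0 < del <= 2^-1 -> 0 < space_int (simker del e0).
  move=> /andP[dl0 dl]; apply: (@space_int_gt0 _ _ _ e0 n0).
  - by apply: simker_tame; rewrite (ltW dl0).
  - exact: simker_ge0.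
  rewrite /simker e01 subrr enorm0 expr0n subr0 !mulr1 lt_max.
  by rewrite dl0 orbT.
pose g : 'rV[R]_n -> R := cutoff 1.
have cg : continuous g := @cutoff_cont R n 1.
have gM x : 2 < enorm x -> g x = 0 by move=> h; apply: cutoff_out.
have tg k : tame (fun x => g x * enorm x ^+ k).
  apply: (tame_compact (M := 2)) => [|x xM]; last by rewrite gM// mul0r.
  by apply: contM => //; apply: contX; exact: enorm_continuous.
have b0 : 0 < I (fun x => g x * enorm x ^+ n.+2).
  pose phi (t : R) := Num.max 0 (Num.min 1 (1 + 1 - t)) * t ^+ n.+2.
  apply: (planes_mean_radial_gt0 d0 dn rmu (phi := phi) (r := 1)) => //.
    by move=> x; rewrite mulr_ge0 ?cutoff_ge0 ?exprn_ge0 ?enorm_ge0.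
  by rewrite /phi expr1n mulr1 addrK minxx lt_max ltr01 orbT.
have a0 : 0 < space_int (fun x => g x * enorm x ^+ d.+2).
  apply: (@space_int_gt0 _ _ _ e0 n0) => //.
    by move=> x; rewrite mulr_ge0 ?cutoff_ge0 ?exprn_ge0 ?enorm_ge0.
  by rewrite e01 expr1n mulr1 /g cutoff1 ?e01.
set b := I _ in b0; set a := space_int _ in a0.
have cmp f M : continuous f -> (forall x, M < enorm x -> f x = 0) ->
    space_int (fun y => f y * enorm y ^+ d.+2) * b = a * I (fun x => f x * enorm x ^+ n.+2).
  move=> cf fM; pose N := Num.max M 2.
  have H1 h U : tame h -> U *m U^T = 1%:M -> I (fun y => h (y *m U)) = I h.
    by move=> th UU; apply: planes_mean_orth.
  have H2 h t : tame h -> 0 < t -> I (fun y => h (t *: y)) = t ^- d * I h.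
    by move=> th t0; apply: planes_mean_scale.
  have H3 (h : 'rV[R]_n -> R) U : tame h -> U *m U^T = 1%:M ->
      space_int (fun y => h (y *m U)) = space_int h by move=> th UU; apply: space_int_orth.
  have H4 (h : 'rV[R]_n -> R) t : tame h -> 0 < t ->
      space_int (fun y => h (t *: y)) = t ^- n * space_int h by move=> th t0; apply: space_int_scale.
  have fN x : N < enorm x -> f x = 0 by rewrite gt_max => /andP[/fM].
  have gN x : N < enorm x -> g x = 0 by rewrite gt_max => /andP[_ /gM].
  exact: (compare_functionals pI pL e01 H1 H2 H3 H4 cf fN cg gN b0 kernel_pos).
exists (b / a) => [|f r r0 ff fr]; first by rewrite divr_gt0.
(* f' is chosen so that f' |x|^(n+2) = h and f' |x|^(d+2) = h |x|^-(n-d) *)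
have cptE h M : continuous h -> (forall x, M < enorm x -> h x = 0) -> vanish_ball r h ->
    I h = b / a * space_int (fun y => h y * (enorm y)^-1 ^+ (n - d)).
  move=> ch hM hr; pose f' x := h x * invpow r n.+2 x.
  have := cmp f' M.
  have -> : (fun x => f' x * enorm x ^+ n.+2) = h.
    apply/funext => x; rewrite /f'; have [xr|xr] := ltP (enorm x) r.
      by rewrite hr// !mul0r.
    rewrite /invpow max_r// -mulrA exprVn mulVf ?mulr1//.
    by rewrite expf_neq0// gt_eqF// (lt_le_trans r0).
  have -> : (fun x => f' x * enorm x ^+ d.+2) =
      (fun y => h y * (enorm y)^-1 ^+ (n - d)).
    apply/funext => x; rewrite /f'; have [xr|xr] := ltP (enorm x) r.
      by rewrite hr// !mul0r.
    rewrite /invpow max_r// -mulrA; congr (_ * _).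
    have -> : n.+2 = ((n - d) + d.+2)%N by rewrite addnS addnS subnK// ltnW.
    rewrite exprD -mulrA [_ ^-1 ^+ d.+2]exprVn mulVf ?mulr1//.
    by rewrite expf_neq0// gt_eqF// (lt_le_trans r0).
  move=> h1; rewrite mulrAC [b * _]mulrC h1; first by rewrite mulrAC divff ?mul1r// gt_eqF.
    by apply: contM => //; exact: invpow_cont.
  by move=> x xM; rewrite /f' hM// mul0r.
have [cf [C fC]] := ff.
have tf := fast_tame ff.
have tfr := tame_riesz (n - d) r0 tf fr.
have W1 := posfun_weight_ge0 pI; have W2 := posfun_weight_ge0 pL.
set w1 := I _ in W1; set w2 := space_int _ in W2.
apply: (@small_eq _ _ _ (`|C| * w1 + b / a * (`|C| * r^-1 ^+ (n - d) * w2))) => e e00.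
(* beyond radius 1/e the extra decay of f is below e *)
pose M := e^-1; have M0 : 0 < M by rewrite invr_gt0.
have Me : (1 + M ^+ 2)^-1 <= e.
  rewrite -[leRHS]invrK lef_pV2 ?posrE ?add1sqr_gt0// -/M.
  have := sqr_ge0 (M - 1); rewrite sqrrB expr1n mulr1; lra.
pose h x := f x * cutoff M x.
have ch : continuous h by apply: contM => //; exact: cutoff_cont.
have hM x : M + 1 < enorm x -> h x = 0 by move=> xM; rewrite /h cutoff_out// mulr0.
have hr : vanish_ball r h by move=> x xr; rewrite /h fr// mul0r.
have th : tame h := tame_compact ch hM.
have thr := tame_riesz (n - d) r0 th hr.
have fh x : `|f x - h x| <= e * (`|C| * weight x).
  have [xM|xM] := leP (enorm x) M.
    by rewrite /h cutoff1// mulr1 subrr normr0 !mulr_ge0 ?weight_ge0// ltW.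
  rewrite /h -{1}[f x]mulr1 -mulrBr normrM.
  apply: (@le_trans _ _ (`|f x| * 1)).
    rewrite ler_wpM2l// ger0_norm ?subr_ge0 ?cutoff_le1// lerBlDr lerDl.
    exact: cutoff_ge0.
  rewrite mulr1; apply: le_trans (fC x) _; rewrite [leRHS]mulrCA.
  have h1 : 0 <= (1 + enorm x ^+ 2)^-1 * weight x.
    by rewrite mulr_ge0 ?weight_ge0// invr_ge0 ltW// add1sqr_gt0.
  apply: le_trans (ler_wpM2r h1 (ler_norm C)) _; rewrite ler_wpM2l//.
  rewrite ler_wpM2r ?weight_ge0//; apply: le_trans Me.
  rewrite lef_pV2 ?posrE ?add1sqr_gt0// lerD2l lerXn2r ?nnegrE ?enorm_ge0 ?ltW//.
have e1 : `|I f - I h| <= e * `|C| * w1.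
  rewrite -posfunB//; apply: posfun_weight => //; first exact: tameB.
  by move=> x; rewrite -mulrA.
have e2 : `|space_int (fun y => f y * (enorm y)^-1 ^+ (n - d)) -
            space_int (fun y => h y * (enorm y)^-1 ^+ (n - d))| <=
    e * `|C| * r^-1 ^+ (n - d) * w2.
  rewrite -(posfunB pL)//; apply: (posfun_weight pL); first exact: tameB.
  move=> x; rewrite -(invpowE _ _ fr) -(invpowE _ _ hr) -mulrBl normrM.
  have := ler_pM (normr_ge0 _) (normr_ge0 _) (fh x) (invpow_bound (n - d) x r0).
  by move=> h2; apply: le_trans h2 _; rewrite le_eqVlt; apply/orP; left; apply/eqP; ring.
have E := cptE h _ ch hM hr.
have -> : I f - b / a * space_int (fun y => f y * (enorm y)^-1 ^+ (n - d)) =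
  (I f - I h) - b / a * (space_int (fun y => f y * (enorm y)^-1 ^+ (n - d)) -
            space_int (fun y => h y * (enorm y)^-1 ^+ (n - d))).
  by rewrite E; ring.
apply: le_trans (ler_normB _ _) _; rewrite normrM.
have ba : 0 <= b / a := ltW (divr_gt0 b0 a0).
rewrite (ger0_norm ba) mulrDr; apply: lerD; first by rewrite mulrA.
apply: le_trans (ler_wpM2l ba e2) _.
by rewrite le_eqVlt; apply/orP; left; apply/eqP; ring.
Qed.

End Riesz.

(** * Differentiation under a functional on continuous functions *)

Section CompactFunctional.
Variables (R : realType) (n : nat).
Implicit Types (Z : set 'rV[R]_n) (g h : 'rV[R]_n -> R).

Definition cont_on Z h := forall z, Z z -> {for z, continuous h}.

(** Continuous linear functionals on the space of continuous functions on Z,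
    which are given as functions on the whole space. *)
Definition cfun Z (L : ('rV[R]_n -> R) -> R) :=
  (forall a g h, cont_on Z g -> cont_on Z h -> L (fun z => a * g z + h z) = a * L g + L h) /\
  exists2 C, 0 <= C &
    forall h m, cont_on Z h -> (forall z, Z z -> `|h z| <= m) -> `|L h| <= C * m.

Lemma cont_onC Z a : cont_on Z (fun=> a).
Proof. by move=> z _; exact: contC. Qed.

Lemma cont_onD Z g h : cont_on Z g -> cont_on Z h -> cont_on Z (fun z => g z + h z).
Proof. by move=> cg ch z zZ; exact: (cvgD (cg z zZ) (ch z zZ)). Qed.

Lemma cont_onM Z g h : cont_on Z g -> cont_on Z h -> cont_on Z (fun z => g z * h z).
Proof. by move=> cg ch z zZ; exact: (cvgM (cg z zZ) (ch z zZ)). Qed.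

Lemma cont_onZ Z a h : cont_on Z h -> cont_on Z (fun z => a * h z).
Proof. by move=> ch; apply: cont_onM => //; exact: cont_onC. Qed.

Lemma cont_on_cont Z h : continuous h -> cont_on Z h.
Proof. by move=> ch z _; exact: ch. Qed.

Lemma cont_on_sum Z (T : Type) (s : seq T) (G : T -> 'rV[R]_n -> R) :
  (forall t, cont_on Z (G t)) -> cont_on Z (fun z => \sum_(t <- s) G t z).
Proof.
move=> cG; elim: s => [|t s IH].
  by under eq_fun do rewrite big_nil; exact: cont_onC.
by under eq_fun do rewrite big_cons; exact: cont_onD.
Qed.

Section Cfun.
Variables (Z : set 'rV[R]_n) (L : ('rV[R]_n -> R) -> R).
Hypothesis cL : cfun Z L.

Lemma cfun0 : L (fun=> 0) = 0.
Proof.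
have := cL.1 (-1) _ _ (@cont_onC Z 0) (@cont_onC Z 0).
rewrite (_ : (fun z => -1 * 0 + 0) = (fun=> 0)); last first.
  by apply/funext => z; rewrite mulr0 addr0.
by move=> h; lra.
Qed.

Lemma cfunZ a h : cont_on Z h -> L (fun z => a * h z) = a * L h.
Proof.
move=> ch; have := cL.1 a _ _ ch (@cont_onC Z 0).
by rewrite cfun0 addr0 => <-; congr L; apply/funext => z; rewrite addr0.
Qed.

Lemma cfunD g h : cont_on Z g -> cont_on Z h -> L (fun z => g z + h z) = L g + L h.
Proof.
move=> cg ch; have := cL.1 1 _ _ cg ch.
by rewrite mul1r => <-; congr L; apply/funext => z; rewrite mul1r.
Qed.

Lemma cfun_sum (T : Type) (s : seq T) (G : T -> 'rV[R]_n -> R) :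
  (forall t, cont_on Z (G t)) ->
  L (fun z => \sum_(t <- s) G t z) = \sum_(t <- s) L (G t).
Proof.
move=> cG; elim: s => [|t s IH].
  have -> : (fun z : 'rV[R]_n => \sum_(t <- [::]) G t z) = fun=> 0.
    by apply/funext => z; rewrite big_nil.
  by rewrite cfun0 big_nil.
rewrite big_cons -IH -cfunD//; last exact: cont_on_sum.
by congr L; apply/funext => z; rewrite big_cons.
Qed.

Lemma cfun_ext g h : cont_on Z g -> cont_on Z h -> (forall z, Z z -> g z = h z) -> L g = L h.
Proof.
move=> cg ch gh; have [C C0 hC] := cL.2.
have c : cont_on Z (fun z => -1 * h z + g z) by apply: cont_onD => //; exact: cont_onZ.
have := hC _ 0 c.
rewrite cL.1// mulr0 mulN1r => h1; apply/eqP; rewrite -subr_eq0 addrC -normr_le0.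
by apply: h1 => z zZ; rewrite gh// mulN1r addNr normr0.
Qed.

Lemma mvt_bound (phi dphi : R -> R) (t : R) :
  (forall s : R, `|s| <= `|t| -> is_derive s 1 phi (dphi s)) ->
  exists2 s, `|s| <= `|t| & phi t - phi 0 = dphi s * t.
Proof.
move=> h.
have cphi s : `|s| <= `|t| -> {for s, continuous phi}.
  by move=> /h [hd _]; apply/differentiable_continuous/derivable1_diffP.
have [t0|t0] := leP 0 t.
  have [s sI e] : exists2 s, s \in `[0, t] & phi t - phi 0 = dphi s * (t - 0).
    apply: MVT_segment => //.
      move=> x; rewrite in_itv /= => /andP[x0 xt]; apply: h.
      by rewrite !ger0_norm// ltW.
    apply: continuous_in_subspaceT => x /set_mem; rewrite /= in_itv /= => /andP[x0 xt].
    by apply: cphi; rewrite !ger0_norm.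
  exists s; last by rewrite e subr0.
  by move: sI; rewrite in_itv/= => /andP[s0 st]; rewrite !ger0_norm.
have [s sI e] : exists2 s, s \in `[t, 0] & phi 0 - phi t = dphi s * (0 - t).
  apply: MVT_segment; first exact: ltW.
    move=> x; rewrite in_itv /= => /andP[x0 xt]; apply: h.
    by rewrite !ltr0_norm// lerN2 ltW.
  apply: continuous_in_subspaceT => x /set_mem; rewrite /= in_itv /= => /andP[x0 xt].
  by apply: cphi; rewrite (ler0_norm xt) (ltr0_norm t0) lerN2.
exists s; last by rewrite -opprB e sub0r mulrN opprK.
by move: sI; rewrite in_itv/= => /andP[s0 st]; rewrite ler0_norm// (ltr0_norm t0) lerN2.
Qed.

(** The mean value theorem in t bounds the difference quotient minus the
    derivative uniformly on Z. *)
Lemma cfun_derive (k dk : R -> 'rV[R]_n -> R) r : 0 < r ->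
  (forall (t : R) z, `|t| < r -> Z z -> is_derive t 1 (fun t : R => k t z) (dk t z)) ->
  (forall t, `|t| < r -> cont_on Z (k t)) -> cont_on Z (dk 0) ->
  (forall e, 0 < e -> exists2 del, 0 < del &
     forall t z, `|t| < del -> Z z -> `|dk t z - dk 0 z| <= e) ->
  forall e, 0 < e -> exists2 del, 0 < del &
     forall t, `|t| < del -> `|L (k t) - L (k 0) - t * L (dk 0)| <= e * `|t|.
Proof.
move=> r0 kd ck cdk uk e e0; have [C C0 hC] := cL.2.
have e1 : 0 < e / (C + 1) by rewrite divr_gt0// ltr_wpDl.
have [d1 d10 hd] := uk _ e1.
exists (Num.min r d1); first by rewrite lt_min r0.
move=> t; rewrite lt_min => /andP[tr td].
have c0 : cont_on Z (k 0) by apply: ck; rewrite normr0.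
have ct := ck t tr.
have cB : cont_on Z (fun z => -1 * k 0 z + k t z) by apply: cont_onD => //; exact: cont_onZ.
have cE : cont_on Z (fun z => (- t) * dk 0 z + (-1 * k 0 z + k t z)).
  by apply: cont_onD => //; exact: cont_onZ.
have -> : L (k t) - L (k 0) - t * L (dk 0) =
  L (fun z => (- t) * dk 0 z + (-1 * k 0 z + k t z)).
  by rewrite cL.1// cL.1//; ring.
apply: (@le_trans _ _ (C * (e / (C + 1) * `|t|))).
  apply: hC => // z zZ.
  have [s st E] := @mvt_bound (fun t => k t z) (fun t => dk t z) t
    (fun s st => kd s z (le_lt_trans st tr) zZ).
  have -> : - t * dk 0 z + (-1 * k 0 z + k t z) = (dk s z - dk 0 z) * t.
    by rewrite mulrBl -E; ring.
  by rewrite normrM ler_wpM2r//; apply: hd => //; exact: le_lt_trans td.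
rewrite mulrA ler_wpM2r// mulrCA ler_piMr ?(ltW e0)//.
by rewrite ler_pdivrMr ?ltr_wpDl// mul1r lerDl.
Qed.

Lemma cfun_derive0 (k dk : R -> 'rV[R]_n -> R) r : 0 < r ->
  (forall (t : R) z, `|t| < r -> Z z -> is_derive t 1 (fun t : R => k t z) (dk t z)) ->
  (forall t, `|t| < r -> cont_on Z (k t)) -> cont_on Z (dk 0) ->
  (forall e, 0 < e -> exists2 del, 0 < del &
     forall t z, `|t| < del -> Z z -> `|dk t z - dk 0 z| <= e) ->
  (forall t, `|t| < r -> L (k t) = 0) -> L (dk 0) = 0.
Proof.
move=> r0 kd ck cdk uk Lk0; apply: (@small_eq _ _ _ 1) => e e0.
have [del del0 h] := cfun_derive r0 kd ck cdk uk e0.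
pose t := Num.min r del / 2.
have t0 : 0 < t by rewrite divr_gt0// lt_min r0.
have tm : t < Num.min r del by rewrite /t ltr_pdivrMr// ltr_pMr ?lt_min ?r0// ltr1n.
have [tr td] : t < r /\ t < del by move: tm; rewrite lt_min => /andP[].
have := h t; rewrite (gtr0_norm t0) => /(_ td).
rewrite !Lk0 ?normr0 ?(gtr0_norm t0)// subr0 sub0r normrN normrM (gtr0_norm t0).
by rewrite mulrC ler_pM2r// subr0 mulr1.
Qed.

End Cfun.

Lemma joint_uniform Z (k : R -> 'rV[R]_n -> R) e : compact Z ->
  (forall z, Z z -> {for (0 : R, z), continuous (fun p : R * 'rV[R]_n => k p.1 p.2)}) ->
  0 < e -> exists2 del, 0 < del & forall t z, `|t| < del -> Z z -> `|k t z - k 0 z| <= e.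
Proof.
move=> /compact_near_coveringP cZ ck e0.
have : \forall t \near (0 : R), Z `<=` (fun z => `|k t z - k 0 z| <= e).
  apply: (cZ _ (nbhs (0 : R)) (fun t z => `|k t z - k 0 z| <= e)) => z zZ.
  have e2 : 0 < e / 2 by rewrite divr_gt0.
  have P := @cvgrPdist_lt R R _ (nbhs (0 : R, z)) (nbhs_filter _)
    (fun p : R * 'rV[R]_n => k p.1 p.2) (k 0 z).
  have /P /(_ _ e2) [[A B] /= [A0 Bz] AB] := ck z zZ.
  exists (B, A) => // -[z' t] /= [Bz' At].
  have h1 := AB (t, z') (conj At Bz').
  have h2 := AB (0, z') (conj (nbhs_singleton A0) Bz').
  rewrite /= in h1 h2; rewrite -(subrK (k 0 z) (k t z')) -addrA.
  apply: le_trans (ler_normD _ _) _; rewrite distrC; lra.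
move=> /nbhs_ballP[del /= d0 h]; exists del => // t z td.
by apply: h; rewrite -ball_normE /= sub0r normrN.
Qed.

End CompactFunctional.

(** * Inversion, and vanishing of moments *)

Section PointContinuity.
Variables (R : realType) (T : topologicalType).
Implicit Types (f g : T -> R).

Lemma catC (a : R) (t : T) : {for t, continuous (fun _ : T => a)}.
Proof. exact: cst_continuous. Qed.

Lemma catD f g (t : T) : {for t, continuous f} -> {for t, continuous g} ->
  {for t, continuous (fun t => f t + g t)}.
Proof. by move=> cf cg; exact: (cvgD cf cg). Qed.

Lemma catN f (t : T) : {for t, continuous f} -> {for t, continuous (fun t => - f t)}.
Proof. by move=> cf; exact: (cvgN cf). Qed.

Lemma catM f g (t : T) : {for t, continuous f} -> {for t, continuous g} ->
  {for t, continuous (fun t => f t * g t)}.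
Proof. by move=> cf cg; exact: (cvgM cf cg). Qed.

Lemma cat_comp f (u : R -> R) (t : T) : {for t, continuous f} ->
  {for f t, continuous u} -> {for t, continuous (fun t => u (f t))}.
Proof. by move=> cf cu; exact: (@continuous_comp _ _ _ f u). Qed.

Lemma powR_continuous (a x : R) : 0 < x -> {for x, continuous (fun t : R => t `^ a)}.
Proof.
move=> x0; have [h _] := is_derive1_powR a x0.
by apply/differentiable_continuous/derivable1_diffP.
Qed.

End PointContinuity.

Section Inversion.
Variables (R : realType) (n : nat).
Implicit Types (x y z : 'rV[R]_n).

(** Extended by inversion 0 = 0. *)
Definition inversion y : 'rV[R]_n := (enorm y ^+ 2)^-1 *: y.

Lemma enorm_inversion y : enorm (inversion y) = (enorm y)^-1.
Proof.
rewrite /inversion enormZ ger0_norm ?invr_ge0 ?sqr_ge0//.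
have [->|y0] := eqVneq (enorm y) 0; first by rewrite mulr0 invr0.
by rewrite expr2 invfM -mulrA mulVf// mulr1.
Qed.

Lemma inversionK y : y != 0 -> inversion (inversion y) = y.
Proof.
rewrite -enorm_eq0 => y0; rewrite {1}/inversion enorm_inversion /inversion.
by rewrite scalerA exprVn invrK divff ?scale1r// expf_neq0.
Qed.

Lemma inversion_dist x y : x != 0 -> y != 0 ->
  enorm (inversion x - inversion y) = enorm (x - y) / (enorm x * enorm y).
Proof.
rewrite -!enorm_eq0 => x0 y0.
apply/eqP; rewrite -(@eqrXn2 _ 2) ?enorm_ge0 ?divr_ge0 ?mulr_ge0 ?enorm_ge0//.
rewrite expr_div_n exprMn !sqr_enorm /inversion !dotDl !dotDr !dotNl !dotNr !dotZl !dotZr.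
rewrite (dotC y x) -!sqr_enorm; apply/eqP; field.
by rewrite x0 y0.
Qed.

Lemma inversion_continuous y : y != 0 -> {for y, continuous inversion}.
Proof.
move=> y0 A /nbhs_enormP[e e0 hA]; apply/nbhs_enormP.
have y0' : 0 < enorm y by rewrite enorm_gt0.
pose d := Num.min (enorm y / 2) (e * enorm y ^+ 2 / 2).
exists d => [|y']; first by rewrite lt_min !divr_gt0// mulr_gt0// exprn_gt0.
rewrite lt_min => /andP[h1 h2]; apply: hA.
have h3 := ler_enorm_dist y y'.
have h4 : enorm y / 2 < enorm y' by lra.
have y'0 : y' != 0 by rewrite -enorm_gt0; apply: lt_trans h4; rewrite divr_gt0.
rewrite inversion_dist// ltr_pdivrMr; last by rewrite mulr_gt0// enorm_gt0.
apply: lt_le_trans h2 _.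
have -> : e * enorm y ^+ 2 / 2 = e * (enorm y * (enorm y / 2)) by rewrite expr2; ring.
by rewrite !ler_pM2l// ltW.
Qed.

Lemma cont_on_bounded (Z : set 'rV[R]_n) (h : 'rV[R]_n -> R) : compact Z -> cont_on Z h ->
  exists2 m, 0 <= m & forall z, Z z -> `|h z| <= m.
Proof.
move=> cZ ch.
have cfn : {within Z, continuous h}.
  by apply: continuous_in_subspaceT => z /set_mem; exact: ch.
have /compact_bounded[D [_ hD]] := continuous_compact cfn cZ.
exists (`|D| + 1) => [|z zZ]; first by rewrite addr_ge0.
by apply: (hD (`|D| + 1)); [rewrite (le_lt_trans (ler_norm _))// ltrDl|exists z].
Qed.

Variables (F : 'rV[R]_n -> R) (rho : R).
Hypotheses (rho0 : 0 < rho) (tF : tame F) (Frho : vanish_ball rho F).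
Local Notation Z := (@eball R n 0 rho^-1).

Let inZ y : rho <= enorm y -> Z (inversion y).
Proof.
move=> h; rewrite /eball /= subr0 enorm_inversion lef_pV2 ?posrE//.
exact: lt_le_trans h.
Qed.

(** In the variable z = inversion y the integral against F lives on the ball of
    radius 1/rho, because F vanishes on the ball of radius rho. *)
Definition inv_fun (h : 'rV[R]_n -> R) : R := space_int (fun y => F y * h (inversion y)).

Lemma inv_fun_tame h : cont_on Z h -> tame (fun y => F y * h (inversion y)).
Proof.
move=> ch; have [m m0 hm] := cont_on_bounded (@compact_eball R n 0 rho^-1) ch.
have [cF [C hC]] := tF.
apply: (@tame_bound _ _ _ (`|C| * m)); last first.
  move=> y; have [yr|yr] := ltP (enorm y) rho.
    by rewrite Frho// mul0r normr0 !mulr_ge0 ?weight_ge0.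
  rewrite normrM mulrAC ler_pM// ?hm//; last exact: inZ.
  by apply: le_trans (hC y) _; rewrite ler_wpM2r ?weight_ge0// ler_norm.
move=> y; have [yr|yr] := ltP (enorm y) rho.
  apply/continuous_enormP => e e0; exists (rho - enorm y); first by rewrite subr_gt0.
  move=> y' yy'; rewrite (Frho yr) Frho ?mul0r ?subrr ?normr0//.
  by have := ler_enorm_dist y' y; rewrite (enormB y'); lra.
have y0 : y != 0 by rewrite -enorm_gt0 (lt_le_trans rho0).
apply: (catM (cF y)).
exact: (continuous_comp (inversion_continuous y0) (ch _ (inZ yr))).
Qed.

Let tnF : tame (fun y => `|F y|).
Proof.
have [cF [C hC]] := tF; apply: (@tame_bound _ _ _ C) => [y|y]; last by rewrite normr_id.
by apply: cat_comp; [exact: cF|exact: norm_continuous].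
Qed.

Lemma inv_fun_cfun : cfun Z inv_fun.
Proof.
split=> [a g h cg ch|].
  rewrite /inv_fun -space_int_lin; [|exact: inv_fun_tame|exact: inv_fun_tame].
  by congr space_int; apply/funext => y; ring.
exists (space_int (fun y => `|F y|)) => [|h m ch hm]; first exact: space_int_ge0.
have m0 : 0 <= m.
  apply: le_trans (normr_ge0 (h 0)) _; apply: hm.
  by rewrite /eball /= subr0 enorm0 invr_ge0 ltW.
rewrite /inv_fun mulrC -(posfunZ (@space_int_posfun R n))//.
apply: (posfun_norm (@space_int_posfun R n)); [exact: inv_fun_tame|exact: tameZ|].
move=> y; have [yr|yr] := ltP (enorm y) rho.
  by rewrite Frho// mul0r normr0 mulr0.
rewrite normrM mulrC ler_wpM2r// hm//; exact: inZ.
Qed.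

(** Chosen so that |y - x|^2 = |y|^2 invD x (inversion y). *)
Definition invD x z : R := 1 - 2 * dot x z + dot x x * dot z z.
Definition invDpow (b : R) x z : R := invD x z `^ (- b).

(** For |x| |z| <= 1/2 one has invD x z >= (1 - |x| |z|)^2. *)
Lemma invD_gt0 x z : enorm x < rho / 2 -> Z z -> 0 < invD x z.
Proof.
rewrite /eball /= subr0 => hx hz.
have h : enorm x * enorm z <= 2^-1.
  apply: (@le_trans _ _ (rho / 2 * rho^-1)).
    by rewrite ler_pM ?enorm_ge0// ltW.
  by rewrite mulrAC divff ?gt_eqF// mul1r.
have h2 := dot_le x z.
have h3 : 0 < (1 - enorm x * enorm z) ^+ 2 by rewrite exprn_gt0//; lra.
rewrite /invD -!sqr_enorm -exprMn; apply: lt_le_trans h3 _.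
rewrite sqrrB expr1n mul1r; lra.
Qed.

Lemma invDpow_S b x z : 0 < invD x z -> invD x z * invDpow (b + 1) x z = invDpow b x z.
Proof.
move=> D0; rewrite /invDpow opprD -{1}[invD x z]powRr1 ?(ltW D0)// -powRD.
  by congr powR; ring.
by apply/implyP => _; rewrite gt_eqF.
Qed.

Lemma invD_shift x z i t : invD (x + t *: delta_mx 0 i) z =
  1 - 2 * (dot x z + t * z 0 i) + (dot x x + 2 * t * x 0 i + t ^+ 2) * dot z z.
Proof.
rewrite /invD !dotDl !dotDr !dotZl !dotZr !(dotC (delta_mx 0 i)) !dot_delta !mxE !eqxx/=.
ring.
Qed.

Lemma is_derive_powR_comp (phi : R -> R) (dphi a t : R) :
  is_derive t 1 phi dphi -> 0 < phi t ->
  is_derive t 1 (fun t => phi t `^ a) (a * phi t `^ (a - 1) * dphi).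
Proof.
move=> hphi phi0; have h := is_derive1_powR a phi0.
have := @is_derive1_comp R (fun u : R => u `^ a) phi t _ _ h hphi.
by rewrite mulrC.
Qed.

Lemma invDpow_derive b x z i (t : R) : 0 < invD (x + t *: delta_mx 0 i) z ->
  is_derive t 1 (fun t : R => invDpow b (x + t *: delta_mx 0 i) z)
    (2 * b * (z 0 i - (x 0 i + t) * dot z z) * invDpow (b + 1) (x + t *: delta_mx 0 i) z).
Proof.
move=> D0; rewrite /invDpow.
pose phi (t : R) := 1 - 2 * (dot x z + t * z 0 i) +
  (dot x x + 2 * t * x 0 i + t ^+ 2) * dot z z.
have phiE : (fun t : R => invD (x + t *: delta_mx 0 i) z) = phi.
  by apply/funext => s; rewrite invD_shift.
have hphi : is_derive t 1 phi (- 2 * (z 0 i - (x 0 i + t) * dot z z)).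
  by apply: is_derive_eq; rewrite /GRing.scale /=; ring.
have -> : (fun t : R => invD (x + t *: delta_mx 0 i) z `^ (- b)) = (fun t => phi t `^ (- b)).
  by apply/funext => s; rewrite invD_shift.
rewrite invD_shift in D0; have := is_derive_powR_comp (- b) hphi D0.
move/is_derive_eq; apply; rewrite invD_shift -/(phi t) (opprD b); ring.
Qed.

End Inversion.

Section Moments.
Variables (R : realType) (n : nat) (F : 'rV[R]_n -> R) (rho : R).
Hypotheses (rho0 : 0 < rho) (tF : tame F) (Frho : vanish_ball rho F).
Implicit Types (x y z : 'rV[R]_n) (q : 'rV[R]_n -> R).
Local Notation Z := (@eball R n 0 rho^-1).
Local Notation L := (inv_fun F).

Let cL : cfun Z L := inv_fun_cfun rho0 tF Frho.

Lemma invDpow_joint b x i z (t : R) : 0 < invD (x + t *: delta_mx 0 i) z ->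
  {for (t, z), continuous (fun p : R * 'rV[R]_n => invDpow b (x + p.1 *: delta_mx 0 i) p.2)}.
Proof.
move=> D0; apply: (@cat_comp _ _ (fun p : R * 'rV[R]_n => invD (x + p.1 *: delta_mx 0 i) p.2)
  (fun u => u `^ (- b))); last exact: powR_continuous.
have -> : (fun p : R * 'rV[R]_n => invD (x + p.1 *: delta_mx 0 i) p.2) =
  (fun p : R * 'rV[R]_n => 1 - 2 * (dot x p.2 + p.1 * p.2 0 i) +
     (dot x x + 2 * p.1 * x 0 i + p.1 ^+ 2) * dot p.2 p.2).
  by apply/funext => -[u v] /=; rewrite invD_shift.
have c1 : {for (t, z), continuous (fun p : R * 'rV[R]_n => p.1)} by exact: cvg_fst.
have c2 (f : 'rV[R]_n -> R) : continuous f ->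
    {for (t, z), continuous (fun p : R * 'rV[R]_n => f p.2)}.
  move=> cf; apply: (@continuous_comp _ _ _ (fun p : R * 'rV[R]_n => p.2) f).
    exact: cvg_snd.
  exact: cf.
apply: catD.
  apply: catD; first exact: catC.
  apply: catN; apply: catM; first exact: catC.
  apply: catD; first by apply: (c2 (dot x)); exact: dot_continuous.
  by apply: catM => //; apply: (c2 (fun z => z 0 i)); exact: cont_coord.
apply: catM; last first.
  apply: (c2 (fun z => dot z z)).
  by under eq_fun do rewrite -sqr_enorm; apply: contX; exact: enorm_continuous.
apply: catD; last by apply: (@catM _ _ (fun p : R * 'rV[R]_n => p.1) (fun p : R * 'rV[R]_n => p.1)).
apply: catD; first exact: catC.
by apply: catM; [apply: catM => //; exact: catC|exact: catC].
Qed.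

Lemma invDpow_cont_on b x : enorm x < rho / 2 -> cont_on Z (invDpow b x).
Proof.
move=> xr z zZ; apply: (@cat_comp _ _ (invD x) (fun u => u `^ (- b))).
  apply: contD.
    apply: contD; first exact: contC.
    by apply: contN; apply: contM; [exact: contC|exact: dot_continuous].
  apply: contM; first exact: contC.
  by under eq_fun do rewrite -sqr_enorm; apply: contX; exact: enorm_continuous.
by apply: powR_continuous; apply: invD_gt0 xr zZ.
Qed.

Lemma dotzz_cont : continuous (fun z : 'rV[R]_n => dot z z).
Proof. by under eq_fun do rewrite -sqr_enorm; apply: contX; exact: enorm_continuous. Qed.

Lemma enorm_shift_delta x i (t : R) : enorm (x + t *: delta_mx 0 i) <= enorm x + `|t|.
Proof. by apply: le_trans (ler_enormD _ _) _; rewrite enormZ delta_enorm mulr1. Qed.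

(** Differentiation at t = 0 of the functional applied to
    (p + t s) K_b(x + t e_i), where K_b = invD^-b. *)
Lemma kernel_derive b (p s : 'rV[R]_n -> R) i x : continuous p -> continuous s -> enorm x < rho / 2 ->
  (forall t, enorm (x + t *: delta_mx 0 i) < rho / 2 ->
    L (fun z => (p z + t * s z) * invDpow b (x + t *: delta_mx 0 i) z) = 0) ->
  L (fun z => s z * invDpow b x z +
              p z * (2 * b * (z 0 i - x 0 i * dot z z) * invDpow (b + 1) x z)) = 0.
Proof.
move=> cp cs xr h; pose r := rho / 2 - enorm x.
have r0 : 0 < r by rewrite subr_gt0.
have near (t : R) : `|t| < r -> enorm (x + t *: delta_mx 0 i) < rho / 2.
  by move=> tr; apply: le_lt_trans (enorm_shift_delta _ _ _) _; rewrite addrC -ltrBrDr.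
pose k (t : R) z := (p z + t * s z) * invDpow b (x + t *: delta_mx 0 i) z.
pose dk (t : R) z := s z * invDpow b (x + t *: delta_mx 0 i) z +
  (p z + t * s z) * (2 * b * (z 0 i - (x 0 i + t) * dot z z) * invDpow (b + 1) (x + t *: delta_mx 0 i) z).
have -> : (fun z => s z * invDpow b x z +
    p z * (2 * b * (z 0 i - x 0 i * dot z z) * invDpow (b + 1) x z)) = dk 0.
  by apply/funext => z; rewrite /dk scale0r addr0 mul0r !addr0.
have x0 : x + 0 *: delta_mx 0 i = x by rewrite scale0r addr0.
apply: (cfun_derive0 cL (k := k) (dk := dk) r0).
- move=> t z tr zZ; have D0 := invD_gt0 rho0 (near t tr) zZ.
  have hK := invDpow_derive b D0.
  have hA : is_derive t 1 (fun t : R => p z + t * s z) (s z).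
    by apply: is_derive_eq; rewrite /GRing.scale /=; ring.
  have := is_deriveM hA hK; move/is_derive_eq; apply.
  by rewrite /dk /GRing.scale /=; ring.
- move=> t tr; apply: cont_onM; last exact: invDpow_cont_on (near t tr).
  by apply: cont_on_cont; apply: contD => //; exact: contZ.
- rewrite /dk x0; under eq_fun do rewrite mul0r addr0.
  apply: cont_onD.
    by apply: cont_onM; [exact: cont_on_cont|exact: invDpow_cont_on].
  apply: cont_onM; first exact: cont_on_cont.
  apply: cont_onM; last exact: invDpow_cont_on.
  apply: cont_on_cont; apply: contZ; apply: contD; first exact: cont_coord.
  by apply: contN; apply: contZ; exact: dotzz_cont.
- move=> e e0; apply: joint_uniform => //; first exact: compact_eball.
  move=> z zZ; have D0 : 0 < invD (x + 0 *: delta_mx 0 i) z.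
    by rewrite x0; exact: invD_gt0 xr zZ.
  have c1 : {for ((0 : R), z), continuous (fun p : R * 'rV[R]_n => p.1)} by exact: cvg_fst.
  have c2 (f : 'rV[R]_n -> R) : continuous f ->
      {for ((0 : R), z), continuous (fun p : R * 'rV[R]_n => f p.2)}.
    move=> cf; apply: (@continuous_comp _ _ _ (fun p : R * 'rV[R]_n => p.2) f).
      exact: cvg_snd.
    exact: cf.
  apply: catD; first by apply: catM; [exact: (c2 s)|exact: invDpow_joint].
  apply: catM; first by apply: catD; [exact: (c2 p)|apply: catM => //; exact: (c2 s)].
  apply: catM; last exact: invDpow_joint.
  apply: catM; first exact: catC.
  apply: catD; first by apply: (c2 (fun z => z 0 i)); exact: cont_coord.
  apply: catN; apply: catM; last by apply: (c2 (fun z => dot z z)); exact: dotzz_cont.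
  by apply: catD => //; exact: catC.
- by move=> t tr; exact: h (near t tr).
Qed.

Definition annihilates q b := forall x, enorm x < rho / 2 -> L (fun z => q z * invDpow b x z) = 0.

(** The derivative of K_b in direction e_i is
    2b (z_i - x_i |z|^2) K_(b+1). *)
Lemma annihilates_step1 q b i x : b != 0 -> continuous q -> annihilates q b ->
  enorm x < rho / 2 ->
  L (fun z => q z * (z 0 i - x 0 i * dot z z) * invDpow (b + 1) x z) = 0.
Proof.
move=> b0 cq hq xr.
have h0 := @kernel_derive b q (fun=> 0) i x cq (@contC _ _ 0) xr.
have h : L (fun z => 0 * invDpow b x z +
    q z * (2 * b * (z 0 i - x 0 i * dot z z) * invDpow (b + 1) x z)) = 0.
  apply: h0 => t tr; rewrite -[RHS](hq _ tr); congr inv_fun; apply/funext => z.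
  by rewrite mulr0 addr0.
have e : (fun z => 0 * invDpow b x z +
    q z * (2 * b * (z 0 i - x 0 i * dot z z) * invDpow (b + 1) x z)) =
  (fun z => 2 * b * (q z * (z 0 i - x 0 i * dot z z) * invDpow (b + 1) x z)).
  by apply/funext => z; ring.
rewrite e in h; rewrite (cfunZ cL) in h; last first.
  apply: cont_onM; last exact: invDpow_cont_on.
  apply: cont_on_cont; apply: contM => //; apply: contD; first exact: cont_coord.
  by apply: contN; apply: contZ; exact: dotzz_cont.
by move/eqP: h; rewrite !mulf_eq0 (negbTE b0) pnatr_eq0 /= => /eqP.
Qed.

(** The Laplacian in x of K_b is 2b (2(b+1) - n) |z|^2 K_(b+1), because
    |z - |z|^2 x|^2 = |z|^2 invD x z.  The second derivatives are taken one by
    one under the functional and then added. *)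
Lemma annihilates_laplace q b : b != 0 -> 2 * (b + 1) != n%:R -> continuous q ->
  annihilates q b -> annihilates (fun z => q z * dot z z) (b + 1).
Proof.
move=> b0 bn cq hq x xr.
have cw i : continuous (fun z : 'rV[R]_n => z 0 i - x 0 i * dot z z).
  by apply: contD; [exact: cont_coord|apply: contN; apply: contZ; exact: dotzz_cont].
have cqz : continuous (fun z => q z * dot z z) by apply: contM => //; exact: dotzz_cont.
have h i : L (fun z => - (q z * dot z z) * invDpow (b + 1) x z +
    q z * (z 0 i - x 0 i * dot z z) *
    (2 * (b + 1) * (z 0 i - x 0 i * dot z z) * invDpow (b + 1 + 1) x z)) = 0.
  apply: (@kernel_derive (b + 1) (fun z => q z * (z 0 i - x 0 i * dot z z))
     (fun z => - (q z * dot z z)) i x) => //.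
  - by apply: contM.
  - by apply: contN.
  move=> t tr; rewrite -[RHS](annihilates_step1 i b0 cq hq tr).
  congr inv_fun; apply/funext => z; congr (_ * _).
  by rewrite !mxE !eqxx /=; ring.
have cK c : cont_on Z (invDpow c x) by exact: invDpow_cont_on.
have co i : cont_on Z (fun z => - (q z * dot z z) * invDpow (b + 1) x z +
    q z * (z 0 i - x 0 i * dot z z) *
    (2 * (b + 1) * (z 0 i - x 0 i * dot z z) * invDpow (b + 1 + 1) x z)).
  apply: cont_onD; first by apply: cont_onM => //; apply: cont_on_cont; exact: contN.
  apply: cont_onM; first by apply: cont_on_cont; exact: contM.
  by apply: cont_onM => //; apply: cont_on_cont; exact: contZ.
have := cfun_sum cL (index_enum 'I_n) co.
rewrite [in RHS]big1 => [hs|i _]; last exact: h.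
have cz : cont_on Z (fun z => q z * dot z z * invDpow (b + 1) x z).
  by apply: cont_onM => //; exact: cont_on_cont.
have E : L (fun z => (2 * (b + 1) - n%:R) * (q z * dot z z * invDpow (b + 1) x z)) = 0.
  rewrite -hs; apply: (cfun_ext cL); first exact: cont_onZ.
    exact: cont_on_sum.
  move=> z zZ; rewrite big_split/= sumr_const card_ord.
  have -> : \sum_(i < n) q z * (z 0 i - x 0 i * dot z z) *
      (2 * (b + 1) * (z 0 i - x 0 i * dot z z) * invDpow (b + 1 + 1) x z) =
    q z * (2 * (b + 1)) * (dot (z - dot z z *: x) (z - dot z z *: x) * invDpow (b + 1 + 1) x z).
    rewrite {3}/dot mulr_suml mulr_sumr; apply: eq_bigr => i _.
    by rewrite !mxE; ring.
  have -> : dot (z - dot z z *: x) (z - dot z z *: x) = dot z z * invD x z.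
    rewrite /invD !dotDl !dotDr !dotNl !dotNr !dotZl !dotZr (dotC z x); ring.
  rewrite -[_ * invDpow (b + 1 + 1) x z]mulrA invDpow_S; last exact: invD_gt0 xr zZ.
  by rewrite -mulr_natl; ring.
rewrite (cfunZ cL) in E => //.
by move/eqP: E; rewrite mulf_eq0 subr_eq0 (negbTE bn) => /eqP.
Qed.

(** Add to the first derivative a multiple of the function in the second
    hypothesis. *)
Lemma annihilates_coord q b i : b != 0 -> continuous q -> annihilates q b ->
  annihilates (fun z => q z * dot z z) (b + 1) -> annihilates (fun z => q z * z 0 i) (b + 1).
Proof.
move=> b0 cq h1 h2 x xr.
have := annihilates_step1 i b0 cq h1 xr; have := h2 x xr.
have cK c : cont_on Z (invDpow c x) by exact: invDpow_cont_on.
have cqz : continuous (fun z => q z * dot z z) by apply: contM => //; exact: dotzz_cont.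
have c2 : cont_on Z (fun z => q z * dot z z * invDpow (b + 1) x z).
  by apply: cont_onM => //; exact: cont_on_cont.
have c1 : cont_on Z (fun z => q z * (z 0 i - x 0 i * dot z z) * invDpow (b + 1) x z).
  apply: cont_onM => //; apply: cont_on_cont; apply: contM => //.
  by apply: contD; [exact: cont_coord|apply: contN; apply: contZ; exact: dotzz_cont].
move=> e2 e1; have := cL.1 (x 0 i) _ _ c2 c1; rewrite e1 e2 mulr0 addr0 => <-.
by congr inv_fun; apply/funext => z; ring.
Qed.

(** The redundant power of |z|^2 keeps track of the applications of the
    Laplacian. *)
Definition monom (s : seq 'I_n) k z : R := \prod_(i <- s) z 0 i * dot z z ^+ k.

Lemma monom_cont s k : continuous (monom s k).
Proof.
apply: contM; last by apply: contX; exact: dotzz_cont.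
elim: s => [|i s IH]; first by under eq_fun do rewrite big_nil; exact: contC.
by under eq_fun do rewrite big_cons; apply: contM => //; exact: cont_coord.
Qed.

(** Apply the Laplacian k + |s| times to 1, and lower it to coordinates |s|
    times; the exponents met on the way are a + j, none of which is exceptional. *)
Lemma annihilates_monom a s k : (forall k : nat, a + k%:R != 0) ->
  (forall k : nat, 2 * (a + k%:R) + 2 != n%:R) ->
  annihilates (fun=> 1) a -> annihilates (monom s k) (a + k%:R + (size s)%:R).
Proof.
move=> a0 an h1.
have hr k' : annihilates (monom [::] k') (a + k'%:R).
  elim: k' => [|k' IH].
    rewrite addr0 => x xr; rewrite -[RHS](h1 x xr); congr inv_fun; apply/funext => z.
    by rewrite /monom big_nil expr0 mulr1.
  have := annihilates_laplace (a0 k') _ (@monom_cont _ _) IH.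
  rewrite mulrDr mulr1 => /(_ (an k')); rewrite -natr1 addrA => h x xr.
  rewrite -[RHS](h x xr); congr inv_fun; apply/funext => z.
  by rewrite /monom exprSr mulrA.
elim: s k => [|i s IH] k /=; first by rewrite addr0.
have e : a + k%:R + (size s)%:R != 0 by rewrite -addrA -natrD.
have h2 : annihilates (fun z => monom s k z * dot z z) (a + k%:R + (size s)%:R + 1).
  have := IH k.+1; rewrite -natr1 !addrA => h x xr.
  have -> : a + k%:R + (size s)%:R + 1 = a + k%:R + 1 + (size s)%:R by ring.
  rewrite -[RHS](h x xr); congr inv_fun; apply/funext => z.
  by rewrite /monom exprSr !mulrA.
have h := annihilates_coord i e (@monom_cont _ _) (IH k) h2.
move=> x xr; rewrite -natr1 addrA -[RHS](h x xr); congr inv_fun; apply/funext => z.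
by rewrite /monom big_cons; ring.
Qed.

(** At x = 0 the kernel is 1. *)
Lemma moments_vanish a s k : (forall k : nat, a + k%:R != 0) ->
  (forall k : nat, 2 * (a + k%:R) + 2 != n%:R) ->
  annihilates (fun=> 1) a -> L (monom s k) = 0.
Proof.
move=> a0 an h1; have x0 : enorm (0 : 'rV[R]_n) < rho / 2 by rewrite enorm0 divr_gt0.
rewrite -[RHS](annihilates_monom s k a0 an h1 x0); congr inv_fun; apply/funext => z.
by rewrite /invDpow /invD !dot0l mulr0 mul0r subr0 addr0 powR1 mulr1.
Qed.

Lemma quadratic_power_vanish (A C : R) (B : 'I_n -> R) N s k :
  (forall s k, L (monom s k) = 0) ->
  L (fun z => monom s k z * (A + \sum_(i < n) B i * z 0 i + C * dot z z) ^+ N) = 0.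
Proof.
move=> hm; set l := fun z : 'rV[R]_n => A + \sum_(i < n) B i * z 0 i + C * dot z z.
have cl : continuous l.
  apply: contD; last by apply: contZ; exact: dotzz_cont.
  by apply: contD; [exact: contC|apply: cont_sum => i; apply: contZ; exact: cont_coord].
have cml s' k' N' : cont_on Z (fun z => monom s' k' z * l z ^+ N').
  by apply: cont_on_cont; apply: contM; [exact: monom_cont|exact: contX].
elim: N s k => [|N IH] s k.
  by rewrite -[RHS](hm s k); congr inv_fun; apply/funext => z; rewrite expr0 mulr1.
have c1 : cont_on Z (fun z => A * (monom s k z * l z ^+ N)) by exact: cont_onZ.
have c2 i : cont_on Z (fun z => B i * (monom (i :: s) k z * l z ^+ N)) by exact: cont_onZ.
have c3 : cont_on Z (fun z => C * (monom s k.+1 z * l z ^+ N)) by exact: cont_onZ.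
have -> : (fun z => monom s k z * l z ^+ N.+1) =
  (fun z => A * (monom s k z * l z ^+ N) +
     (\sum_(i < n) B i * (monom (i :: s) k z * l z ^+ N) + C * (monom s k.+1 z * l z ^+ N))).
  apply/funext => z; rewrite exprS.
  have -> : \sum_(i < n) B i * (monom (i :: s) k z * l z ^+ N) =
      (\sum_(i < n) B i * z 0 i) * (monom s k z * l z ^+ N).
    by rewrite mulr_suml; apply: eq_bigr => i _; rewrite /monom big_cons; ring.
  by rewrite {1}/l /monom exprS; ring.
rewrite (cfunD cL) //; last by apply: cont_onD => //; exact: cont_on_sum.
rewrite (cfunD cL) //; last exact: cont_on_sum.
rewrite (cfun_sum cL)// !(cfunZ cL)// !IH !mulr0 add0r addr0 big1// => i _.
by rewrite (cfunZ cL)// IH mulr0.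
Qed.

Lemma bernoulli_ineq (u : R) N : 0 <= u -> 1 + N%:R * u <= (1 + u) ^+ N.
Proof.
move=> u0; elim: N => [|N IH]; first by rewrite mul0r addr0 expr0.
rewrite exprS; apply: (@le_trans _ _ ((1 + u) * (1 + N%:R * u))).
  rewrite -natr1; have : 0 <= u * (N%:R * u) by rewrite !mulr_ge0.
  by move: (N%:R) => a; nra.
by rewrite ler_wpM2l// addr_ge0.
Qed.

(** If F y0 > 0, put z0 = inversion y0.  The polynomial
    l(z) = 1 - |z - z0|^2 / (4 r^2) is nonnegative on the ball of radius r that
    carries the functional, at least r1 near z0 and at most r2' < r1 away from
    z0.  Since the functional kills every l^N, the contribution of order r1^N
    of the points near y0 would be bounded by a multiple of r2'^N. *)
Lemma moments_nonpos : (0 < n)%N -> (forall s k, L (monom s k) = 0) -> forall y, F y <= 0.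
Proof.
move=> n0 hm y0; rewrite leNgt; apply/negP => Fy0.
have yr : rho <= enorm y0.
  by rewrite leNgt; apply/negP => h; move: Fy0; rewrite Frho// ltxx.
have yn0 : y0 != 0 by rewrite -enorm_gt0 (lt_le_trans rho0).
pose r := rho^-1; have r0 : 0 < r by rewrite invr_gt0.
pose z0 := inversion y0.
have z0n : z0 != 0 by rewrite -enorm_gt0 enorm_inversion invr_gt0 enorm_gt0.
have z0r : enorm z0 <= r by rewrite enorm_inversion lef_pV2 ?posrE// enorm_gt0.
have F2 : 0 < F y0 / 2 by rewrite divr_gt0.
have cFi : {for z0, continuous (fun z => F (inversion z))}.
  apply: (@continuous_comp _ _ _ (@inversion R n) F); first exact: inversion_continuous.
  exact: tF.1.
have /continuous_enormP/(_ _ F2) [del0 del00 hdel0] := cFi.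
pose del := Num.min del0 r; have del_0 : 0 < del by rewrite lt_min del00.
have delr : del <= r by rewrite ge_min lexx orbT.
have hF y : y != 0 -> enorm (z0 - inversion y) < del -> F y0 / 2 < F y.
  move=> yn; rewrite lt_min => /andP[h _].
  have := hdel0 _ h; rewrite !inversionK// ltr_norml => /andP[_ ?]; lra.
have del2 : 0 < del / 2 by rewrite divr_gt0.
have [eta eta0 heta] : exists2 eta, 0 < eta & forall y, enorm (y0 - y) < eta ->
    y != 0 /\ enorm (z0 - inversion y) < del / 2.
  have : nbhs z0 [set z | enorm (z0 - z) < del / 2] by apply/nbhs_enormP; exists (del / 2).
  move=> /(inversion_continuous yn0)/nbhs_enormP[e e0 he].
  exists (Num.min e (enorm y0)) => [|y]; first by rewrite lt_min e0 enorm_gt0.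
  rewrite lt_min => /andP[/he h1 h2]; split=> //.
  by apply/eqP => y00; move: h2; rewrite y00 subr0 ltxx.
(* a bump around y0 on whose support l (inversion y) >= r1 and F y > F y0 / 2 *)
pose b y := Num.max 0 (1 - enorm (y - y0) / eta).
have b0 y : 0 <= b y by rewrite le_max lexx.
have b1 y : b y <= 1.
  by rewrite ge_max ler01/= gerBl divr_ge0 ?enorm_ge0// ltW.
have b_neq0 y : b y != 0 -> enorm (y0 - y) < eta.
  apply: contraNT; rewrite -leNgt => h; apply/eqP; rewrite /b max_l//.
  by rewrite subr_le0 ler_pdivlMr// mul1r enormB.
have tb : tame b.
  apply: (tame_compact (M := enorm y0 + eta)); last first.
    move=> y h; apply/eqP; apply: contraLR h => /b_neq0 h; rewrite -leNgt.
    by have := ler_enorm_dist y y0; rewrite enormB; lra.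
  apply: cont_max; first exact: contC.
  apply: contD; first exact: contC.
  apply: contN; under eq_fun do rewrite mulrC; apply: contZ => y.
  apply/continuous_enormP => e e0; exists e => // z yz.
  apply: le_lt_trans (ler_dist_enorm _ _) _.
  by rewrite opprB addrA subrK.
have lb : 0 < space_int b.
  by apply: (@space_int_gt0 _ _ _ y0) => //; rewrite /b subrr enorm0 mul0r subr0 lt_max ltr01 orbT.
pose l z := 1 - dot (z - z0) (z - z0) / (4 * r ^+ 2).
have r2 : 0 < 4 * r ^+ 2 by rewrite mulr_gt0// exprn_gt0.
have lle z : enorm z <= r -> 0 <= l z.
  move=> zr; rewrite subr_ge0 ler_pdivrMr// mul1r -sqr_enorm.
  have -> : 4 * r ^+ 2 = (r + r) ^+ 2 by ring.
  rewrite lerXn2r ?nnegrE ?enorm_ge0 ?addr_ge0 ?(ltW r0)//.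
  by apply: le_trans (ler_enormB _ _) (lerD zr z0r).
pose r1 := 1 - (del / 2) ^+ 2 / (4 * r ^+ 2).
pose r2' := 1 - del ^+ 2 / (4 * r ^+ 2).
have dr : del ^+ 2 <= r ^+ 2 by rewrite lerXn2r ?nnegrE// ltW.
have r2p : 0 < r2'.
  by rewrite subr_gt0 ltr_pdivrMr// mul1r; have := exprn_gt0 2 r0; lra.
have r12 : r2' < r1.
  rewrite ltrD2l ltrN2 ltr_pM2r ?invr_gt0//.
  by rewrite ltrXn2r ?nnegrE// ?(ltW del2) ?(ltW del_0)//; lra.
have l_near z : enorm (z0 - z) < del / 2 -> r1 <= l z.
  move=> h; rewrite lerD2l lerN2 ler_pM2r ?invr_gt0// -sqr_enorm enormB.
  by rewrite lerXn2r ?nnegrE ?enorm_ge0 ?(ltW h) ?(ltW del2).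
have l_far z : del <= enorm (z0 - z) -> l z <= r2'.
  move=> h; rewrite lerD2l lerN2 ler_pM2r ?invr_gt0// -sqr_enorm enormB.
  by rewrite lerXn2r ?nnegrE ?enorm_ge0 ?(ltW del_0).
have tnF : tame (fun y => `|F y|).
  have [cF [C hC]] := tF; apply: (@tame_bound _ _ _ C) => [y|y]; last by rewrite normr_id.
  by apply: cat_comp; [exact: cF|exact: norm_continuous].
have key N : F y0 / 2 * r1 ^+ N * space_int b <= r2' ^+ N * space_int (fun y => `|F y|).
  rewrite -subr_le0.
  have cl : continuous (fun z => l z ^+ N).
    apply: contX; apply: contD; first exact: contC.
    apply: contN; under eq_fun do rewrite mulrC; apply: contZ.
    under eq_fun do rewrite -sqr_enorm; apply: contX => y.
    apply/continuous_enormP => e e0; exists e => // z yz.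
    by apply: le_lt_trans (ler_dist_enorm _ _) _; rewrite opprB addrA subrK.
  have L0 : L (fun z => l z ^+ N) = 0.
    (* the coefficients of l as a polynomial in z *)
    pose A := 1 - dot z0 z0 / (4 * r ^+ 2).
    pose B i := 2 * z0 0 i / (4 * r ^+ 2).
    pose C := - (4 * r ^+ 2)^-1.
    rewrite -[RHS](@quadratic_power_vanish A C B N [::] 0 hm).
    congr inv_fun; apply/funext => z; rewrite /monom big_nil expr0 !mul1r; congr (_ ^+ _).
    have -> : \sum_(i < n) B i * z 0 i = 2 * dot z z0 / (4 * r ^+ 2).
      rewrite /dot mulr_sumr mulr_suml; apply: eq_bigr => i _; rewrite /B; ring.
    rewrite /l /A /C dotDl !dotDr !dotNl !dotNr (dotC z0 z); ring.
  rewrite -L0 /inv_fun -(posfunZ (@space_int_posfun R n))// -(posfunZ (@space_int_posfun R n))//.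
  have t1 := tameZ (F y0 / 2 * r1 ^+ N) tb; have t2 := tameZ (r2' ^+ N) tnF.
  rewrite -(posfunB (@space_int_posfun R n))//.
  apply: (posfun_le (@space_int_posfun R n)); first exact: tameB.
    exact: (inv_fun_tame rho0 tF Frho (@cont_on_cont _ _ _ _ cl)).
  move=> y; rewrite lerBlDr.
  have r1N : 0 <= r1 ^+ N by rewrite exprn_ge0// (le_trans (ltW r2p))// ltW.
  have R0 : 0 <= r2' ^+ N * `|F y| by rewrite mulr_ge0// exprn_ge0// ltW.
  have [yrho|yrho] := ltP (enorm y) rho.
    have -> : b y = 0.
      apply/eqP; apply: contraT => /b_neq0/heta[yn h].
      have := hF y yn (lt_trans h _); rewrite (Frho yrho) => h3.
      suff : F y0 / 2 < 0 by move=> h4; have := lt_trans F2 h4; rewrite ltxx.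
      by apply: h3; rewrite ltr_pdivrMr// ltr_pMr// ltr1n.
    by rewrite mulr0 addr_ge0// Frho// mul0r.
  have zr : enorm (inversion y) <= r.
    by rewrite enorm_inversion lef_pV2 ?posrE// (lt_le_trans rho0).
  have yn : y != 0 by rewrite -enorm_gt0 (lt_le_trans rho0).
  have lN : 0 <= l (inversion y) ^+ N by rewrite exprn_ge0// lle.
  have [hd|hd] := ltP (enorm (z0 - inversion y)) del; last first.
    have -> : b y = 0.
      apply/eqP; apply: contraT => /b_neq0/heta[_ h].
      by have := le_lt_trans hd h; move: del_0; clearbody del; lra.
    rewrite mulr0 -lerBlDr sub0r.
    have h1 : l (inversion y) ^+ N <= r2' ^+ N.
      by rewrite lerXn2r ?nnegrE ?lle ?(ltW r2p) ?l_far.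
    have h2 : `|F y| * l (inversion y) ^+ N <= r2' ^+ N * `|F y|.
      by rewrite mulrC ler_wpM2r.
    rewrite lerNl; apply: le_trans h2.
    by rewrite -mulNr ler_wpM2r// -normrN ler_norm.
  have Fy := hF y yn hd.
  have Fy0' : 0 <= F y by rewrite (le_trans (ltW F2))// ltW.
  apply: (@le_trans _ _ (F y * l (inversion y) ^+ N)); last by rewrite lerDl.
  have [->|byn] := eqVneq (b y) 0; first by rewrite mulr0 mulr_ge0.
  have [_ h] := heta _ (b_neq0 _ byn).
  apply: (@le_trans _ _ (F y0 / 2 * r1 ^+ N)).
    by rewrite ler_piMr// mulr_ge0// ltW.
  apply: ler_pM => //; [exact: ltW|exact: ltW|].
  have r1p := le_trans (ltW r2p) (ltW r12).
  by rewrite lerXn2r ?nnegrE ?lle ?l_near.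
have ratio N : 1 + N%:R * (r1 / r2' - 1) <= space_int (fun y => `|F y|) / (F y0 / 2 * space_int b).
  have u0 : 0 <= r1 / r2' - 1 by rewrite subr_ge0 ler_pdivlMr// mul1r ltW.
  apply: le_trans (bernoulli_ineq N u0) _.
  rewrite addrC subrK expr_div_n ler_pdivlMr ?mulr_gt0// mulrAC ler_pdivrMr ?exprn_gt0//.
  have h := key N; rewrite [r2' ^+ N * _]mulrC in h; apply: le_trans h.
  by rewrite le_eqVlt; apply/orP; left; apply/eqP; ring.
set Q := space_int (fun y => `|F y|) / _ in ratio.
have u0 : 0 < r1 / r2' - 1 by rewrite subr_gt0 ltr_pdivlMr// mul1r.
have := ratio (Num.truncn (`|Q| / (r1 / r2' - 1))).+1.
have := truncnS_gt (`|Q| / (r1 / r2' - 1)).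
rewrite ltr_pdivrMr// => h1 h2; have := ler_norm Q.
move: h1 h2; move: (_ * (r1 / r2' - 1)) => w h1 h2 h3; lra.
Qed.

End Moments.

(** * Unique continuation for real functions *)

Section RealFunctions.
Variables (R : realType) (n d : nat).
Hypotheses (d0 : (0 < d)%N) (dn : (d < n)%N).
Implicit Types (x y z : 'rV[R]_n) (f : 'rV[R]_n -> R).

Lemma fast_shift f x : fast f -> fast (fun y => f (x + y)).
Proof.
move=> [cf [C fC]]; split; first exact: cont_shift.
pose b := 2 * (1 + enorm x ^+ 2).
exists (`|C| * (b * b ^+ n.+1)) => y; apply: le_trans (fC _) _.
have b0 : 0 < b by rewrite mulr_gt0 ?add1sqr_gt0.
have p0 : 0 <= (1 + enorm (x + y) ^+ 2)^-1 * weight (x + y).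
  by rewrite mulr_ge0 ?weight_ge0// invr_ge0 ltW ?add1sqr_gt0.
apply: le_trans (ler_wpM2r p0 (ler_norm C)) _; rewrite -mulrA ler_wpM2l//.
have h1 : (1 + enorm (x + y) ^+ 2)^-1 <= b * (1 + enorm y ^+ 2)^-1.
  rewrite ler_pdivlMr ?add1sqr_gt0// mulrC ler_pdivrMr ?add1sqr_gt0//.
  have h := ler_enormB (x + y) x; rewrite addrAC subrr add0r in h.
  have h2 : enorm y ^+ 2 <= (enorm (x + y) + enorm x) ^+ 2.
    by rewrite lerXn2r ?nnegrE ?addr_ge0 ?enorm_ge0.
  rewrite /b; set u := enorm (x + y) in h2 *; set v := enorm x in h2 *.
  have := sqr_ge0 (u - v); have := mulr_ge0 (sqr_ge0 u) (sqr_ge0 v).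
  rewrite sqrrD in h2; rewrite sqrrB; nra.
rewrite [leRHS]mulrACA ler_pM ?weight_ge0//; first by rewrite invr_ge0 ltW ?add1sqr_gt0.
exact: weightS.
Qed.

Lemma fastN f : fast f -> fast (fun y => - f y).
Proof.
move=> [cf [C fC]]; split; first by move=> y; exact: (cvgN (cf y)).
by exists C => y; rewrite normrN.
Qed.

(** The Riesz kernel centred at x, in the inverted variable, is the one centred
    at 0 times a power of invD. *)
Lemma riesz_inversion x y : y != 0 ->
  0 < invD x (inversion y) ->
  (enorm y)^-1 ^+ (n - d) * invDpow ((n - d)%:R / 2) x (inversion y) =
  (enorm (y - x))^-1 ^+ (n - d).
Proof.
move=> y0 D0; have ey : 0 < enorm y by rewrite enorm_gt0.
have e : enorm (y - x) ^+ 2 = enorm y ^+ 2 * invD x (inversion y).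
  rewrite sqr_enorm /invD /inversion dotDl !dotDr !dotNl !dotNr !dotZl !dotZr (dotC y x).
  rewrite -(sqr_enorm y); field; by rewrite gt_eqF.
have -> : enorm (y - x) = enorm y * invD x (inversion y) `^ 2^-1.
  apply/eqP; rewrite -(@eqrXn2 _ 2) ?enorm_ge0 ?mulr_ge0 ?enorm_ge0 ?powR_ge0//.
  rewrite e exprMn -[X in _ == _ * X]powR_mulrn ?powR_ge0// -powRrM mulVf ?pnatr_eq0// powRr1//.
  exact: ltW.
rewrite invfM exprMn; congr (_ * _).
by rewrite /invDpow -powRN -powR_mulrn ?powR_ge0// -powRrM; congr powR; ring.
Qed.

Variable mu : probability (borel_matrix R n) R.
Hypothesis rmu : rotation_invariant d mu.

(** The hypothesis says that F(y) = f(y) |y|^-(n-d) annihilates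
    invD^-a with a = (n-d)/2.  The exceptional exponents 2(a+k) + 2 = n mean
    d = 2k + 2. *)
Lemma real_unique_continuation f rho : odd d -> 0 < rho -> fast f -> vanish_ball rho f ->
  (forall x, enorm x < rho -> planes_mean d mu (fun y => f (x + y)) = 0) ->
  forall y, f y = 0.
Proof.
move=> od rho0 ff fr hI; have n0 : (0 < n)%N by exact: leq_ltn_trans dn.
have nd0 : (0 < n - d)%N by rewrite subn_gt0.
suff nonpos g : fast g -> vanish_ball rho g ->
    (forall x, enorm x < rho -> planes_mean d mu (fun y => g (x + y)) = 0) ->
    forall y, g y <= 0.
  move=> y; apply/eqP; rewrite eq_le nonpos//= -oppr_le0.
  apply: (nonpos (fun y => - f y)); first exact: fastN.
    by move=> x xr; rewrite fr ?oppr0.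
  move=> x xr; rewrite (posfunN (planes_mean_posfun dn rmu)) ?hI ?oppr0//.
  exact: tame_shift (fast_tame ff).
move=> fg gr hg y.
have [c c0 hc] := planes_mean_riesz d0 dn rmu.
pose F y := g y * (enorm y)^-1 ^+ (n - d).
have tF : tame F by apply: (tame_riesz _ rho0) => //; exact: fast_tame.
have Fr : vanish_ball rho F by move=> x xr; rewrite /F gr ?mul0r.
have h1 : annihilates F rho (fun=> 1) ((n - d)%:R / 2).
  move=> x xr; rewrite /inv_fun.
  have xr' : enorm x < rho by apply: lt_trans xr _; lra.
  have r20 : 0 < rho / 2 by rewrite divr_gt0.
  have vx : vanish_ball (rho / 2) (fun y => g (x + y)).
    by move=> z zr; apply: gr; apply: le_lt_trans (ler_enormD _ _) _; lra.
  have := hc _ _ r20 (fast_shift x fg) vx.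
  rewrite hg// => /esym/eqP; rewrite mulf_eq0 gt_eqF//= => /eqP h0.
  have th := tame_riesz (n - d) r20 (tame_shift x (fast_tame fg)) vx.
  rewrite -h0 -(space_int_shift (- x) th); congr space_int; apply/funext => z; rewrite mul1r.
  rewrite addrA subrr add0r [- x + z]addrC /F -mulrA.
  have [zr|zr] := ltP (enorm z) rho; first by rewrite gr// !mul0r.
  have z0 : z != 0 by rewrite -enorm_gt0 (lt_le_trans rho0).
  rewrite riesz_inversion//; apply: (invD_gt0 rho0) => //.
  rewrite /eball /= subr0 enorm_inversion lef_pV2 ?posrE//.
  by rewrite enorm_gt0.
have h2 s k : inv_fun F (monom s k) = 0.
  apply: (moments_vanish rho0 tF Fr s k _ _ h1) => j.
    by rewrite gt_eqF// ltr_wpDr// divr_gt0// ltr0n.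
  (* here parity enters: n = (n - d) + 2j + 2 would make d even *)
  rewrite (_ : 2 * _ + 2 = ((n - d) + 2 * j + 2)%N%:R :> R); last first.
    by rewrite 2!natrD natrM; field.
  rewrite eqr_nat; apply/eqP => e; move: od.
  have -> : d = (j + 1).*2 by rewrite -muln2; lia.
  by rewrite odd_double.
have Fy := moments_nonpos rho0 tF Fr n0 h2 y.
have [yr|yr] := ltP (enorm y) rho; first by rewrite gr.
move: Fy; rewrite /F pmulr_lle0// exprn_gt0// invr_gt0.
exact: lt_le_trans yr.
Qed.

End RealFunctions.

(** * Unique continuation for complex functions *)

Section ComplexFunctions.
Local Open Scope complex_scope.
Variables (R : realType) (n d : nat).
Implicit Types (f : 'rV[R]_n -> R[i]).

Lemma norm_Re_le (z : R[i]) (M : R) : `|z| <= M%:C -> `|complex.Re z| <= M.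
Proof. by move=> h; rewrite -lecR; apply: le_trans h; exact: normc_ge_Re. Qed.

Lemma norm_Im_le (z : R[i]) (M : R) : `|z| <= M%:C -> `|complex.Im z| <= M.
Proof.
rewrite normc_def lecR; apply: le_trans.
by rewrite -sqrtr_sqr ler_wsqrtr// lerDr sqr_ge0.
Qed.

Lemma norm_complex_le (z : R[i]) (M N : R) :
  `|complex.Re z| <= M -> `|complex.Im z| <= N -> `|z| <= (M + N)%:C.
Proof.
move=> hM hN; rewrite normc_def lecR.
have M0 := le_trans (normr_ge0 _) hM; have N0 := le_trans (normr_ge0 _) hN.
rewrite -[leRHS]ger0_norm ?addr_ge0// -sqrtr_sqr ler_wsqrtr//.
rewrite -(real_normK (num_real (complex.Re z))) -(real_normK (num_real (complex.Im z))).
rewrite sqrrD; have h1 : `|complex.Re z| ^+ 2 <= M ^+ 2 by rewrite lerXn2r ?nnegrE.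
have h2 : `|complex.Im z| ^+ 2 <= N ^+ 2 by rewrite lerXn2r ?nnegrE.
have := mulr_ge0 M0 N0; lra.
Qed.

Lemma C_infty_fast f : C_infty f ->
  fast (fun x => complex.Re (f x)) /\ fast (fun x => complex.Im (f x)).
Proof.
move=> [cR cI hf]; have [M hM] := hf (2 * n.+2)%N.
have e x : (1 + enorm x ^+ 2) `^ ((2 * n.+2)%:R / 2) = (1 + enorm x ^+ 2) ^+ n.+2 :> R.
  by rewrite natrM mulrAC divff ?pnatr_eq0// mul1r powR_mulrn// ltW// add1sqr_gt0.
have b x (r : R) : `|(1 + enorm x ^+ 2) ^+ n.+2 * r| <= M ->
    `|r| <= M * ((1 + enorm x ^+ 2)^-1 * weight (x : 'rV_n)).
  have p0 : 0 < (1 + enorm x ^+ 2) ^+ n.+2 :> R by rewrite exprn_gt0// add1sqr_gt0.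
  by rewrite normrM gtr0_norm// /weight -exprS exprVn ler_pdivlMr// mulrC.
split; split => //; exists M => x; apply: b; have := hM x; rewrite e.
  by move=> /norm_Re_le; case: (f x) => a c /=; rewrite mul0r subr0.
by move=> /norm_Im_le; case: (f x) => a c /=; rewrite mul0r addr0.
Qed.

Lemma complex_pair (a b a' b' : R) : a = a' -> b = b' -> a +i* b = a' +i* b'.
Proof. by move=> -> ->. Qed.

Lemma complex_eq0 (z : R[i]) : complex.Re z = 0 -> complex.Im z = 0 -> z = 0.
Proof. by case: z => a b /= -> ->. Qed.

Hypotheses (d0 : (0 < d)%N) (dn : (d < n)%N).
Variable mu : probability (borel_matrix R n) R.
Hypothesis rmu : rotation_invariant d mu.

(** The affine planes through x are the translates of the planes through 0. *)
Lemma normal_operatorE f x :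
  tame (fun x => complex.Re (f x)) -> tame (fun x => complex.Im (f x)) ->
  normal_operator d mu f x =
  planes_mean d mu (fun y => complex.Re (f (x + y))) +i*
  planes_mean d mu (fun y => complex.Im (f (x + y))).
Proof.
move=> tR tI; apply: complex_pair; apply: eq_Rintegral => P /set_mem GP.
  have [B [BB ->]] := orthonormal_factor GP.
  rewrite (plane_intE dn (tame_shift x tR) BB).
  exact: (plane_integral x BB (ltnW dn) tR).
have [B [BB ->]] := orthonormal_factor GP.
rewrite (plane_intE dn (tame_shift x tI) BB).
exact: (plane_integral x BB (ltnW dn) tI).
Qed.

Lemma function_unique_continuation f (V : set 'rV[R]_n) : odd d -> open V -> V !=set0 ->
  C_infty f -> (forall x, V x -> normal_operator d mu f x = 0) ->
  (forall x, V x -> f x = 0) -> forall x, f x = 0.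
Proof.
move=> od oV [v Vv] /C_infty_fast[fR fI] hN hf x.
have /nbhs_enormP[rho rho0 hrho] : nbhs v V by exact: open_nbhs_nbhs.
have inV y : enorm y < rho -> V (v + y).
  by move=> yr; apply: hrho; rewrite opprD addrA subrr add0r enormN.
have tR := fast_tame fR; have tI := fast_tame fI.
have N0 y : enorm y < rho -> planes_mean d mu (fun z => complex.Re (f (v + (y + z)))) = 0 /\
    planes_mean d mu (fun z => complex.Im (f (v + (y + z)))) = 0.
  move=> yr; have := hN _ (inV _ yr); rewrite normal_operatorE// => -[h1 h2].
  by split; under eq_fun do rewrite addrA.
have -> : x = v + (x - v) by rewrite addrC subrK.
apply: complex_eq0.
  apply: (real_unique_continuation d0 dn rmu od rho0 (fast_shift v fR)).
    by move=> y yr; rewrite hf//; exact: inV.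
  by move=> y /N0[].
apply: (real_unique_continuation d0 dn rmu od rho0 (fast_shift v fI)).
  by move=> y yr; rewrite hf//; exact: inV.
by move=> y /N0[].
Qed.

End ComplexFunctions.

(** * Partial derivatives *)

Section DirectionalDerivatives.
Variables (R : realType) (V : normedModType R).
Implicit Types (v x : V) (f : V -> R).

(** Epsilon-delta form of the directional derivative, in which uniform estimates
    are directly usable. *)
Definition has_deriv v f x (l : R) := forall e, 0 < e -> exists2 del, 0 < del &
  forall t, `|t| < del -> `|f (x + t *: v) - f x - t * l| <= e * `|t|.

Lemma has_derivP v f x l : has_deriv v f x l <-> is_derive x v f l.
Proof.
have key (l0 t : R) : t != 0 ->
    `|t^-1 *: (f (t *: v + x) - f x) - l0| = `|f (x + t *: v) - f x - t * l0| / `|t|.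
  move=> t0; rewrite (addrC _ x) /GRing.scale /= -normfV -normrM; congr `|_|; field; exact: t0.
split=> [h|[/cvg_ex[l' dl] <-]].
  have c : (fun t : R => t^-1 *: (f (t *: v + x) - f x)) @ 0^' --> l.
    apply/cvgrPdist_le => e e0; have [del del0 hd] := h e e0.
    near=> t; rewrite /= distrC key; last by near: t; exact: nbhs_dnbhs_neq.
    rewrite ler_pdivrMr ?normr_gt0; last by near: t; exact: nbhs_dnbhs_neq.
    apply: hd; near: t; apply: dnbhs0_lt; exact: del0.
  by apply: DeriveDef; [apply/cvg_ex; exists l|exact: cvg_lim c].
have -> : 'D_v f x = l' by exact: cvg_lim dl.
move=> e e0; move: dl => /cvgrPdist_le /(_ e e0).
rewrite near_withinE => /nbhs_ballP[del /= del0 hd]; exists del => // t td.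
have [->|t0] := eqVneq t 0; first by rewrite scale0r addr0 subrr mul0r subr0 normr0 mulr0.
have := hd t; rewrite distrC key// ler_pdivrMr ?normr_gt0//; apply => //.
by rewrite -ball_normE /= sub0r normrN.
Unshelve. all: by end_near.
Qed.

End DirectionalDerivatives.

Section PartialDerivatives.
Variables (R : realType) (n : nat).
Implicit Types (x y : 'rV[R]_n) (f g : 'rV[R]_n -> R) (s : seq 'I_n).
Local Notation e_ i := (delta_mx 0 i : 'rV[R]_n).

Local Notation has_pd i := (has_deriv (e_ i)).

Lemma has_pdP i f x l : has_pd i f x l <-> is_derive x (e_ i) f l.
Proof. exact: has_derivP. Qed.

Lemma has_pd_line i f x l :
  has_pd i f x l <-> is_derive (0 : R) 1 (fun t : R => f (x + t *: e_ i)) l.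
Proof.
rewrite has_pdP; split => [[dl <-]|[dl <-]].
  have e : (fun t : R => t^-1 *: (f (x + (t *: 1 + 0) *: e_ i) - f (x + 0 *: e_ i))) =
     (fun t : R => t^-1 *: (f (t *: e_ i + x) - f x)).
    by apply/funext => t; rewrite addr0 scale0r addr0 [t *: 1]mulr1 (addrC x).
  by apply: DeriveDef; rewrite /derivable /derive e.
have e : (fun t : R => t^-1 *: (f (x + (t *: 1 + 0) *: e_ i) - f (x + 0 *: e_ i))) =
     (fun t : R => t^-1 *: (f (t *: e_ i + x) - f x)).
  by apply/funext => t; rewrite addr0 scale0r addr0 [t *: 1]mulr1 (addrC x).
by apply: DeriveDef; rewrite /derivable /derive -e.
Qed.

Lemma has_pd_shift_line i f df x (t : R) : (forall x, has_pd i f x (df x)) ->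
  is_derive t 1 (fun t : R => f (x + t *: e_ i)) (df (x + t *: e_ i)).
Proof.
move=> h; have /has_pd_line := h (x + t *: e_ i).
have e : (fun t' : R => t'^-1 *: (f (x + t *: e_ i + (t' *: 1 + 0) *: e_ i) -
       f (x + t *: e_ i + 0 *: e_ i))) =
     (fun t' : R => t'^-1 *: (f (x + (t' *: 1 + t) *: e_ i) - f (x + t *: e_ i))).
  by apply/funext => u; rewrite addr0 scale0r addr0 [u *: 1]mulr1 scalerDl addrA addrAC.
by move=> [dl <-]; apply: DeriveDef; rewrite /derivable /derive -e.
Qed.

Lemma has_pd_unique i f x l l' : has_pd i f x l -> has_pd i f x l' -> l = l'.
Proof. by move=> /has_pdP[_ <-] /has_pdP[_ <-]. Qed.

Lemma has_pd_lin i a f g x l l' : has_pd i f x l -> has_pd i g x l' ->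
  has_pd i (fun y => a * f y + g y) x (a * l + l').
Proof.
move=> /has_pdP hf /has_pdP hg; apply/has_pdP.
Qed.

Lemma has_pdM i f g x l l' : has_pd i f x l -> has_pd i g x l' ->
  has_pd i (fun y => f y * g y) x (f x * l' + g x * l).
Proof. by move=> /has_pdP hf /has_pdP hg; apply/has_pdP; exact: is_deriveM. Qed.

Lemma has_pd_cst i (a : R) x : has_pd i (fun=> a) x 0.
Proof. by apply/has_pdP; exact: is_derive_cst. Qed.

Lemma has_pd_reflect i f x y l : has_pd i f (x - y) l ->
  has_pd i (fun y => f (x - y)) y (- l).
Proof.
move=> h e e0; have [del del0 hd] := h e e0; exists del => // t td.
have := hd (- t); rewrite normrN scaleNr opprD addrA mulrN mulNr; exact.
Qed.

Lemma has_pd_local i f g x l r : 0 < r -> (forall y, enorm (x - y) < r -> f y = g y) ->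
  has_pd i f x l -> has_pd i g x l.
Proof.
move=> r0 fg h e e0; have [del del0 hd] := h e e0; exists (Num.min r del).
  by rewrite lt_min r0.
move=> t; rewrite lt_min => /andP[tr td]; rewrite -!fg ?hd//; first by rewrite subrr enorm0.
by rewrite opprD addrA subrr add0r enormN enormZ delta_enorm mulr1.
Qed.

(** To prove smoothness it suffices to exhibit all partial derivatives at once,
    as a family indexed by lists of directions. *)
Lemma real_smooth_intro f (F : seq 'I_n -> 'rV[R]_n -> R) :
  (forall x, F [::] x = f x) -> (forall s, continuous (F s)) ->
  (forall s i x, has_pd i (F s) x (F (i :: s) x)) ->
  (forall s, partials s f = F s) /\ real_smooth f.
Proof.
move=> F0 cF dF.
have pE s : partials s f = F s.
  elim: s => [|i s IH] /=; first by apply/funext => x; rewrite F0.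
  by rewrite /partial; apply/funext => x; rewrite IH; have /has_pdP[_ ->] := dF s i x.
split=> // s; rewrite pE; split=> // i x.
by have /has_pdP[] := dF s i x.
Qed.

Lemma real_smooth_cont f s : real_smooth f -> continuous (partials s f).
Proof. by move=> /(_ s)[]. Qed.

Lemma real_smooth_pd f s i x : real_smooth f -> has_pd i (partials s f) x (partials (i :: s) f x).
Proof. by move=> /(_ s)[_ h]; apply/has_pdP; apply: DeriveDef => //; exact: h. Qed.

Lemma partials_lin a f g : real_smooth f -> real_smooth g ->
  (forall s, partials s (fun x => a * f x + g x) =
     (fun x => a * partials s f x + partials s g x)) /\
  real_smooth (fun x => a * f x + g x).
Proof.
move=> sf sg; apply: real_smooth_intro => // [s'|s' i x].
  apply: contD; last exact: real_smooth_cont.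
  by apply: contZ; exact: real_smooth_cont.
by apply: has_pd_lin; exact: real_smooth_pd.
Qed.

Lemma real_smooth0 : real_smooth (fun _ : 'rV[R]_n => 0 : R).
Proof.
suff [] : (forall s, partials s (fun _ : 'rV[R]_n => 0 : R) = (fun=> 0)) /\
  real_smooth (fun _ : 'rV[R]_n => 0 : R) by [].
by apply: (real_smooth_intro (F := fun _ _ => 0)) => // [s|s i x];
  [exact: contC|exact: has_pd_cst].
Qed.

Lemma partials_reflect f x : real_smooth f ->
  (forall s, partials s (fun y => f (x - y)) = (fun y => (-1) ^+ size s * partials s f (x - y))) /\
  real_smooth (fun y => f (x - y)).
Proof.
move=> sf; apply: real_smooth_intro => [y|s|s i y] /=; first by rewrite expr0 mul1r.
  apply: contZ => y; apply: (@continuous_comp _ _ _ (fun y => x - y)); last first.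
    exact: real_smooth_cont.
  by apply: (@enorm_lip_continuous _ _ _ _ 1) => a b; rewrite mul1r opprD opprK addrACA subrr add0r addrC enormB.
have := has_pd_lin ((-1) ^+ size s) (has_pd_reflect (real_smooth_pd s i (x - y) sf))
  (has_pd_cst i 0 y).
rewrite /= addr0 exprS mulN1r mulrN mulNr.
by under eq_fun do rewrite addr0.
Qed.

Lemma real_smooth_sum (T : Type) (r : seq T) (c : T -> R) (F : T -> 'rV[R]_n -> R) :
  (forall t, real_smooth (F t)) ->
  (forall s, partials s (fun x => \sum_(t <- r) c t * F t x) =
     (fun x => \sum_(t <- r) c t * partials s (F t) x)) /\
  real_smooth (fun x => \sum_(t <- r) c t * F t x).
Proof.
move=> sF; apply: real_smooth_intro => // [s|s i x].
  by apply: cont_sum => t; apply: contZ; exact: real_smooth_cont.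
elim: r => [|t r IH].
  by under eq_fun do rewrite big_nil; rewrite big_nil; exact: has_pd_cst.
by under eq_fun do rewrite big_cons; rewrite big_cons; exact: (has_pd_lin (c t) (real_smooth_pd s i x (sF t)) IH).
Qed.

Lemma partials_vanish f M s : real_smooth f -> (forall x, M < enorm x -> f x = 0) ->
  forall x, M < enorm x -> partials s f x = 0.
Proof.
move=> sf fM; elim: s => [|i s IH] //= x xM.
apply: (has_pd_unique (real_smooth_pd s i x sf)).
apply: (@has_pd_local _ (fun=> 0) _ _ _ (enorm x - M)); rewrite ?subr_gt0//.
  move=> y xy; rewrite IH//; have := ler_enorm_dist x y; lra.
exact: has_pd_cst.
Qed.

End PartialDerivatives.

Notation has_pd i := (has_deriv (delta_mx 0 i)).

(** * Smooth bumps *)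

Section Flat.
Variable R : realType.
Implicit Types (p : {poly R}) (t x : R).

(** The power series of the exponential. *)
Lemma pow_exp_bound t k : 0 <= t -> t ^+ k * expR (- t) <= k`!%:R.
Proof.
move=> t0; rewrite expRN ler_pdivrMr ?expR_gt0//.
case: k => [|k]; first by rewrite expr0 fact0 mul1r -expR0 ler_expR.
rewrite mulrC -ler_pdivrMr ?ltr0n ?fact_gt0//.
by apply: le_trans (expR_ge1Dxn k t0); rewrite lerDr.
Qed.

Lemma poly_exp_bound p : exists C, forall t, 0 <= t -> `|p.[t] * expR (- t)| <= C.
Proof.
exists (\sum_(i < size p) `|p`_i| * i`!%:R) => t t0.
rewrite horner_coef mulr_suml; apply: le_trans (ler_norm_sum _ _ _) _.
apply: ler_sum => i _; rewrite -mulrA normrM ler_wpM2l// ger0_norm ?pow_exp_bound//.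
by rewrite mulr_ge0 ?exprn_ge0 ?expR_ge0.
Qed.

(** The functions p(1/t) exp(-1/t) on t > 0, extended by 0: a class stable under
    differentiation. *)
Definition flat p t : R := if 0 < t then p.[t^-1] * expR (- t^-1) else 0.

(** At 0 the derivative is 0 because t^-2 p(1/t) exp(-1/t) is bounded. *)
Lemma flat_derive p t : is_derive t 1 (flat p) (flat ('X^2 * (p - p^`())) t).
Proof.
have [t0|t0|<-] := ltgtP 0 t.
- have e : {near t, (fun u => p.[u^-1] * expR (- u^-1)) =1 flat p}.
    near=> u; rewrite /flat ifT//; near: u; exact: lt_nbhsr.
  have tn0 : t != 0 by rewrite gt_eqF.
  have dv : is_derive t 1 (fun u : R => u^-1) (- t ^- 2).
    by have := is_deriveV tn0 (is_derive_id t 1); rewrite /GRing.scale /= mulr1.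
  have dp := @is_derive1_comp R (horner p) (fun u => u^-1) t _ _ (is_derive_poly p t^-1) dv.
  have dn : is_derive t 1 (fun u : R => - u^-1) (- (- t ^- 2)) by exact: is_deriveN.
  have de := @is_derive1_comp R expR (fun u => - u^-1) t _ _ (is_derive_expR (- t^-1)) dn.
  have := near_eq_is_derive e (is_deriveM dp de).
  move/is_derive_eq; apply; rewrite /GRing.scale /= /flat t0 hornerM hornerXn hornerD hornerN.
  by rewrite exprVn; ring.
- have e : {near t, (fun=> 0) =1 flat p}.
    near=> u; rewrite /flat ifF//; apply/negbTE; rewrite -leNgt; apply/ltW.
    by near: u; exact: lt_nbhsl.
  rewrite /flat [0 < t]ltNge (ltW t0) /=.
  exact: near_eq_is_derive e (is_derive_cst _ _ _).
- apply/has_derivP => e e0.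
  have [C hC] := poly_exp_bound ('X^2 * p).
  have C1 : 0 < `|C| + 1 by rewrite ltr_wpDl.
  exists (e / (`|C| + 1)); first by rewrite divr_gt0.
  move=> {}t te; rewrite add0r /GRing.scale /= mulr1 /flat ltxx subr0 mulr0 subr0.
  case: ltP => t0; last by rewrite normr0 mulr_ge0// ltW.
  have := hC t^-1; rewrite invr_ge0 (ltW t0) => /(_ isT).
  rewrite hornerM hornerXn -mulrA normrM => h.
  have h2 : `|p.[t^-1] * expR (- t^-1)| <= C * t ^+ 2.
    move: h; rewrite ger0_norm ?exprn_ge0 ?invr_ge0 ?(ltW t0)// exprVn mulrC.
    by rewrite ler_pdivrMr ?exprn_gt0.
  apply: le_trans h2 _; rewrite gtr0_norm// expr2 mulrA ler_wpM2r ?(ltW t0)//.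
  move: te; rewrite gtr0_norm// ltr_pdivlMr// => te.
  apply: le_trans _ (ltW te); rewrite mulrC ler_wpM2l ?(ltW t0)//.
  by apply: le_trans (ler_norm _) _; rewrite lerDl.
Unshelve. all: by end_near.
Qed.

Lemma flat_ge0 t : 0 <= flat 1 t.
Proof. by rewrite /flat; case: ifP => // _; rewrite hornerE mul1r expR_ge0. Qed.

(** The k-th derivative of exp(-1/t) is [flat (flat_poly k)]. *)
Fixpoint flat_poly k : {poly R} :=
  if k is k'.+1 then 'X^2 * (flat_poly k' - (flat_poly k')^`()) else 1.

Variable r : R.

(** The k-th derivative of the product of the i-th derivative of exp(-1/t) at
    r + t and the j-th at r - t.  The case i = j = 0 is the bump; the
    recursion is the product rule. *)
Fixpoint bump1 k i j t : R :=
  if k is k'.+1 then bump1 k' i.+1 j t - bump1 k' i j.+1 t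
  else flat (flat_poly i) (r + t) * flat (flat_poly j) (r - t).

Lemma bump1_derive k i j t : is_derive t 1 (bump1 k i j) (bump1 k.+1 i j t).
Proof.
elim: k i j => [|k IH] i j; last first.
  have -> : bump1 k.+1 i j = bump1 k i.+1 j - bump1 k i j.+1 by apply/funext.
  exact: (is_deriveB (IH i.+1 j) (IH i j.+1)).
have d1 : is_derive t 1 (fun u : R => r + u) 1.
  by have := is_deriveD (is_derive_cst r t 1) (is_derive_id t 1); rewrite add0r.
have d2 : is_derive t 1 (fun u : R => r - u) (-1).
  by have := is_deriveB (is_derive_cst r t 1) (is_derive_id t 1); rewrite sub0r.
have e1 := @is_derive1_comp R _ (fun u => r + u) t _ _ (flat_derive (flat_poly i) _) d1.
have e2 := @is_derive1_comp R _ (fun u => r - u) t _ _ (flat_derive (flat_poly j) _) d2.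
have := is_deriveM e1 e2; move/is_derive_eq; apply.
by rewrite /GRing.scale /=; ring.
Qed.

Lemma bump1_out k i j t : r <= `|t| -> bump1 k i j t = 0.
Proof.
move=> rt; elim: k i j => [|k IH] i j /=; last by rewrite !IH subrr.
rewrite /flat; case: (ger0P t) rt => t0 rt; last first.
  by rewrite ifF ?mul0r//; apply/negbTE; rewrite -leNgt; lra.
by rewrite [X in _ * X]ifF ?mulr0//; apply/negbTE; rewrite -leNgt; lra.
Qed.

Lemma bump1_ge0 t : 0 <= bump1 0 0 0 t.
Proof. by rewrite mulr_ge0 ?flat_ge0. Qed.

Lemma bump1_gt0 : 0 < r -> 0 < bump1 0 0 0 0.
Proof.
by move=> r0; rewrite mulr_gt0 /flat ?addr0 ?subr0 ?r0 ?hornerE ?mul1r ?expR_gt0.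
Qed.

Lemma bump1_continuous k i j : continuous (bump1 k i j).
Proof.
move=> t; have [h _] := bump1_derive k i j t.
by apply/differentiable_continuous/derivable1_diffP.
Qed.

End Flat.

Section Bump.
Variables (R : realType) (n : nat).
Implicit Types (x : 'rV[R]_n) (s : seq 'I_n).

(** The partial derivative along s of the tensor product of the one-dimensional
    bumps: it depends only on how often each direction occurs in s. *)
Definition tensor_bump (r : R) s x :=
  \prod_(i < n) bump1 r (count_mem i s) 0 0 (x 0 i).

Lemma tensor_bump_pd r s i x : has_pd i (tensor_bump r s) x (tensor_bump r (i :: s) x).
Proof.
apply/has_pd_line; rewrite /tensor_bump.
pose c := \prod_(j < n | j != i) bump1 r (count_mem j s) 0 0 (x 0 j).
have -> : (fun t : R => \prod_(j < n)
    bump1 r (count_mem j s) 0 0 ((x + t *: (delta_mx 0 i : 'rV_n)) 0 j)) =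
  (fun t => c * bump1 r (count_mem i s) 0 0 (x 0 i + t)).
  apply/funext => t; rewrite (bigD1 i)//= mulrC; congr (_ * _).
    by apply: eq_bigr => j ji; rewrite !mxE (negbTE ji) andbF mulr0 addr0.
  by rewrite !mxE !eqxx mulr1.
rewrite (bigD1 i)//= eqxx add1n mulrC.
have -> : \prod_(j < n | j != i)
    bump1 r ((i == j) + count_mem j s) 0 0 (x 0 j) = c.
  by apply: eq_bigr => j ji; rewrite eq_sym (negbTE ji).
have d1 : is_derive (0 : R) 1 (fun u : R => x 0 i + u) 1.
  by have := is_deriveD (is_derive_cst (x 0 i) (0 : R) (1 : R)) (is_derive_id (0 : R) 1); rewrite add0r.
have e1 := @is_derive1_comp R _ (fun u => x 0 i + u) 0 _ _
  (bump1_derive r (count_mem i s) 0 0 _) d1.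
have := is_deriveZ c e1; move/is_derive_eq; apply.
by rewrite /GRing.scale /= addr0 mulr1.
Qed.

Lemma tensor_bump_cont r s : continuous (tensor_bump r s).
Proof.
rewrite /tensor_bump; elim: (index_enum _) => [|i l IH].
  by under eq_fun do rewrite big_nil; exact: contC.
under eq_fun do rewrite big_cons; apply: contM => // x.
apply: (@cat_comp R _ (fun x : 'rV[R]_n => x 0 i) (bump1 r (count_mem i s) 0 0) x); first exact: cont_coord.
exact: bump1_continuous.
Qed.

(** The last clause is the symmetry of higher partial derivatives, visible here
    from the tensor form; integration by parts reverses the order of the
    derivatives. *)
Lemma bump_exists (r : R) : 0 < r -> exists phi : 'rV[R]_n -> R,
  [/\ real_smooth phi, (forall x, 0 <= phi x), 0 < phi 0,
      (forall x, r < enorm x -> phi x = 0) &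
      forall s, partials (rev s) phi = partials s phi].
Proof.
move=> r0; pose r' := r / n.+1%:R; have r'0 : 0 < r' by rewrite divr_gt0.
have [pE sm] : (forall s, partials s (tensor_bump r' [::]) = tensor_bump r' s) /\
  real_smooth (tensor_bump r' [::]).
  by apply: real_smooth_intro => // [s|s i x]; [exact: tensor_bump_cont|exact: tensor_bump_pd].
exists (tensor_bump r' [::]); split => //.
- by move=> x; apply: prodr_ge0 => i _; exact: bump1_ge0.
- by apply: prodr_gt0 => i _; rewrite mxE; exact: bump1_gt0.
- move=> x xr; have [i xi] : exists i, r' <= `|x 0 i|.
    apply: contrapT => h; move: xr; rewrite ltNge => /negP; apply.
    apply: le_trans (enorm_le_norm x) _.
    apply: (@le_trans _ _ (n%:R * r')).
      rewrite ler_wpM2l//; apply: norm_leP => [|i]; first exact: ltW.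
      by rewrite leNgt; apply/negP => hi; apply: h; exists i; exact: ltW.
    by rewrite /r' mulrCA ler_piMr ?(ltW r0)// ler_pdivrMr// mul1r ler_nat.
  by rewrite /tensor_bump (bigD1 i)// bump1_out//= mul0r.
- by move=> s; rewrite !pE /tensor_bump; under eq_fun do under eq_bigr do rewrite count_rev.
Qed.

End Bump.

(** * Averages of translates *)

Section Averages.
Variables (R : realType) (n : nat).
Implicit Types (x y w : 'rV[R]_n) (f g phi : 'rV[R]_n -> R) (s : seq 'I_n).

Lemma vanish_shift f M y : (forall x, M < enorm x -> f x = 0) ->
  forall w, M + enorm y < enorm w -> f (y + w) = 0.
Proof.
move=> fM w wM; apply: fM; have := ler_enorm_dist w (- y); rewrite opprK enormN (addrC w); lra.
Qed.

Section Mean.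
Variable L : ('rV[R]_n -> R) -> R.
Hypothesis pL : posfun L.

Lemma mean_continuous f M : continuous f -> (forall x, M < enorm x -> f x = 0) ->
  continuous (fun y => L (fun w => f (y + w))).
Proof.
move=> cf fM y; apply/continuous_enormP => e e0.
have tf := tame_compact cf fM.
pose N := M + enorm y + 1.
have B0 := pL.2 _ (cutoff_tame n N) (cutoff_ge0 N); set B := L _ in B0.
have e1 : 0 < e / (B + 1) by rewrite divr_gt0// ltr_wpDl.
have [d d0 hd] := unif_cont_compact cf fM e1.
exists (Num.min d 1) => [|y']; first by rewrite lt_min d0/=.
rewrite lt_min => /andP[yd y1].
rewrite -(posfunB pL (tame_shift y tf) (tame_shift y' tf)).
apply: (@le_lt_trans _ _ (e / (B + 1) * B)).
  rewrite -(posfunZ pL _ (cutoff_tame n N)); apply: (posfun_norm pL).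
  - by apply: tameB; exact: tame_shift.
  - by apply: tameZ; exact: cutoff_tame.
  move=> w; have [wN|wN] := leP (enorm w) N.
    by rewrite cutoff1// mulr1 hd// opprD addrACA subrr addr0.
  have -> : f (y + w) = 0 by apply: (vanish_shift fM); rewrite /N in wN; lra.
  have -> : f (y' + w) = 0.
    by apply: (vanish_shift fM); have := ler_enorm_dist y' y; rewrite enormB; rewrite /N in wN; lra.
  by rewrite subrr normr0 mulr_ge0 ?cutoff_ge0// ltW.
by rewrite mulrAC ltr_pdivrMr ?ltr_wpDl// ltr_pM2l// ltrDl.
Qed.

(** Differentiation under L: the error of the first order expansion of f is
    uniformly small, and supported in a fixed ball as long as the increment is
    bounded. *)
Lemma mean_pd i f df M y : continuous f -> continuous df ->
  (forall x, has_pd i f x (df x)) ->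
  (forall x, M < enorm x -> f x = 0) -> (forall x, M < enorm x -> df x = 0) ->
  has_pd i (fun y => L (fun w => f (y + w))) y (L (fun w => df (y + w))).
Proof.
move=> cf cdf hf fM dfM e e0.
have tf := tame_compact cf fM; have tdf := tame_compact cdf dfM.
pose N := M + enorm y + 1.
have B0 := pL.2 _ (cutoff_tame n N) (cutoff_ge0 N); set B := L _ in B0.
have e1 : 0 < e / (B + 1) by rewrite divr_gt0// ltr_wpDl.
have [d d0 hd] := unif_cont_compact cdf dfM e1.
exists (Num.min d 1) => [|t]; first by rewrite lt_min d0/=.
rewrite lt_min => /andP[td t1].
rewrite -(posfunB pL (tame_shift _ tf) (tame_shift y tf)) -(posfunZ pL _ (tame_shift y tdf)).
rewrite -(posfunB pL); last 2 first.
  by apply: tameB; exact: tame_shift.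
  by apply: tameZ; exact: tame_shift.
apply: (@le_trans _ _ (e / (B + 1) * `|t| * B)); last first.
  by rewrite mulrAC ler_wpM2r// mulrAC ler_pdivrMr ?ltr_wpDl// ler_pM2l// lerDl.
rewrite -(posfunZ pL _ (cutoff_tame n N)); apply: (posfun_norm pL).
- by apply: tameB; [apply: tameB|apply: tameZ]; exact: tame_shift.
- by apply: tameZ; exact: cutoff_tame.
move=> w; have [wN|wN] := leP (enorm w) N.
  rewrite cutoff1// mulr1.
  have [u ut E] := @mvt_bound R (fun t => f (y + w + t *: delta_mx 0 i))
    (fun t => df (y + w + t *: delta_mx 0 i)) t (fun u _ => has_pd_shift_line _ _ hf).
  rewrite scale0r addr0 in E.
  rewrite (addrAC y) E [t * _]mulrC -mulrBl normrM ler_wpM2r// hd//.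
  rewrite addrAC subrr add0r enormZ delta_enorm mulr1; exact: le_lt_trans td.
have -> : f (y + w) = 0 by apply: (vanish_shift fM); rewrite /N in wN; lra.
have -> : df (y + w) = 0 by apply: (vanish_shift dfM); rewrite /N in wN; lra.
have -> : f (y + t *: delta_mx 0 i + w) = 0.
  apply: (vanish_shift fM); have := ler_enormD y (t *: delta_mx 0 i).
  by rewrite enormZ delta_enorm mulr1; rewrite /N in wN; lra.
by rewrite mulr0 !subr0 normr0 mulr_ge0 ?cutoff_ge0// mulr_ge0 ?normr_ge0// ltW.
Qed.

Lemma partials_mean f M : real_smooth f -> (forall x, M < enorm x -> f x = 0) ->
  (forall s, partials s (fun y => L (fun w => f (y + w))) =
     (fun y => L (fun w => partials s f (y + w)))) /\
  real_smooth (fun y => L (fun w => f (y + w))).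
Proof.
move=> sf fM; apply: real_smooth_intro => // [s|s i x].
  apply: (mean_continuous (M := M)); first exact: real_smooth_cont.
  exact: partials_vanish.
apply: (mean_pd (M := M)); [exact: real_smooth_cont|exact: real_smooth_cont
  |move=> y; exact: real_smooth_pd|exact: partials_vanish|exact: partials_vanish].
Qed.

End Mean.

(** The integral of f(y + .) does not depend on y. *)
Lemma space_int_pd i f df M : continuous f -> continuous df ->
  (forall x, has_pd i f x (df x)) ->
  (forall x, M < enorm x -> f x = 0) -> (forall x, M < enorm x -> df x = 0) ->
  space_int df = 0.
Proof.
move=> cf cdf hf fM dfM; have := mean_pd (@space_int_posfun R n) 0 cf cdf hf fM dfM.
under [X in has_deriv _ _ _ (_ X) -> _]eq_fun do rewrite add0r.
have -> : (fun y => space_int (fun w => f (y + w))) = fun=> space_int f.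
  by apply/funext => y; rewrite space_int_shift//; exact: tame_compact fM.
by move=> h; exact: has_pd_unique h (has_pd_cst _ _ _).
Qed.

(** Moving derivatives one at a time from phi to g reverses their order, which
    is the reason for [catrev]. *)
Lemma space_int_partials_parts g phi M s s' : real_smooth g -> real_smooth phi ->
  (forall x, M < enorm x -> phi x = 0) ->
  space_int (fun w => partials s' g w * partials s phi w) =
  (-1) ^+ size s * space_int (fun w => partials (catrev s s') g w * phi w).
Proof.
move=> sg sp pM; elim: s s' => [|i s IH] s'; first by rewrite expr0 mul1r.
have c h s0 : real_smooth h -> continuous (partials s0 h) by exact: real_smooth_cont.
have v s0 x : M < enorm x -> partials s0 phi x = 0 by exact: partials_vanish.
have t s1 s2 : tame (fun w => partials s1 g w * partials s2 phi w).
  apply: (tame_compact (M := M)); first by apply: contM; exact: c.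
  by move=> x xM; rewrite v// mulr0.
have h0 : space_int (fun w => partials s' g w * partials (i :: s) phi w +
    partials s phi w * partials (i :: s') g w) = 0.
  apply: (@space_int_pd i (fun w => partials s' g w * partials s phi w) _ M).
  - by apply: contM; exact: c.
  - by apply: contD; apply: contM; exact: c.
  - by move=> x; apply: has_pdM; exact: real_smooth_pd.
  - by move=> x xM; rewrite v// mulr0.
  - by move=> x xM; rewrite !v// mulr0 mul0r addr0.
move: h0; have -> : (fun w => partials s' g w * partials (i :: s) phi w +
   partials s phi w * partials (i :: s') g w) =
   (fun w => partials s' g w * partials (i :: s) phi w +
   partials (i :: s') g w * partials s phi w) by apply/funext => w; rewrite [X in _ + X]mulrC.
rewrite (posfunD (@space_int_posfun R n))// IH /= exprS mulN1r mulNr => h; lra.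
Qed.

Lemma partials_shift f x : real_smooth f ->
  (forall s, partials s (fun y => f (x + y)) = (fun y => partials s f (x + y))) /\
  real_smooth (fun y => f (x + y)).
Proof.
move=> sf; apply: real_smooth_intro => // [s|s i y].
  by apply: cont_shift; exact: real_smooth_cont.
move=> e e0; have [d d0 h] := real_smooth_pd s i (x + y) sf e0.
by exists d => // t td; rewrite addrA h.
Qed.

End Averages.

(** * Functionals of finite order *)

Section FiniteOrder.
Variables (R : realType) (n : nat).
Implicit Types (x y w : 'rV[R]_n) (f g phi G : 'rV[R]_n -> R) (s : seq 'I_n).

(** Finitely many lists of bounded size, hence a common bound. *)
Lemma uniform_order (P : seq 'I_n -> R -> Prop) m :
  (forall s d d', 0 < d' -> d' <= d -> P s d -> P s d') ->
  (forall s, exists2 d, 0 < d & P s d) ->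
  exists2 d, 0 < d & forall s, (size s <= m)%N -> P s d.
Proof.
move=> mono; elim: m P mono => [|m IH] P mono hP.
  by have [d d0 h] := hP [::]; exists d => // s; rewrite leqn0 size_eq0 => /eqP->.
have [d0 d00 h0] := hP [::].
have /choice[D hD] i : exists d, 0 < d /\ forall s, (size s <= m)%N -> P (i :: s) d.
  have [d dp h] := IH (fun s => P (i :: s)) (fun s => mono (i :: s)) (fun s => hP (i :: s)).
  by exists d.
pose d := \big[Num.min/d0]_(i < n) D i.
have dp : 0 < d by rewrite /d; apply: (big_ind (fun d => 0 < d)) => // [a b a0 b0|i _]; [rewrite lt_min a0|case: (hD i)].
exists d => // -[_|i s hs].
  by apply: (mono _ d0) => //; apply: bigmin_le_id.
have [_ hi] := hD i; apply: (mono _ (D i) _ dp _ (hi s hs)).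
exact: bigmin_le_cond.
Qed.

Variables (U : ('rV[R]_n -> R) -> R) (K : set 'rV[R]_n) (m : nat) (C : R).
Hypothesis Ulin : forall a f g, real_smooth f -> real_smooth g ->
  U (fun x => a * f x + g x) = a * U f + U g.
Hypotheses (cK : compact K) (C0 : 0 <= C).
Hypothesis Ubound : forall f M, real_smooth f -> 0 <= M ->
  (forall s x, (size s <= m)%N -> K x -> `|partials s f x| <= M) -> `|U f| <= C * M.

Lemma order_U0 : U (fun=> 0) = 0.
Proof.
have s0 := @real_smooth0 R n; have := Ulin (-1) s0 s0.
rewrite (_ : (fun x => -1 * 0 + 0) = (fun=> 0)); last first.
  by apply/funext => x; rewrite mulr0 addr0.
by move=> h; lra.
Qed.

Lemma order_U_sum (T : Type) (r : seq T) (c : T -> R) (F : T -> 'rV[R]_n -> R) :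
  (forall t, real_smooth (F t)) ->
  U (fun x => \sum_(t <- r) c t * F t x) = \sum_(t <- r) c t * U (F t).
Proof.
move=> sF; elim: r => [|t r IH].
  by under eq_fun do rewrite big_nil; rewrite big_nil order_U0.
under eq_fun do rewrite big_cons; rewrite big_cons -IH; apply: Ulin => //.
by have [_] := real_smooth_sum r c sF.
Qed.

Lemma order_U_dist f g M : real_smooth f -> real_smooth g -> 0 <= M ->
  (forall s x, (size s <= m)%N -> K x -> `|partials s f x - partials s g x| <= M) ->
  `|U f - U g| <= C * M.
Proof.
move=> sf sg M0 h; have [pE sm] := partials_lin (-1) sg sf.
have := Ubound sm M0; rewrite Ulin// mulN1r addrC; apply => s x sm' xK.
by rewrite pE mulN1r addrC h.
Qed.

Section Kernel.
Variables (phi : 'rV[R]_n -> R) (M : R).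
Hypotheses (sphi : real_smooth phi) (phiM : forall x, M < enorm x -> phi x = 0).

(** The convolution of the distribution U with phi. *)
Definition smoothed x : R := U (fun y => phi (x - y)).

Lemma partials_uniform e : 0 < e -> exists2 d, 0 < d &
  forall s x y, (size s <= m)%N -> enorm (x - y) < d -> `|partials s phi x - partials s phi y| <= e.
Proof.
move=> e0; have [|s|d d0 h] := @uniform_order
  (fun s d => forall x y, enorm (x - y) < d -> `|partials s phi x - partials s phi y| <= e) m.
- by move=> s d d' d'0 dd' h x y xy; apply: h; exact: lt_le_trans dd'.
- have [d d0 h] := unif_cont_compact (real_smooth_cont (s := s) sphi) (partials_vanish s sphi phiM) e0.
  by exists d.
- by exists d => // s x y sm; apply: h.
Qed.

Lemma partials_bounded : exists2 B, 0 <= B &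
  forall s x, (size s <= m)%N -> `|partials s phi x| <= B.
Proof.
have [|s|d d0 h] := @uniform_order (fun s d => forall x, `|partials s phi x| * d <= 1) m.
- by move=> s d d' d'0 dd' h x; apply: le_trans (h x); rewrite ler_wpM2l.
- have [_ [D hD]] := tame_compact (real_smooth_cont (s := s) sphi) (partials_vanish s sphi phiM).
  have D0 : 0 < `|D| + 1 by rewrite ltr_wpDl.
  exists (`|D| + 1)^-1 => [|x]; first by rewrite invr_gt0.
  rewrite ler_pdivrMr// mul1r; apply: le_trans (hD x) _.
  apply: (@le_trans _ _ (`|D| * 1)); last by rewrite mulr1 lerDl.
  apply: le_trans (ler_wpM2r (weight_ge0 x) (ler_norm D)) _.
  by rewrite ler_wpM2l// weight_le1.
- exists d^-1 => [|s x sm]; first by rewrite invr_ge0 ltW.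
  by rewrite -[d^-1]mul1r ler_pdivlMr// h.
Qed.

Lemma smoothed_uniform e : 0 < e -> exists2 d, 0 < d &
  forall x y, enorm (x - y) < d -> `|smoothed x - smoothed y| <= C * e.
Proof.
move=> e0; have [d d0 h] := partials_uniform e0; exists d => // x y xy.
have [px sx] := partials_reflect x sphi; have [py sy] := partials_reflect y sphi.
apply: (order_U_dist sx sy (ltW e0)) => s z sm zK.
rewrite px py -mulrBr normrM normrX normrN1 expr1n mul1r h//.
by rewrite opprB addrA subrK.
Qed.

Lemma smoothed_continuous : continuous smoothed.
Proof.
move=> x; apply/continuous_enormP => e e0.
have e1 : 0 < e / (C + 1) by rewrite divr_gt0// ltr_wpDl.
have [d d0 h] := smoothed_uniform e1; exists d => // y /h h1.
apply: le_lt_trans h1 _; rewrite mulrCA gtr_pMr//.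
by rewrite ltr_pdivrMr ?ltr_wpDl// mul1r ltrDl.
Qed.

Lemma smoothed_bounded : exists2 B, 0 <= B & forall x, `|smoothed x| <= B.
Proof.
have [B B0 h] := partials_bounded; exists (C * B) => [|x]; first exact: mulr_ge0.
have [px sx] := partials_reflect x sphi.
by apply: Ubound => // s z sm zK; rewrite px normrM normrX normrN1 expr1n mul1r h.
Qed.

Lemma smoothed_vanish : exists N, forall x, N < enorm x -> smoothed x = 0.
Proof.
have [r hr] : exists r, forall y, K y -> enorm y <= r.
  have /compact_bounded[D [_ hD]] := cK.
  exists (n%:R * (`|D| + 1)) => y Ky; apply: le_trans (enorm_le_norm y) _.
  by rewrite ler_wpM2l//; apply: hD => //; rewrite (le_lt_trans (ler_norm D))// ltrDl.
exists (M + r) => x xN; have [px sx] := partials_reflect x sphi.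
apply/eqP; rewrite -normr_le0 -(mulr0 C); apply: Ubound => // s y sm Ky.
rewrite px (partials_vanish s sphi phiM) ?mulr0 ?normr0//.
have := ler_enorm_dist x y; have := hr y Ky; lra.
Qed.

(** U commutes with averages of translates of phi, up to an error: if G is close
    to the average of the reflected translates phi(w - .) with weight a, in all
    derivatives of order at most m on K, then U G is close to the average of
    U(phi(w - .)).  Both averages are approximated by the same Riemann sum, on
    which U acts termwise. *)
Lemma functional_swap (L : ('rV[R]_n -> R) -> R) (a : 'rV[R]_n -> R) N G eta :
  posfun L -> continuous a -> (forall x, N < enorm x -> a x = 0) -> real_smooth G -> 0 <= eta ->
  (forall s y, (size s <= m)%N -> K y ->
    `|partials s G y - (-1) ^+ size s * L (fun w => a w * partials s phi (w - y))| <= eta) ->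
  `|U G - L (fun w => a w * smoothed w)| <= C * eta.
Proof.
move=> pL ca aN sG eta0 hG.
have [A A0 hA] : exists2 A, 0 <= A & forall x, `|a x| <= A.
  have [_ [D hD]] := tame_compact ca aN; exists `|D| => // x.
  apply: le_trans (hD x) _; apply: le_trans (ler_wpM2r (weight_ge0 x) (ler_norm D)) _.
  by rewrite ler_piMr// weight_le1.
have [B B0 hB] := partials_bounded; have [B' B'0 hB'] := smoothed_bounded.
have T0 := pL.2 _ (cutoff_tame n N) (cutoff_ge0 N); set T := L _ in T0.
apply/ler_addgt0Pr => e' e'0.
pose k1 := (B + A) * T; pose k2 := (B' + A * C) * T.
have k10 : 0 <= k1 by rewrite mulr_ge0// addr_ge0.
have k20 : 0 <= k2 by rewrite mulr_ge0// addr_ge0// mulr_ge0.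
have k0 : 0 < C * k1 + k2 + 1 by rewrite ltr_wpDl// addr_ge0// mulr_ge0.
pose e := e' / (C * k1 + k2 + 1); have e0 : 0 < e by rewrite divr_gt0.
have [d1 d10 h1] := unif_cont_compact ca aN e0.
have [d2 d20 h2] := partials_uniform e0; have [d3 d30 h3] := smoothed_uniform e0.
pose d := Num.min d1 (Num.min d2 d3) / 2.
have dm0 : 0 < Num.min d1 (Num.min d2 d3) by rewrite !lt_min d10 d20.
have d0 : 0 < d by rewrite divr_gt0.
have dlt : d < Num.min d1 (Num.min d2 d3) by rewrite /d ltr_pdivrMr// ltr_pMr// ltr1n.
move: dlt; rewrite !lt_min => /and3P[dd1 dd2 dd3].
have cutN x : N + 1 < enorm x -> cutoff N x = 0 by exact: cutoff_out.
have [l hl] := riemann_sum pL (@cutoff_cont _ _ N) (cutoff_ge0 N) cutN d0.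
(* used with q a derivative of phi, for U G, and with q the convolution, for the average *)
have est (q : 'rV[R]_n -> R) b c : continuous q -> (forall x, `|q x| <= b) -> 0 <= c ->
    (forall x y, enorm (x - y) <= d -> `|q x - q y| <= c) ->
    `|L (fun w => a w * q w) - \sum_(p <- l) p.2 * (a p.1 * q p.1)| <= (e * b + A * c) * T.
  move=> cq qb c0 qc.
  have aE : (fun w => a w * q w) = (fun w => a w * q w * cutoff N w).
    apply/funext => w; have [wN|wN] := leP (enorm w) N; first by rewrite cutoff1 ?mulr1.
    by rewrite aN ?mul0r.
  rewrite {1}aE; apply: (hl (fun w => a w * q w)).
    rewrite -aE; apply: (tame_compact (M := N)); first exact: contM.
    by move=> w wN; rewrite aN ?mul0r.
  move=> x y _ xy.
  have -> : a x * q x - a y * q y = (a x - a y) * q x + a y * (q x - q y) by ring.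
  apply: le_trans (ler_normD _ _) _; rewrite !normrM; apply: lerD; apply: ler_pM => //.
    by apply: h1; exact: le_lt_trans dd1.
  exact: qc.
pose S y := \sum_(p <- l) (p.2 * a p.1) * phi (p.1 - y).
have sr (p : 'rV[R]_n * R) : real_smooth (fun y => phi (p.1 - y)).
  by have [] := partials_reflect p.1 sphi.
have [pS sS] := real_smooth_sum l (fun p => p.2 * a p.1) sr.
have US : U S = \sum_(p <- l) p.2 * (a p.1 * smoothed p.1).
  rewrite /S (@order_U_sum _ l (fun p => p.2 * a p.1) (fun p y => phi (p.1 - y)) sr).
  by apply: eq_bigr => p _; rewrite mulrA.
have E1 : `|U G - U S| <= C * (eta + e * k1).
  apply: order_U_dist => //; first by rewrite addr_ge0// mulr_ge0// ltW.
  move=> s y sm Ky; set X := (-1) ^+ size s * L (fun w => a w * partials s phi (w - y)).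
  have -> : partials s G y - partials s S y = (partials s G y - X) + (X - partials s S y).
    by ring.
  apply: le_trans (ler_normD _ _) _; apply: lerD; first exact: hG.
  have -> : partials s S y =
      (-1) ^+ size s * \sum_(p <- l) p.2 * (a p.1 * partials s phi (p.1 - y)).
    rewrite pS mulr_sumr; apply: eq_bigr => p _.
    by have [-> _] := partials_reflect p.1 sphi; ring.
  rewrite /X -mulrBr normrM normrX normrN1 expr1n mul1r.
  have -> : e * k1 = (e * B + A * e) * T by rewrite /k1; ring.
  apply: (est (fun w => partials s phi (w - y))) => //; last 1 first.
  - move=> w w' ww'; apply: h2 => //; rewrite opprB addrA subrK; exact: le_lt_trans dd2.
  - have := cont_shift (x := - y) (real_smooth_cont (s := s) sphi).
    by under eq_fun do rewrite addrC.
  - by move=> w; exact: hB.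
  - exact: ltW.
have E2 : `|L (fun w => a w * smoothed w) - U S| <= e * k2.
  have -> : e * k2 = (e * B' + A * (C * e)) * T by rewrite /k2; ring.
  rewrite US; apply: est => //; first exact: smoothed_continuous.
    by rewrite mulr_ge0// ltW.
  by move=> w w' ww'; apply: h3; exact: le_lt_trans dd3.
have -> : U G - L (fun w => a w * smoothed w) =
  (U G - U S) - (L (fun w => a w * smoothed w) - U S) by ring.
apply: le_trans (ler_normB _ _) _; apply: le_trans (lerD E1 E2) _.
rewrite mulrDr -addrA lerD2l.
have -> : C * (e * k1) + e * k2 = e * (C * k1 + k2) by ring.
by rewrite /e mulrAC ler_pdivrMr// ler_pM2l// lerDl.
Qed.

End Kernel.

End FiniteOrder.

(** * Unique continuation for real distributions *)

Section RealDistributions.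
Variables (R : realType) (n d : nat).
Hypotheses (d0 : (0 < d)%N) (dn : (d < n)%N) (od : odd d).
Implicit Types (x y w : 'rV[R]_n) (f g phi psi : 'rV[R]_n -> R) (s : seq 'I_n).
Variable mu : probability (borel_matrix R n) R.
Hypothesis rmu : rotation_invariant d mu.

Let n0 : (0 < n)%N. Proof. exact: leq_ltn_trans dn. Qed.

Lemma mollifier_exists (r : R) : 0 < r -> exists phi : 'rV[R]_n -> R,
  [/\ real_smooth phi, (forall x, 0 <= phi x), space_int phi = 1,
      (forall x, r < enorm x -> phi x = 0) &
      forall s, partials (rev s) phi = partials s phi].
Proof.
move=> r0; have [phi [sp p0 p1 pr ps]] := bump_exists n r0.
have cp : continuous phi := real_smooth_cont (s := [::]) sp.
have tp := tame_compact cp pr.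
have l0 : 0 < space_int phi := space_int_gt0 n0 tp p0 p1.
pose c := (space_int phi)^-1.
have [pE sm] : (forall s, partials s (fun x => c * phi x) = (fun x => c * partials s phi x)) /\
    real_smooth (fun x => c * phi x).
  apply: real_smooth_intro => // [s|s i x]; first by apply: contZ; exact: real_smooth_cont.
  have := has_pd_lin c (real_smooth_pd s i x sp) (has_pd_cst i 0 x).
  by rewrite addr0; under eq_fun do rewrite addr0.
exists (fun x => c * phi x); split => //.
- by move=> x; rewrite mulr_ge0// invr_ge0 ltW.
- by rewrite (posfunZ (@space_int_posfun R n))// mulVf// gt_eqF.
- by move=> x xr; rewrite pr ?mulr0.
- by move=> s; rewrite !pE ps.
Qed.

Lemma fast_compact f M : continuous f -> (forall x, M < enorm x -> f x = 0) -> fast f.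
Proof.
move=> cf fM; split=> //.
have [_ [C hC]] : tame (fun x => (1 + enorm x ^+ 2) * f x).
  apply: (tame_compact (M := M)); last by move=> x xM; rewrite fM ?mulr0.
  apply: contM => //; apply: contD; first exact: contC.
  by apply: contX; exact: enorm_continuous.
exists C => x; have := hC x; rewrite normrM gtr0_norm ?add1sqr_gt0// => h.
by rewrite mulrCA ler_pdivlMl ?add1sqr_gt0.
Qed.

Lemma planes_mean_reflect f : tame f -> planes_mean d mu (fun z => f (- z)) = planes_mean d mu f.
Proof.
move=> tf; rewrite -(planes_mean_orth dn rmu (U := - 1%:M) tf).
  by congr planes_mean; apply/funext => z; rewrite mulmxN mulmx1.
by rewrite linearN /= trmx1 mulNmx mulmxN mulmx1 opprK.
Qed.

(** After integration by parts the derivative falls on psi, and phi averages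
    it over a small ball. *)
Lemma mollify_dist (psi phi : 'rV[R]_n -> R) M s y e : real_smooth psi -> real_smooth phi ->
  (forall x, 0 <= phi x) -> space_int phi = 1 -> (forall x, M < enorm x -> phi x = 0) ->
  (forall s, partials (rev s) phi = partials s phi) ->
  (forall w, enorm w <= M -> `|partials s psi y - partials s psi (y + w)| <= e) ->
  `|partials s psi y - (-1) ^+ size s * space_int (fun w => psi w * partials s phi (w - y))| <= e.
Proof.
move=> spsi sphi phi0 phi1 phiM ps he.
have cphi : continuous phi := real_smooth_cont (s := [::]) sphi.
have tphi := tame_compact cphi phiM.
have cpsi : continuous psi := real_smooth_cont (s := [::]) spsi.
have [pE sg] := partials_shift y spsi.
have th : tame (fun w => psi w * partials s phi (w - y)).
  apply: (tame_compact (M := M + enorm y)).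
    apply: contM => //; have := cont_shift (x := - y) (real_smooth_cont (s := s) sphi).
    by under eq_fun do rewrite addrC.
  move=> w wM; rewrite (partials_vanish s sphi phiM) ?mulr0//.
  by have := ler_enorm_dist w y; lra.
rewrite -(space_int_shift y th).
have -> : (fun w => psi (y + w) * partials s phi (y + w - y)) =
    (fun w => partials [::] (fun w => psi (y + w)) w * partials (rev s) phi w).
  by apply/funext => w; rewrite ps addrAC subrr add0r.
rewrite (space_int_partials_parts _ _ sg sphi phiM) size_rev mulrA -exprMn mulrNN mulr1 expr1n mul1r.
rewrite -/(rev (rev s)) revK pE.
have t1 : tame (fun w => partials s psi (y + w) * phi w).
  apply: (tame_compact (M := M)); last by move=> w wM; rewrite phiM ?mulr0.
  by apply: contM => //; apply: cont_shift; exact: real_smooth_cont.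
have -> : partials s psi y = space_int (fun w => partials s psi y * phi w).
  by rewrite (posfunZ (@space_int_posfun R n))// phi1 mulr1.
rewrite -(posfunB (@space_int_posfun R n))//; last exact: tameZ.
have -> : e = space_int (fun w => e * phi w) by rewrite (posfunZ (@space_int_posfun R n))// phi1 mulr1.
apply: (posfun_norm (@space_int_posfun R n)); [|exact: tameZ|].
  by apply: tameB => //; exact: tameZ.
move=> w; have [wM|wM] := leP (enorm w) M; last by rewrite phiM// !mulr0 subrr normr0.
by rewrite -mulrBl normrM (ger0_norm (phi0 w)) ler_wpM2r// he.
Qed.

Variables (U : ('rV[R]_n -> R) -> R) (K : set 'rV[R]_n) (m : nat) (C : R).
Hypothesis Ulin : forall a f g, real_smooth f -> real_smooth g ->
  U (fun x => a * f x + g x) = a * U f + U g.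
Hypotheses (cK : compact K) (C0 : 0 <= C).
Hypothesis Ubound : forall f M, real_smooth f -> 0 <= M ->
  (forall s x, (size s <= m)%N -> K x -> `|partials s f x| <= M) -> `|U f| <= C * M.

Variables (v : 'rV[R]_n) (rho : R).
Hypothesis rho0 : 0 < rho.
Hypothesis U0 : forall f, real_smooth f ->
  (forall y, rho <= enorm (y - v) -> f y = 0) -> U f = 0.
Hypothesis NU0 : forall f, real_smooth f ->
  (forall y, rho <= enorm (y - v) -> f y = 0) ->
  U (fun y => planes_mean d mu (fun z => f (y + z))) = 0.

Let K_bounded : exists r, forall y, K y -> enorm y <= r.
Proof.
have /compact_bounded[D [_ hD]] := cK.
exists (n%:R * (`|D| + 1)) => y Ky; apply: le_trans (enorm_le_norm y) _.
by rewrite ler_wpM2l//; apply: hD => //; rewrite (le_lt_trans (ler_norm D))// ltrDl.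
Qed.

(** The convolution f of U with phi is continuous with compact support and
    vanishes near v, because phi(x - .) is supported near v for x near v.  The
    mean of f over the planes through such an x is U applied to the mean of
    phi(x - .), by [functional_swap] with zero error, and this is 0 by
    hypothesis; so unique continuation for functions applies. *)
Lemma smoothed_zero phi r : real_smooth phi -> r < rho / 2 ->
  (forall x, r < enorm x -> phi x = 0) -> forall x, smoothed U phi x = 0.
Proof.
move=> sphi r2 phir.
have cphi : continuous phi := real_smooth_cont (s := [::]) sphi.
have tphi := tame_compact cphi phir.
set f := smoothed U phi.
have cf : continuous f := smoothed_continuous Ulin C0 Ubound sphi phir.
have [N hN] := smoothed_vanish cK Ubound sphi phir.
have supp x : enorm x < rho / 2 -> forall y, rho <= enorm (y - v) -> phi (v + x - y) = 0.
  move=> xr y yr; apply: phir; have := ler_enorm_dist (y - v) x.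
  by rewrite (_ : v + x - y = - (y - v - x)) ?enormN; [lra|rewrite 2!opprB addrA (addrC x)].
have pI := planes_mean_posfun dn rmu.
have If x : enorm x < rho / 2 -> planes_mean d mu (fun z => f (v + (x + z))) = 0.
  move=> xr; set x' := v + x; pose L (h : 'rV[R]_n -> R) := planes_mean d mu (fun z => h (x' + z)).
  have pL : posfun L.
    split=> [a g h tg th|g tg g0]; first by apply: pI.1; exact: tame_shift.
    by apply: pI.2 => //; exact: tame_shift.
  have [rK hK] := K_bounded.
  (* beyond this radius both f and, for y in K, phi(. - y) vanish *)
  pose N' := Num.max N (r + rK).
  have [pP sP] := partials_reflect x' sphi.
  have P0 w : r + enorm x' < enorm w -> phi (x' - w) = 0.
    by move=> wr; apply: phir; have := ler_enorm_dist w x'; rewrite enormB; lra.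
  pose G y := planes_mean d mu (fun z => phi (x' - (y + z))).
  have [pG sG] := partials_mean pI sP P0.
  have NN w : N' + 1 < enorm w -> cutoff N' w = 0 by exact: cutoff_out.
  have tN w : N' < enorm w -> f w = 0.
    by rewrite gt_max => /andP[wN _]; exact: hN.
  have := @functional_swap _ _ U K m C Ulin C0 Ubound phi r sphi phir L (cutoff N') (N' + 1) G 0
    pL (@cutoff_cont _ _ N') NN sG (lexx 0).
  rewrite mulr0 => swap; have : `|U G - L (fun w => cutoff N' w * f w)| <= 0.
    apply: swap => s y sm Ky; rewrite normr_le0 subr_eq0; apply/eqP.
    rewrite /G (pG s) pP.
    have ts : tame (fun z => partials s phi (x' + z - y)).
      have := tame_shift (x' - y) (tame_compact (real_smooth_cont (s := s) sphi)
        (partials_vanish s sphi phir)).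
      by under eq_fun do rewrite addrAC.
    rewrite (_ : (fun w => (-1) ^+ size s * partials s phi (x' - (y + w))) =
      (fun w => (-1) ^+ size s * partials s phi (x' + (- w) - y))); last first.
      by apply/funext => w; rewrite opprD (addrC (- y)) addrA.
    rewrite (posfunZ pI); last first.
      have := tame_isometry (B := - 1%:M) _ (leqnn n) ts.
      under eq_fun do rewrite mulmxN mulmx1.
      by apply; rewrite linearN /= trmx1 mulNmx mulmxN mulmx1 opprK.
    rewrite (planes_mean_reflect ts) /L; congr (_ * planes_mean d mu _).
    apply/funext => z; have [zN|zN] := leP (enorm (x' + z)) N'; first by rewrite cutoff1// mul1r.
    rewrite (partials_vanish s sphi phir) ?mulr0//.
    have := ler_enorm_dist (x' + z) y; have := hK _ Ky.
    by move: zN; rewrite gt_max => /andP[_]; lra.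
  have NG : U G = 0 := NU0 sP (supp x xr).
  rewrite normr_le0 subr_eq0 NG => /eqP h; rewrite h /L; congr planes_mean; apply/funext => z.
  rewrite addrA -/x'; have [zN|zN] := leP (enorm (x' + z)) N'; first by rewrite cutoff1// mul1r.
  by rewrite tN// mulr0.
have r20 : 0 < rho / 2 by rewrite divr_gt0.
move=> x; have -> : x = v + (x - v) by rewrite addrC subrK.
apply: (real_unique_continuation d0 dn rmu od r20 (fast_shift v (fast_compact cf hN))) => //.
move=> y yr; apply: U0; last exact: supp.
by have [] := partials_reflect (v + y) sphi.
Qed.

(** For a mollifier phi of small support the convolution of U with phi is zero,
    while psi is within e of an average of translates of phi; then
    [functional_swap] gives |U psi| <= C e. *)
Lemma real_dist_unique_continuation psi : real_smooth psi -> U psi = 0.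
Proof.
move=> spsi; apply: (@small_eq _ _ _ C) => e e0; rewrite subr0 mulrC.
have cpsi : continuous psi := real_smooth_cont (s := [::]) spsi.
have [|s|del del0 hdel] := @uniform_order R n
  (fun s d => forall y w, K y -> enorm w < d -> `|partials s psi y - partials s psi (y + w)| <= e) m.
- by move=> s a b b0 ba h y w Ky wb; apply: h => //; exact: lt_le_trans ba.
- have [a a0 h] := unif_cont cK (fun y _ => real_smooth_cont (s := s) spsi (x := y)) e0.
  exists a => // y w Ky wa; apply: ltW; apply: h => //.
  by rewrite opprD addrA subrr add0r enormN.
pose r := Num.min del rho / 4.
have m0 : 0 < Num.min del rho by rewrite lt_min del0.
have r0 : 0 < r by rewrite divr_gt0.
have [rd rr] : Num.min del rho <= del /\ Num.min del rho <= rho.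
  by rewrite !ge_min !lexx orbT.
have rdel : r < del by rewrite /r; lra.
have rrho : r < rho / 2 by rewrite /r; lra.
have [phi [sphi phi0 phi1 phir ps]] := mollifier_exists r0.
have f0 := smoothed_zero sphi rrho phir.
have [rK hK] := K_bounded; pose N := r + rK.
pose a w := psi w * cutoff N w.
have aN w : N + 1 < enorm w -> a w = 0 by move=> wN; rewrite /a cutoff_out// mulr0.
have ca : continuous a by apply: contM => //; exact: cutoff_cont.
have := @functional_swap _ _ U K m C Ulin C0 Ubound phi r sphi phir (@space_int R n) a (N + 1) psi e
  (@space_int_posfun R n) ca aN spsi (ltW e0).
have -> : (fun w => a w * smoothed U phi w) = fun=> 0.
  by apply/funext => w; rewrite f0 mulr0.
rewrite (posfun0 (@space_int_posfun R n)) subr0; apply => s y sm Ky.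
have -> : (fun w => a w * partials s phi (w - y)) = (fun w => psi w * partials s phi (w - y)).
  apply/funext => w; have [wN|wN] := leP (enorm w) N; first by rewrite /a cutoff1// mulr1.
  rewrite (partials_vanish s sphi phir) ?mulr0//.
  by have := ler_enorm_dist w y; have := hK _ Ky; rewrite /N in wN; lra.
apply: (mollify_dist spsi sphi phi0 phi1 phir ps) => w wr.
by apply: hdel => //; exact: le_lt_trans rdel.
Qed.

End RealDistributions.

(** * Unique continuation for complex distributions *)

Section ComplexDistributions.
Local Open Scope complex_scope.
Variables (R : realType) (n d : nat).
Hypotheses (d0 : (0 < d)%N) (dn : (d < n)%N) (od : odd d).
Implicit Types (f g : 'rV[R]_n -> R).
Variable mu : probability (borel_matrix R n) R.
Hypothesis rmu : rotation_invariant d mu.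

Definition complexify f : 'rV[R]_n -> R[i] := fun x => (f x)%:C.

Lemma complexify_smooth f : real_smooth f -> smooth (complexify f).
Proof. by move=> sf; split=> //; exact: real_smooth0. Qed.

Lemma complex_partials_complexify s f x :
  complex_partials s (complexify f) x = (partials s f x)%:C.
Proof.
rewrite /complex_partials /complexify /=; congr (_ +i* _).
suff [-> _] : (forall s, partials s (fun _ : 'rV[R]_n => 0 : R) = (fun=> 0)) /\
  real_smooth (fun _ : 'rV[R]_n => 0 : R) by [].
by apply: (real_smooth_intro (F := fun _ _ => 0)) => // [s'|s' i y];
  [exact: contC|exact: has_pd_cst].
Qed.

Lemma complexify_test (V : set 'rV[R]_n) f v r : real_smooth f ->
  (forall y, r < enorm (y - v) -> f y = 0) -> (forall y, enorm (y - v) <= r -> V y) ->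
  test_function V (complexify f).
Proof.
move=> sf fr rV; have sub : Defs.support (complexify f) `<=` eball v r.
  have cl := @closed_eball R n v r.
  rewrite /eball ((closure_id _).1 cl); apply: closureS.
  move=> y; rewrite /eball /=; apply: contraNle => /fr h; rewrite /complexify h.
  exact: eqxx.
split; first exact: complexify_smooth.
  exact: (subclosed_compact (@closed_closure _ _) (@compact_eball R n v r)).
by move=> y /sub; exact: rV.
Qed.

Lemma normal_operator_complexify f : tame f ->
  normal_operator d mu (complexify f) =
  complexify (fun y => planes_mean d mu (fun z => f (y + z))).
Proof.
move=> tf; apply/funext => x; rewrite normal_operatorE//; last exact: tame0.
by rewrite /complexify /= (posfun0 (planes_mean_posfun dn rmu)).
Qed.

(** The real and imaginary parts of u on real functions are real distributions.
    Real functions suffice because u is complex linear. *)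
Lemma distribution_unique_continuation (u : ('rV[R]_n -> R[i]) -> R[i]) (V : set 'rV[R]_n) :
  open V -> V !=set0 -> compactly_supported_distribution u ->
  dist_vanishes_on V (dist_normal_operator d mu u) -> dist_vanishes_on V u ->
  forall phi, smooth phi -> u phi = 0.
Proof.
move=> oV [v Vv] [ulin [K [m [C [cK ubd]]]]] hN hu.
have /nbhs_enormP[rho rho0 hrho] : nbhs v V by exact: open_nbhs_nbhs.
have r20 : 0 < rho / 2 by rewrite divr_gt0.
have test f : real_smooth f -> (forall y, rho / 2 <= enorm (y - v) -> f y = 0) ->
    test_function V (complexify f).
  move=> sf fr; apply: (@complexify_test _ _ v (rho / 2)) => //.
    by move=> y /ltW /fr.
  by move=> y yr; apply: hrho; rewrite enormB; lra.
have key (part : R[i] -> R) : (forall (a : R) z w, part (a%:C * z + w) = a * part z + part w) ->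
    (forall z (M : R), `|z| <= M%:C -> `|part z| <= M) ->
    forall f, real_smooth f -> part (u (complexify f)) = 0.
  move=> plin pbd.
  have p0 : part 0 = 0 by have := plin (-1) 0 0; rewrite mulr0 addr0 => h; lra.
  apply: (@real_dist_unique_continuation _ _ _ d0 dn od mu rmu (fun f => part (u (complexify f)))
    K m `|C| _ cK (normr_ge0 C) _ v _ r20).
  - move=> a f g sf sg; rewrite -plin -ulin; [|exact: complexify_smooth|exact: complexify_smooth].
    congr (part (u _)); apply/funext => x; rewrite /complexify rmorphD rmorphM//.
  - move=> f M sf M0 h; apply: pbd; apply: le_trans (ubd _ M _ M0 _) _.
    + exact: complexify_smooth.
    + move=> s x sm Kx; rewrite complex_partials_complexify.
      have := norm_complex_le (z := (partials s f x)%:C) (h s x sm Kx) (N := 0).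
      by rewrite addr0 /= normr0; apply.
    + by rewrite lecR ler_wpM2r// ler_norm.
  - by move=> f sf fr; rewrite hu ?p0//; exact: test.
  - move=> f sf fr; have := hN _ (test f sf fr).
    rewrite /dist_normal_operator /dist_plane_adjoint /dist_plane_transform.
    rewrite -/(normal_operator d mu (complexify f)) normal_operator_complexify ?p0 => [->//|].
    apply: (tame_compact (M := rho / 2 + enorm v)).
      exact: (real_smooth_cont (s := [::]) sf).
    by move=> x xr; apply: fr; have := ler_enorm_dist x v; lra.
have u0 f : real_smooth f -> u (complexify f) = 0.
  move=> sf; apply: complex_eq0.
    apply: (key (@complex.Re R)) => // [a [z1 z2] [w1 w2]|]; last exact: norm_Re_le.
    by rewrite /= mul0r subr0.
  apply: (key (@complex.Im R)) => // [a [z1 z2] [w1 w2]|]; last exact: norm_Im_le.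
  by rewrite /= mul0r addr0.
move=> phi [sR sI].
have -> : phi = fun x => 'i * complexify (fun x => complex.Im (phi x)) x +
                         complexify (fun x => complex.Re (phi x)) x.
  apply/funext => x; rewrite /complexify; case: (phi x) => a b /=.
  by apply/eqP; rewrite eq_complex /=; apply/andP; split; apply/eqP; ring.
rewrite (ulin 'i _ _ (complexify_smooth sI) (complexify_smooth sR)).
by rewrite (u0 _ sI) (u0 _ sR) mulr0 addr0.
Qed.

End ComplexDistributions.

Theorem corollary1p3 (R : realType) (n d : nat)
    (mu : probability (borel_matrix R n) R) (V : set 'rV[R]_n) :
  (2 <= n)%N -> odd d -> (0 < d < n)%N ->
  rotation_invariant d mu ->
  open V -> V !=set0 ->
  (forall u : ('rV[R]_n -> R[i]) -> R[i],
     compactly_supported_distribution u ->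
     dist_vanishes_on V (dist_normal_operator d mu u) ->
     dist_vanishes_on V u ->
     forall phi : 'rV[R]_n -> R[i], smooth phi -> u phi = 0) /\
  (forall f : 'rV[R]_n -> R[i],
     C_infty f ->
     (forall x, V x -> normal_operator d mu f x = 0) ->
     (forall x, V x -> f x = 0) ->
     forall x, f x = 0).
Proof.
move=> _ od /andP[d0 dn] rmu oV V0; split=> [u csu Nu uV|f fC Nf fV].
  exact: (distribution_unique_continuation d0 dn od rmu oV V0 csu Nu uV).
exact: (function_unique_continuation d0 dn rmu od oV V0 fC Nf fV).
Qed.
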